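(* Consider the random walk $(X_t,V_t,t)_{t\ge 0}$ in a rotational environment defined in the context. For every $\omega>0$: (i) $d_r(X_t)\to\infty$ as $t\to\infty$, almost surely and in probability; (ii) $V_t/F_\omega(X_t)\to 1$ as $t\to\infty$, almost surely and in probability, in the sense that $\dfrac{\|V_t-F_\omega(X_t)\|}{\|F_\omega(X_t)\|}\to 0$; (iii) there exists a value $\beta>0$ such that, with $X_n$ denoting the position at the $n$-th collision, $$\mathbb{P}\left(\liminf_{n\to\infty}\{d_r(X_n)>\beta n\}\right)=1,$$ where for events $(A_n)_n$, $\liminf_{n\to\infty}A_n=\bigcup_{n=1}^{\infty}\bigcap_{m>n}A_m$.
   Context: Notation: $\|\cdot\|$ is the Euclidean norm on $\mathbb{R}^3$, $B(x,r)$ is the open Euclidean ball, and $d_r(x)=\sqrt{x_1^2+x_2^2}$ for $x=(x_1,x_2,x_3)\in\mathbb{R}^3$ (radial distance). For $\omega>0$ (the angular velocity of the medium) let $F_\omega(y)=(-\omega y_2,\omega y_1,0)$, the velocity field of the rotating medium. Randomness: fix $\lambda>0$ and $\sigma>0$. Let $(\eta_k)_k,(\Delta_k)_k,(\xi_k)_k$ be mutually independent sequences such that: $(\eta_k)$ is i.i.d. with values in $B(0,1)\subset\mathbb{R}^3$ and its law has support with non-empty interior; $(\Delta_k)$ is i.i.d. in $\mathbb{R}^3$ with law $\mathcal{N}(0,\sigma^2)$ (centered Gaussian with covariance $\sigma^2 I$); $(\xi_k)$ is i.i.d. exponential with rate $\lambda$, i.e. $\mathbb{P}(\xi_k>s)=e^{-\lambda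 s}$. For a nonzero $u\in\mathbb{R}^3$, $R_u$ is a $3\times3$ rotation matrix (preserving angles and orientation) sending $(1,0,0)$ to $u/\|u\|$ (a fixed measurable choice $u\mapsto R_u$). Dynamics: the particle starts at time $T_0=0$ with $X_0=x_0\in\mathbb{R}^3$, $V_0=v_0\in\mathbb{R}^3$. For $x,v\in\mathbb{R}^3$ define $$D^{\omega}_{x,v}(t)=\int_0^t\|v-F_\omega(x+sv)\|\,ds .$$ Given the state $(X_k,V_k,T_k)$ after the $k$-th collision, the next collision time is $T_{k+1}=T_k+[D^{\omega}_{X_k,V_k}]^{-1}(\xi_k)$; for $t\in[T_k,T_{k+1}]$ the position is $X_t=X_k+(t-T_k)V_k$, and the velocity is $V_t=V_k$ for $t\in[T_k,T_{k+1})$. At time $T_{k+1}$ the position is $X_{k+1}=X_{T_{k+1}}$ and the new velocity is $$V_{k+1}=\|w\|\,R_{w}\,\eta_{k+1}+F_\omega(X_{k+1})+\Delta_{k+1},\qquad w=V_k-\big(F_\omega(X_{k+1})+\Delta_{k+1}\big).$$ By abuse of notation $X_k=X_{T_k}$ and $V_k=V_{T_k}$ for integer index $k$ (collision index).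
   Formalization: The starting state with x_0 on the rotation axis and v_0 = 0 is excluded: there D^ω_{x_0,v_0} is identically zero, so its inverse, and hence the first collision time and the process, are undefined (the particle would rest forever and (i) would fail). *)

(* Defs.v *)
(* MathComp-Analysis; points and velocities of R^3 are column vectors 'cV[R]_3. *)
From mathcomp Require Import all_boot all_order all_algebra.
From mathcomp Require Import all_classical all_reals all_analysis.

Set Implicit Arguments.
Unset Strict Implicit.
Unset Printing Implicit Defensive.

Import Order.TTheory GRing.Theory Num.Theory.
Import numFieldNormedType.Exports.

Local Open Scope classical_set_scope.
Local Open Scope ring_scope.

(* T with its Borel sigma-algebra. Matrices have no measurable structure in the
   library; the type is convertible to T itself. *)
Notation borel T := (g_sigma_algebraType (@open T)).

Section Geometry.
Variable R : realType.
Implicit Types (x y u v : 'cV[R]_3) (om t : R).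

(* The library norm `|x| on matrices is the sup norm, hence this one. *)
Definition enorm x : R := Num.sqrt (\sum_i x i 0 ^+ 2).

Definition radial x : R := Num.sqrt (x 0 0 ^+ 2 + x 1 0 ^+ 2).

Definition vec3 (a b c : R) : 'cV[R]_3 := \col_i [:: a; b; c]`_i.

Definition rotfield om y : 'cV[R]_3 := vec3 (- om * y 1 0) (om * y 0 0) 0.

Definition is_rotation (M : 'M[R]_3) : Prop := M^T *m M = 1%:M /\ \det M = 1.

(* A measurable choice of rotations u |-> R_u on the nonzero vectors. The value
   at 0 is arbitrary: the dynamics only uses R_w after scaling by ||w||. *)
Definition rotation_choice (rot : 'cV[R]_3 -> 'M[R]_3) : Prop :=
  measurable_fun ([set u | u != 0] : set (borel 'cV[R]_3))
    (rot : borel 'cV[R]_3 -> borel 'M[R]_3) /\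
  forall u, u != 0 ->
    is_rotation (rot u) /\ rot u *m vec3 1 0 0 = (enorm u)^-1 *: u.

Definition rel_dist om x v t : R :=
  \int[lebesgue_measure]_(s in `[0, t]) enorm (v - rotfield om (x + s *: v)).

(* The inverse of rel_dist om x v : [0, +oo[ -> [0, +oo[. This map is a
   bijection unless v = 0 and radial x = 0, in which case it vanishes. *)
Definition free_time om x v : R -> R :=
  'pinv_(fun=> 0) `[0, +oo[ (rel_dist om x v).

(* Velocity after a collision at x of a particle of velocity v. *)
Definition collide om (rot : 'cV[R]_3 -> 'M[R]_3) x v (eta delta : 'cV[R]_3) :
    'cV[R]_3 :=
  let m := rotfield om x + delta in
  let w := v - m in
  enorm w *: (rot w *m eta) + m.

End Geometry.

Section Dynamics.
Context {R : realType}.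
Variables (om : R) (rot : 'cV[R]_3 -> 'M[R]_3) (x0 v0 : 'cV[R]_3).
Variables (eta delta : nat -> 'cV[R]_3) (xi : nat -> R).

(* (X_k, V_k, T_k) *)
Fixpoint walk (k : nat) : 'cV[R]_3 * 'cV[R]_3 * R :=
  if k is k'.+1 then
    let: (x, v, t) := walk k' in
    let tau := free_time om x v (xi k') in
    let x' := x + tau *: v in
    (x', collide om rot x' v (eta k) (delta k), t + tau)
  else (x0, v0, 0).

Definition walk_pos k := (walk k).1.1.
Definition walk_vel k := (walk k).1.2.
Definition walk_time k := (walk k).2.

(* The k with T_k <= t < T_(k+1), unique when it exists since T is
   nondecreasing; 0 when t is not below sup_k T_k. *)
Definition last_collision (t : R) : nat :=
  xget 0%N [set k | walk_time k <= t < walk_time k.+1].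

Definition path_pos (t : R) : 'cV[R]_3 :=
  let k := last_collision t in
  walk_pos k + (t - walk_time k) *: walk_vel k.

Definition path_vel (t : R) : 'cV[R]_3 := walk_vel (last_collision t).

End Dynamics.

Section Probability.
Context {d : measure_display} {T : measurableType d} {R : realType}.
Variable P : probability T R.

Definition independent_seq {d'} {T' : measurableType d'}
    (X : nat -> {RV P >-> T'}) : Prop :=
  forall (s : seq nat) (A : nat -> set T'), uniq s ->
    (forall k, measurable (A k)) ->
    P (\bigcap_(k in [set` s]) (X k @^-1` A k)) =
    (\prod_(k <- s) P (X k @^-1` A k))%E.

Definition iid {d'} {T' : measurableType d'} (X : nat -> {RV P >-> T'}) : Prop :=
  independent_seq X /\
  forall k A, measurable A -> distribution P (X k) A = distribution P (X 0) A.

Definition sigma_seq {d'} {T' : measurableType d'} (X : nat -> {RV P >-> T'}) :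
    set (set T) :=
  <<s \bigcup_k preimage_set_system setT (X k) measurable >>.

(* Taking one of the events to be setT gives pairwise independence. *)
Definition independent3 (E F G : set (set T)) : Prop :=
  forall A B C, E A -> F B -> G C ->
    P (A `&` B `&` C) = (P A * P B * P C)%E.

Definition has_law {d'} {T' : measurableType d'} (X : {RV P >-> T'})
    (mu : set T' -> \bar R) : Prop :=
  forall A, measurable A -> distribution P X A = mu A.

Definition cvg_in_prob (Y : R -> T -> R) (l : R) : Prop :=
  forall e : R, 0 < e -> P [set w | e < `|Y t w - l|] @[t --> +oo] --> 0%E.

Definition cvg_in_prob_pinfty (Y : R -> T -> R) : Prop :=
  forall M : R, P [set w | Y t w <= M] @[t --> +oo] --> 0%E.

Definition liminf_events (A : nat -> set T) : set T :=
  \bigcup_(n in [set n | (1 <= n)%N]) \bigcap_(m in [set m | (n < m)%N]) A m.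

End Probability.

Definition msupport {U : topologicalType} {R : realType} (mu : set U -> \bar R) :
    set U :=
  [set x | forall O, open O -> O x -> (0 < mu O)%E].

(* N(0, s^2 I), as the product of three laws N(0, s^2); the second parameter of
   normal_prob is the standard deviation. *)
Definition gaussian3 {R : realType} (s : R) (A : set 'cV[R]_3) : \bar R :=
  ((normal_prob 0 s \x normal_prob 0 s) \x normal_prob 0 s)%E
    [set p | A (vec3 p.1.1 p.1.2 p.2)].

(* Main.v *)
(* In the frame rotating with the medium, write u = V - F(X), a = |u| and rho = om d_r(X).
   During a free flight a^2 - rho^2 is constant and |rho' - rho| <= om xi; a collision turns
   a into at most |eta| a + 2 |Delta|. So the chain of pre-collision states is governed by
   (rho, a).

   Escape. The function h = (2 - kap) rho - (1 - kap) sqrt(rho^2 + a^2) <= rho drifts upwards: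
   up to the noise, a collision decreases the square root, and when a is small compared with
   rho a flight changes h by about kap (rho' - rho), which the centrifugal effect pushes up.
   Outside a compact set of (rho, a) this gives E exp(-th h') <= gam exp(-th h) with gam < 1;
   on the compact set one strong kick followed by a long flight escapes with a probability
   bounded below, which is enough once the exponential is flattened for large values.
   Hence the flattened exponential decays geometrically in mean along the chain, and
   Borel-Cantelli gives rho_n >= beta n eventually.

   Speed. q = a^2 / (M + rho) satisfies q' <= (1 + z/M) (1 + de) e^2 q + noise, so E q_n^2 is
   bounded and q_n = o(n) almost surely; thus a_n = o(rho_n), and also the n-th noise is
   o(rho_n). A flight then lasts at least c ln(rho_(n+1) / rho_n), so collision times tend to
   infinity by telescoping, and the estimates extend to all times by conservation of
   a^2 - rho^2. *)
Require Import Defs.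
From mathcomp Require Import all_boot all_order all_algebra.
From mathcomp Require Import all_classical all_reals all_analysis.
From mathcomp Require Import measurable_realfun ring lra.
Import Order.TTheory GRing.Theory Num.Theory.
Import numFieldNormedType.Exports.
Local Open Scope classical_set_scope.
Local Open Scope ring_scope.

Set Implicit Arguments.
Unset Strict Implicit.
Unset Printing Implicit Defensive.

(** * Independence and the Markov property *)

(** The critical scale is [a] of order [sqrt rho]. There [nrm2] exceeds [rho] by about a^2 / (2
    rho). Up to noise, a collision lowers [nrm2] by the fraction 1 - |eta|^2 of this quantity, while
    the next flight, by conservation, can move inwards by at most the fraction |eta|^2 of it. Since
    [h] gives the weight 1 - kap to the first effect and kap to the second, the gain wins in mean
    for small kap. When [a] is much smaller, both effects vanish and only the centrifugal push is
    left, which is seen because kap is positive. When [a] is much larger, the speed lost in one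
    collision raises [h] by a large amount. Hence three regimes outside the compact set.

    The norm of eta is below 1 but may come arbitrarily close to 1, so no gain is certain: each one
    is claimed on an event whose probability is bounded below by a constant, and all errors are paid
    by exponential moments of the noise. This is why the pointwise bounds have the form constant,
    minus an indicator, plus an exponential of the noise. *)

Lemma measurable_preimage d1 d2 (E1 : measurableType d1) (E2 : measurableType d2)
    (f : E1 -> E2) A :
  measurable_fun setT f -> measurable A -> measurable (f @^-1` A).
Proof. by move=> mf mA; rewrite -[X in measurable X]setTI; exact: mf. Qed.

Section product_uniqueness.
Local Open Scope ereal_scope.
Context d1 d2 (T1 : measurableType d1) (T2 : measurableType d2) (R : realType).

(** Measurable rectangles are stable under intersection and generate the product sigma-algebra.
    Exhausting the space by the constant sequence [setT] asks only that [m1] be finite, so [m1] may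
    be the law of a pair restricted to an event. *)
Lemma finite_measure_prod_unique (m1 m2 : {measure set (T1 * T2) -> \bar R}) :
  m1 setT < +oo ->
  (forall A B, measurable A -> measurable B -> m1 (A `*` B) = m2 (A `*` B)) ->
  forall X, measurable X -> m1 X = m2 X.
Proof.
move=> m1oo m12 X mX.
pose C : set (set (T1 * T2)) :=
  [set C | exists A, measurable A /\ exists B, measurable B /\ C = A `*` B].
apply: (@measure_unique _ R _ C (fun=> setT)) => //.
- rewrite measurable_prod_measurableType //; congr (<<s _ >>).
  rewrite predeqE; split => [[A mA [B mB <-]]|[A [mA [B [mB ->]]]]].
    by exists A; split => //; exists B.
  by exists A => //; exists B.
- move=> /= _ _ [X1 [mX1 [X2 [mX2 ->]]]] [Y1 [mY1 [Y2 [mY2 ->]]]].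
  rewrite -setXI; exists (X1 `&` Y1); split; first exact: measurableI.
  by exists (X2 `&` Y2); split => //; exact: measurableI.
- by move=> _; exists setT; split => //; exists setT; split => //; rewrite setXTT.
- exact: bigcup_const.
- by move=> A [A1 [mA1 [A2 [mA2 ->]]]]; exact: m12.
Qed.

End product_uniqueness.

Section independence.
Local Open Scope ereal_scope.
Context d (T : measurableType d) (R : realType) (P : probability T R).

(** Independence from a single event, with no sigma-algebra attached. The event will be a cylinder
    of later innovations, and such statements propagate by induction along the chain. *)
Definition indep_event d' (E : measurableType d') (f : T -> E) (J : set T) :=
  forall A, measurable A -> P (f @^-1` A `&` J) = P (f @^-1` A) * P J.

(** As functions of the set of values, both sides are finite measures, so rectangles suffice. There
    [f] splits off from the constraint on [g] together with [J], then [g] from [J], and the product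
    is reassembled by the independence of [f] and [g]. *)
Lemma indep_event_pair d1 d2 (E1 : measurableType d1) (E2 : measurableType d2)
    (f : T -> E1) (g : T -> E2) (J : set T) :
  measurable_fun setT f -> measurable_fun setT g -> measurable J ->
  (forall B, measurable B -> indep_event f (g @^-1` B)) ->
  (forall B, measurable B -> indep_event f (g @^-1` B `&` J)) ->
  indep_event g J -> indep_event (fun w => (f w, g w)) J.
Proof.
move=> mf mg mJ fg fgJ gJ.
have mfg : measurable_fun setT (fun w => (f w, g w)) by exact: measurable_fun_pair.
have PJ0 : (0 <= fine (P J))%R by rewrite fine_ge0.
have PJ : P J = (fine (P J))%:E by rewrite fineK // fin_num_measure.
pose h : {mfun T >-> (E1 * E2)%type} := mfun_Sub (mem_set mfg).
move=> X mX.
have -> : P ((fun w => (f w, g w)) @^-1` X `&` J) = pushforward (mrestr P mJ) h X by [].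
have -> : P ((fun w => (f w, g w)) @^-1` X) * P J = mscale (NngNum PJ0) (pushforward P h) X.
  by rewrite /mscale /= muleC {1}PJ.
apply: finite_measure_prod_unique => //.
  rewrite /= /pushforward /mrestr /= preimage_setT setTI.
  by rewrite (le_lt_trans (probability_le1 P mJ))// ltry.
move=> A B mA mB.
rewrite /= /pushforward /mrestr /mscale /= -PJ muleC.
rewrite (_ : pushforward P _ _ = P (f @^-1` A `&` g @^-1` B)) //.
by rewrite -setIA fgJ // fg // gJ // muleA.
Qed.

Lemma indep_event_comp d1 d2 (E1 : measurableType d1) (E2 : measurableType d2)
    (f : T -> E1) (phi : E1 -> E2) (J : set T) :
  measurable_fun setT phi -> indep_event f J -> indep_event (phi \o f) J.
Proof.
by move=> mphi fJ A mA; rewrite comp_preimage; apply: fJ; exact: measurable_preimage.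
Qed.

Definition indep3_event d1 d2 d3 (Z1 : measurableType d1) (Z2 : measurableType d2)
    (Z3 : measurableType d3) (z1 : T -> Z1) (z2 : T -> Z2) (z3 : T -> Z3) (J : set T) :=
  forall B1 B2 B3, measurable B1 -> measurable B2 -> measurable B3 ->
  P (z1 @^-1` B1 `&` (z2 @^-1` B2 `&` (z3 @^-1` B3 `&` J))) =
  P (z1 @^-1` B1) * P (z2 @^-1` B2) * P (z3 @^-1` B3) * P J.

Lemma indep_event_triple d1 d2 d3 (Z1 : measurableType d1) (Z2 : measurableType d2)
    (Z3 : measurableType d3) (z1 : T -> Z1) (z2 : T -> Z2) (z3 : T -> Z3) (J : set T) :
  measurable_fun setT z1 -> measurable_fun setT z2 -> measurable_fun setT z3 ->
  measurable J ->
  indep3_event z1 z2 z3 setT -> indep3_event z1 z2 z3 J ->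
  indep_event (fun w => (z1 w, z2 w, z3 w)) J.
Proof.
move=> m1 m2 m3 mJ HT HJ.
have P1 (U : Type) (f : T -> U) : P (f @^-1` setT) = 1 by rewrite preimage_setT probability_setT.
have E23 B2 B3 : measurable B2 -> measurable B3 ->
    P (z2 @^-1` B2 `&` (z3 @^-1` B3 `&` J)) = P (z2 @^-1` B2) * P (z3 @^-1` B3) * P J.
  move=> mB2 mB3; have := HJ setT B2 B3 measurableT mB2 mB3.
  by rewrite P1 mul1e preimage_setT setTI.
have E3 B3 : measurable B3 -> P (z3 @^-1` B3 `&` J) = P (z3 @^-1` B3) * P J.
  move=> mB3; have := E23 setT B3 measurableT mB3.
  by rewrite P1 mul1e preimage_setT setTI.
have E12 B1 B2 : measurable B1 -> measurable B2 ->
    P (z1 @^-1` B1 `&` z2 @^-1` B2) = P (z1 @^-1` B1) * P (z2 @^-1` B2).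
  move=> mB1 mB2; have := HT B1 B2 setT mB1 mB2 measurableT.
  by rewrite preimage_setT !setIT probability_setT !mule1.
have E123 B1 B2 B3 : measurable B1 -> measurable B2 -> measurable B3 ->
    P (z1 @^-1` B1 `&` (z2 @^-1` B2 `&` z3 @^-1` B3)) =
    P (z1 @^-1` B1) * P (z2 @^-1` B2) * P (z3 @^-1` B3).
  move=> mB1 mB2 mB3; have := HT B1 B2 B3 mB1 mB2 mB3.
  by rewrite setIT probability_setT mule1.
have E23' B2 B3 : measurable B2 -> measurable B3 ->
    P (z2 @^-1` B2 `&` z3 @^-1` B3) = P (z2 @^-1` B2) * P (z3 @^-1` B3).
  move=> mB2 mB3; have := E123 setT B2 B3 measurableT mB2 mB3.
  by rewrite P1 mul1e preimage_setT setTI.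
apply: indep_event_pair => //.
- exact: measurable_fun_pair.
- move=> B3 mB3; apply: indep_event_pair => //.
  + exact: measurable_preimage.
  + by move=> B2 mB2 B1 mB1; exact: E12.
  + by move=> B2 mB2 B1 mB1; rewrite E123 // E23' // muleA.
  + by move=> B2 mB2; exact: E23'.
- move=> B3 mB3; apply: indep_event_pair => //.
  + by apply: measurableI => //; exact: measurable_preimage.
  + by move=> B2 mB2 B1 mB1; exact: E12.
  + by move=> B2 mB2 B1 mB1; rewrite HJ // E23 // !muleA.
  + by move=> B2 mB2; rewrite E23 // E3 // muleA.
Qed.

End independence.

Section markov.
Local Open Scope ereal_scope.
Context d (T : measurableType d) (R : realType) (P : probability T R).
Context d1 d2 d3 (Z1 : measurableType d1) (Z2 : measurableType d2)
  (Z3 : measurableType d3).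
Variables (z1 : nat -> T -> Z1) (z2 : nat -> T -> Z2) (z3 : nat -> T -> Z3).
Hypothesis mz1 : forall k, measurable_fun setT (z1 k).
Hypothesis mz2 : forall k, measurable_fun setT (z2 k).
Hypothesis mz3 : forall k, measurable_fun setT (z3 k).

(** Constraints on the innovations of indices [k] to [n - 1]; the cylinder is [setT] when
    [n <= k]. *)
Definition cyl (A : nat -> set Z1) (B : nat -> set Z2) (C : nat -> set Z3) k n : set T :=
  \big[setI/setT]_(k <= j < n)
    (z1 j @^-1` A j `&` (z2 j @^-1` B j `&` z3 j @^-1` C j)).

Definition mseq (A : nat -> set Z1) (B : nat -> set Z2) (C : nat -> set Z3) :=
  forall j, [/\ measurable (A j), measurable (B j) & measurable (C j)].

Lemma measurable_cyl A B C k n : mseq A B C -> measurable (cyl A B C k n).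
Proof.
move=> ABC; apply: bigsetI_measurable => j _; have [mA mB mC] := ABC j.
by do 2?apply: measurableI => //; exact: measurable_preimage.
Qed.

(** The only form in which independence enters the Markov property: the three innovations of index
    [k] against each other and against cylinders of later indices. *)
Definition indep_innov := forall A B C k n, mseq A B C ->
  indep3_event P (z1 k) (z2 k) (z3 k) (cyl A B C k.+1 n).

Hypothesis innov : indep_innov.

Context d4 (E : measurableType d4) (S : nat -> T -> E)
  (step : nat -> E * ((Z1 * Z2) * Z3) -> E) (s0 : E).
Let z k w := (z1 k w, z2 k w, z3 k w).
Hypothesis mstep : forall k, measurable_fun setT (step k).
Hypothesis stepE : forall k w, S k.+1 w = step k (S k w, z k w).
Hypothesis S0E : forall w, S 0 w = s0.

Let mz k : measurable_fun setT (z k).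
Proof. by apply: measurable_fun_pair => //; exact: measurable_fun_pair. Qed.

Lemma measurable_chain k : measurable_fun setT (S k).
Proof.
elim: k => [|k IH]; first by rewrite (_ : S 0 = cst s0) //; exact/funext.
rewrite (_ : S k.+1 = step k \o (fun w => (S k w, z k w))).
  by apply: measurableT_comp => //; exact: measurable_fun_pair.
by apply/funext => w /=; exact: stepE.
Qed.

Let innovT k : indep3_event P (z1 k) (z2 k) (z3 k) setT.
Proof.
have m : mseq (fun=> setT) (fun=> setT) (fun=> setT) by [].
by have := @innov _ _ _ k 0%N m; rewrite /cyl big_geq.
Qed.

(** [S k] depends on earlier innovations only. Instead of their sigma-algebra, the induction carries
    independence from all later cylinders: [S k.+1] is a function of [S k] and [z k], and every
    event needed at stage [k.+1] is a cylinder from [k] on, with suitable sets at index [k]. *)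
Lemma chain_indep k A B C n : mseq A B C -> indep_event P (S k) (cyl A B C k n).
Proof.
elim: k A B C n => [|k IH] A B C n ABC.
  move=> D mD; rewrite (_ : S 0 @^-1` D = if s0 \in D then setT else set0).
    by case: ifP => _; rewrite ?setTI ?probability_setT ?mul1e ?set0I ?measure0 ?mul0e.
  apply/seteqP; split => w /=; rewrite S0E; case: ifPn; rewrite ?inE ?notin_setE //.
have mSk := measurable_chain k.
have mJ m := measurable_cyl k.+1 m ABC.
have SJ m : indep_event P (S k) (cyl A B C k.+1 m).
  (* Trivial constraints up to [k] turn a cylinder from [k.+1] into one from [k], to which the
     induction hypothesis applies. *)
  pose A' j := if (j <= k)%N then setT else A j.
  pose B' j := if (j <= k)%N then setT else B j.
  pose C' j := if (j <= k)%N then setT else C j.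
  have ABC' : mseq A' B' C' by move=> j; rewrite /A' /B' /C'; case: ifP => // _; exact: ABC.
  rewrite (_ : cyl A B C k.+1 m = cyl A' B' C' k m); first exact: IH.
  have -> : cyl A B C k.+1 m = cyl A' B' C' k.+1 m.
    rewrite /cyl; apply: eq_big_nat => j /andP[kj _].
    by rewrite /A' /B' /C' leqNgt kj.
  have [km|km] := ltnP k m; last by rewrite /cyl !big_geq // leqW.
  by rewrite [in RHS]/cyl big_ltn // /A' /B' /C' leqnn !preimage_setT !setTI.
have zSJ A0 m : measurable A0 ->
    indep_event P (z k) (S k @^-1` A0 `&` cyl A B C k.+1 m).
  move=> mA0; apply: indep_event_triple => //.
    by apply: measurableI => //; exact: measurable_preimage.
  move=> B1 B2 B3 mB1 mB2 mB3.
  (* The box for [z k] is inserted at index [k], again producing a cylinder from [k]. *)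
  pose A' j := if j == k then B1 else A j.
  pose B' j := if j == k then B2 else B j.
  pose C' j := if j == k then B3 else C j.
  have ABC' : mseq A' B' C' by move=> j; rewrite /A' /B' /C'; case: ifP => // _; exact: ABC.
  have [km|km] := ltnP k m; last first.
    (* When [m <= k] the cylinder from [k] to [m] would not see index [k], so the upper end is taken
       to be [k.+1]. *)
    rewrite [cyl _ _ _ _ _]big_geq ?leqW // setIT.
    have := IH A' B' C' k.+1 ABC' A0 mA0.
    rewrite /cyl big_ltn // big_geq // setIT /A' /B' /C' eqxx => H.
    rewrite (_ : _ `&` _ = S k @^-1` A0 `&` (z1 k @^-1` B1 `&` (z2 k @^-1` B2 `&` z3 k @^-1` B3))).
      rewrite H; have := innovT k mB1 mB2 mB3.
      by rewrite setIT probability_setT mule1 => ->; rewrite muleC.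
    by apply/seteqP; split => w /=; tauto.
  have := IH A' B' C' m ABC' A0 mA0.
  have JE : cyl A' B' C' k m = z1 k @^-1` B1 `&` (z2 k @^-1` B2 `&` (z3 k @^-1` B3 `&` cyl A B C k.+1 m)).
    rewrite /cyl big_ltn // /A' /B' /C' eqxx -!setIA; do 3 congr (_ `&` _).
    by apply: eq_big_nat => j /andP[kj _]; rewrite gtn_eqF.
  rewrite JE (@innov _ _ _ _ _ ABC) // => H.
  rewrite SJ //.
  rewrite (_ : _ `&` _ = S k @^-1` A0 `&` (z1 k @^-1` B1 `&` (z2 k @^-1` B2 `&` (z3 k @^-1` B3 `&` cyl A B C k.+1 m)))).
    by rewrite H; rewrite muleCA.
  by apply/seteqP; split => w /=; tauto.
rewrite (_ : S k.+1 = step k \o (fun w => (S k w, z k w))); last first.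
  by apply/funext => w /=; exact: stepE.
apply: indep_event_comp => //.
have zJ m : indep_event P (z k) (cyl A B C k.+1 m).
  by have := zSJ setT m measurableT; rewrite preimage_setT setTI.
have SzJ B0 m : measurable B0 -> indep_event P (S k) (z k @^-1` B0 `&` cyl A B C k.+1 m).
  move=> mB0 A0 mA0; rewrite setICA zSJ // SJ // zJ //.
  by rewrite muleCA.
apply: indep_event_pair => //; last by move=> B0 mB0; exact: SzJ.
move=> B0 mB0; have := SzJ B0 0%N mB0.
by rewrite [cyl _ _ _ _ _]big_geq // setIT.
Qed.

Lemma chain_indep_innov k B : measurable B -> indep_event P (S k) (z k @^-1` B).
Proof.
move=> mB A mA.
suff : indep_event P (z k) (S k @^-1` A) by move=> /(_ B mB); rewrite setIC muleC.
apply: indep_event_triple => //; first by apply: measurable_preimage => //; exact: measurable_chain.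
move=> B1 B2 B3 mB1 mB2 mB3.
have ABC : mseq (fun=> B1) (fun=> B2) (fun=> B3) by [].
have := chain_indep k k.+1 ABC mA.
rewrite /cyl big_ltn // big_geq // setIT => H.
have := innovT k mB1 mB2 mB3; rewrite setIT probability_setT mule1 => <-.
rewrite muleC -H; congr (P _).
by apply/seteqP; split => w /=; tauto.
Qed.

(** By independence the joint law of [S k] and [z k] is the product of their laws; Tonelli then
    freezes the state while the innovation is integrated. *)
Lemma chain_expectation (f : E * ((Z1 * Z2) * Z3) -> \bar R) k :
  measurable_fun setT f -> (forall x, 0 <= f x) ->
  \int[P]_w f (S k w, z k w) = \int[P]_w' \int[P]_w f (S k w', z k w).
Proof.
move=> mf f0.
have mSk := measurable_chain k.
have mzk := mz k.
pose Sk : {mfun T >-> E} := mfun_Sub (mem_set mSk).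
pose zk : {mfun T >-> ((Z1 * Z2) * Z3)%type} := mfun_Sub (mem_set mzk).
have mh : measurable_fun setT (fun w => (S k w, z k w)) by exact: measurable_fun_pair.
pose h : {mfun T >-> (E * ((Z1 * Z2) * Z3))%type} := mfun_Sub (mem_set mh).
transitivity (\int[distribution P h]_x f x).
  by rewrite ge0_integral_distribution.
have -> : \int[distribution P h]_x f x = \int[distribution P Sk \x distribution P zk]_x f x.
  apply: eq_measure_integral => X mX _; symmetry.
  apply: (product_measure_unique (m' := distribution P h)) => // A B mA mB.
  exact: chain_indep_innov.
rewrite fubini_tonelli1 // /fubini_F ge0_integral_distribution //=.
- apply: eq_integral => w' _ /=.
  by rewrite ge0_integral_distribution //; exact: measurable_fun_pair2.
- exact: measurable_fun_fubini_tonelli_F.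
- by move=> x; exact: integral_ge0.
Qed.

(** Turns a drift condition checked at each deterministic state into a recursion for the means along
    the chain. *)
Lemma chain_drift (f : E -> R) (g c : R) k :
  measurable_fun setT f -> (forall s, 0 <= f s)%R -> (0 <= g)%R -> (0 <= c)%R ->
  (forall s, \int[P]_w (f (step k (s, z k w)))%:E <= (g * f s + c)%:E) ->
  \int[P]_w (f (S k.+1 w))%:E <= g%:E * \int[P]_w (f (S k w))%:E + c%:E.
Proof.
move=> mf f0 g0 c0 H.
have mSk := measurable_chain k.
have mfs : measurable_fun setT (fun x => (f (step k x))%:E).
  by apply/measurable_EFinP; exact: measurableT_comp.
under eq_integral do rewrite stepE.
rewrite (@chain_expectation (fun x => (f (step k x))%:E)) //; last first.
  by move=> x; rewrite lee_fin.
have mfS : measurable_fun setT (fun w => (f (S k w))%:E).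
  by apply/measurable_EFinP; exact: measurableT_comp.
apply: (@le_trans _ _ (\int[P]_w (g * f (S k w) + c)%:E)).
  apply: ge0_le_integral => //.
  - by move=> w _; apply: integral_ge0 => w' _; rewrite lee_fin.
  - apply: (@measurableT_comp _ _ _ _ _ _ (fun s => \int[P]_w (f (step k (s, z k w)))%:E) _ (S k)) => //.
    have := @measurable_fun_fubini_tonelli_F _ _ E T R P (fun x => (f (step k (x.1, z k x.2)))%:E).
    apply => //; last by move=> x; rewrite lee_fin.
    apply: (measurableT_comp mfs); apply: measurable_fun_pair => //.
    exact: measurableT_comp.
  - by apply/measurable_EFinP; apply: measurable_funD => //; apply: measurable_funM => //; exact: measurableT_comp.
under eq_integral do rewrite EFinD EFinM.
rewrite ge0_integralD //; last 2 first.
- by move=> w _; rewrite mule_ge0 ?lee_fin.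
- by apply: measurable_funeM.
rewrite ge0_integralZl_EFin //; last by move=> w _; rewrite lee_fin.
by rewrite integral_cst //= probability_setT mule1.
Qed.

End markov.

(** * Geometry of the rotating frame *)

Lemma ge0_sqr_inj (R : realDomainType) (a b : R) :
  0 <= a -> 0 <= b -> a ^+ 2 = b ^+ 2 -> a = b.
Proof. by move=> a0 b0 /eqP; rewrite eqrXn2 // => /eqP. Qed.

Section euclid.
Variable R : realType.
Implicit Types (x y u v : 'cV[R]_3) (om t s : R).

Lemma sum3 (f : 'I_3 -> R) : \sum_i f i = f 0 + f 1 + f 2.
Proof.
rewrite !big_ord_recl big_ord0 addr0 addrA.
by congr (f _ + f _ + f _); apply/val_inj.
Qed.

Lemma ord3P (Q : 'I_3 -> Prop) : Q 0 -> Q 1 -> Q 2 -> forall i, Q i.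
Proof.
move=> Q0 Q1 Q2 [[|[|[|//]]] Hi].
- by rewrite (_ : Ordinal Hi = 0) //; exact/val_inj.
- by rewrite (_ : Ordinal Hi = 1) //; exact/val_inj.
- by rewrite (_ : Ordinal Hi = 2) //; exact/val_inj.
Qed.

Lemma vec3E (a b c : R) : [/\ vec3 a b c 0 0 = a, vec3 a b c 1 0 = b & vec3 a b c 2 0 = c].
Proof. by rewrite /vec3 !mxE. Qed.

Lemma enormE x : enorm x = Num.sqrt (x 0 0 ^+ 2 + x 1 0 ^+ 2 + x 2 0 ^+ 2).
Proof. by rewrite /enorm sum3. Qed.

Lemma enorm_ge0 x : 0 <= enorm x. Proof. exact: sqrtr_ge0. Qed.

Lemma radial_ge0 x : 0 <= radial x. Proof. exact: sqrtr_ge0. Qed.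

Lemma enorm_sqr x : enorm x ^+ 2 = x 0 0 ^+ 2 + x 1 0 ^+ 2 + x 2 0 ^+ 2.
Proof. by rewrite enormE sqr_sqrtr // !addr_ge0 // sqr_ge0. Qed.

Lemma radial_sqr x : radial x ^+ 2 = x 0 0 ^+ 2 + x 1 0 ^+ 2.
Proof. by rewrite sqr_sqrtr // addr_ge0 // sqr_ge0. Qed.

Definition dot x y : R := x 0 0 * y 0 0 + x 1 0 * y 1 0 + x 2 0 * y 2 0.

(** Lagrange's identity: the defect in the Cauchy-Schwarz inequality is the sum of the squared
    components of the cross product. *)
Lemma dot_le x y : dot x y <= enorm x * enorm y.
Proof.
have [d0|d0] := leP (dot x y) 0; first by rewrite (le_trans d0)// mulr_ge0 ?enorm_ge0.
rewrite -[leLHS]ger0_norm ?(ltW d0)// -[leRHS]ger0_norm ?mulr_ge0 ?enorm_ge0//.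
rewrite -ler_sqr ?nnegrE ?normr_ge0 // !real_normK ?num_real // exprMn !enorm_sqr /dot.
rewrite -subr_ge0.
set a := x 0 0; set b := x 1 0; set c := x 2 0.
set a' := y 0 0; set b' := y 1 0; set c' := y 2 0.
rewrite (_ : _ - _ = (a * b' - b * a') ^+ 2 + (a * c' - c * a') ^+ 2 + (b * c' - c * b') ^+ 2).
  by rewrite !addr_ge0 // sqr_ge0.
ring.
Qed.

Lemma enormD x y : enorm (x + y) <= enorm x + enorm y.
Proof.
rewrite -ler_sqr ?nnegrE ?addr_ge0 ?enorm_ge0 // sqrrD !enorm_sqr !mxE.
have := dot_le x y; rewrite /dot; nra.
Qed.

Lemma enormZ s x : enorm (s *: x) = `|s| * enorm x.
Proof.
apply: ge0_sqr_inj; rewrite ?mulr_ge0 ?enorm_ge0 ?radial_ge0 //.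
rewrite exprMn !enorm_sqr real_normK ?num_real // !mxE; ring.
Qed.

Lemma enormN x : enorm (- x) = enorm x.
Proof. by rewrite -scaleN1r enormZ normrN normr1 mul1r. Qed.

Lemma enormB x y : enorm (x - y) <= enorm x + enorm y.
Proof. by rewrite -[in leRHS](enormN y) enormD. Qed.

Lemma enorm_triangle x y : enorm x - enorm y <= enorm (x - y).
Proof. by rewrite lerBlDr -{1}(subrK y x) enormD. Qed.

Lemma enorm0 : enorm (0 : 'cV[R]_3) = 0.
Proof. by rewrite -(scale0r (0 : 'cV[R]_3)) enormZ normr0 mul0r. Qed.

Lemma enorm_eq0 x : enorm x = 0 -> x = 0.
Proof.
move=> /(congr1 (fun r => r ^+ 2)); rewrite enorm_sqr expr0n /= => x0.
apply/colP; apply: ord3P; rewrite [RHS]mxE; apply/eqP; rewrite -sqrf_eq0; apply/eqP.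
all: have := sqr_ge0 (x 0 0); have := sqr_ge0 (x 1 0); have := sqr_ge0 (x 2 0); lra.
Qed.

Lemma le_coord_enorm x i : `|x i 0| <= enorm x.
Proof.
rewrite -ler_sqr ?nnegrE ?enorm_ge0 // real_normK ?num_real // enorm_sqr.
move: i; apply: ord3P; have := sqr_ge0 (x 0 0); have := sqr_ge0 (x 1 0); have := sqr_ge0 (x 2 0); lra.
Qed.

Lemma enorm_le_coord x : enorm x <= `|x 0 0| + `|x 1 0| + `|x 2 0|.
Proof.
rewrite -ler_sqr ?nnegrE ?enorm_ge0 ?addr_ge0 // enorm_sqr.
rewrite -(real_normK (num_real (x 0 0))) -(real_normK (num_real (x 1 0))) -(real_normK (num_real (x 2 0))).
have := normr_ge0 (x 0 0); have := normr_ge0 (x 1 0); have := normr_ge0 (x 2 0); nra.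
Qed.

Lemma enorm_rot (M : 'M[R]_3) y : is_rotation M -> enorm (M *m y) = enorm y.
Proof.
move=> [MTM _].
have NE (z : 'cV[R]_3) : z^T *m z = (enorm z ^+ 2)%:M.
  apply/matrixP => i j; rewrite !ord1 mxE sum3 [RHS]mxE eqxx mulr1n enorm_sqr.
  by rewrite ![z^T _ _]mxE !expr2.
apply: ge0_sqr_inj; rewrite ?mulr_ge0 ?enorm_ge0 ?radial_ge0 //.
have : (M *m y)^T *m (M *m y) = y^T *m y.
  by rewrite trmx_mul -mulmxA (mulmxA M^T) MTM mul1mx.
by rewrite !NE => /matrixP /(_ 0 0); rewrite !mxE eqxx !mulr1n.
Qed.

Lemma radialD x y : radial (x + y) <= radial x + radial y.
Proof.
pose h (z : 'cV[R]_3) : 'cV[R]_3 := vec3 (z 0 0) (z 1 0) 0.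
have hE (z : 'cV[R]_3) : radial z = enorm (h z).
  by rewrite enormE /radial; have [-> -> ->] := vec3E (z 0 0) (z 1 0) 0; rewrite expr0n /= addr0.
rewrite !hE; have -> : h (x + y) = h x + h y; last exact: enormD.
apply/colP; apply: ord3P; rewrite !mxE //=; exact/esym/addr0.
Qed.

Lemma radialZ s x : radial (s *: x) = `|s| * radial x.
Proof.
apply: ge0_sqr_inj; rewrite ?mulr_ge0 ?enorm_ge0 ?radial_ge0 //.
rewrite exprMn !radial_sqr real_normK ?num_real // !mxE; ring.
Qed.

Lemma radial_le_enorm x : radial x <= enorm x.
Proof.
rewrite -ler_sqr ?nnegrE ?enorm_ge0 ?radial_ge0 // enorm_sqr radial_sqr.
by rewrite lerDl sqr_ge0.
Qed.

Lemma rotfieldE om x : [/\ rotfield om x 0 0 = - om * x 1 0,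
  rotfield om x 1 0 = om * x 0 0 & rotfield om x 2 0 = 0].
Proof. exact: vec3E. Qed.

Lemma rotfieldD om x y : rotfield om (x + y) = rotfield om x + rotfield om y.
Proof.
have [a b c] := rotfieldE om (x + y); have [a1 b1 c1] := rotfieldE om x.
have [a2 b2 c2] := rotfieldE om y.
apply/colP; apply: ord3P; rewrite [RHS]mxE ?a ?b ?c ?a1 ?b1 ?c1 ?a2 ?b2 ?c2 ?mxE; ring.
Qed.

Lemma rotfieldZ om s x : rotfield om (s *: x) = s *: rotfield om x.
Proof.
have [a b c] := rotfieldE om (s *: x); have [a1 b1 c1] := rotfieldE om x.
apply/colP; apply: ord3P; rewrite [RHS]mxE ?a ?b ?c ?a1 ?b1 ?c1 ?mxE; ring.
Qed.

Lemma enorm_rotfield om x : 0 <= om -> enorm (rotfield om x) = om * radial x.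
Proof.
move=> om0; apply: ge0_sqr_inj; rewrite ?mulr_ge0 ?enorm_ge0 ?radial_ge0 //.
have [a b c] := rotfieldE om x.
rewrite exprMn enorm_sqr radial_sqr a b c; ring.
Qed.

(* Conservation of the Jacobi energy of the rotating frame along a free flight. *)
Lemma flight_energy om x v s : 0 <= om ->
  enorm (v - rotfield om (x + s *: v)) ^+ 2 - (om * radial (x + s *: v)) ^+ 2 =
  enorm (v - rotfield om x) ^+ 2 - (om * radial x) ^+ 2.
Proof.
move=> om0; rewrite !exprMn !enorm_sqr !radial_sqr !mxE /=; ring.
Qed.

Lemma enorm_relvel_le om x v s : 0 <= om -> 0 <= s ->
  enorm (v - rotfield om (x + s *: v)) <= enorm (v - rotfield om x) + s * (om * enorm v).
Proof.
move=> om0 s0; rewrite rotfieldD rotfieldZ opprD addrA.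
rewrite (le_trans (enormB _ _))// lerD2l enormZ ger0_norm // ler_wpM2l // enorm_rotfield //.
by rewrite ler_wpM2l // radial_le_enorm.
Qed.

Lemma enorm_relvel_ge om x v s : 0 <= om -> 0 <= s ->
  s * (om * radial v) - enorm (v - rotfield om x) <= enorm (v - rotfield om (x + s *: v)).
Proof.
move=> om0 s0; rewrite rotfieldD rotfieldZ opprD addrA.
rewrite -[in leRHS]enormN opprB -(enormN (v - _)).
rewrite -[s * _]ger0_norm ?mulr_ge0 ?radial_ge0 //.
rewrite normrM (ger0_norm (mulr_ge0 om0 (radial_ge0 v))) -enorm_rotfield // -enormZ.
by rewrite enormN; exact: enorm_triangle.
Qed.

(** The new relative velocity is |w| R_w eta + Delta. The rotation preserves norms and |w| is at
    most |v - F(x)| + |Delta|, so with |eta| at most 1 the noise enters at most twice. *)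
Lemma enorm_collide om rot x v eta delta :
  rotation_choice rot -> enorm eta <= 1 ->
  enorm (collide om rot x v eta delta - rotfield om x) <=
  enorm eta * enorm (v - rotfield om x) + 2 * enorm delta.
Proof.
move=> [_ hrot] eta1; rewrite /collide.
set m := rotfield om x; set w := v - (m + delta).
have -> : enorm w *: (rot w *m eta) + (m + delta) - m = enorm w *: (rot w *m eta) + delta.
  by rewrite addrA addrAC addrK.
have ww : enorm (enorm w *: (rot w *m eta)) = enorm w * enorm eta.
  have [->|w0] := eqVneq w 0; first by rewrite enorm0 scale0r enorm0 mul0r.
  by rewrite enormZ ger0_norm ?enorm_ge0 // enorm_rot //; have [] := hrot _ w0.
rewrite (le_trans (enormD _ _))// ww.
have wle : enorm w <= enorm (v - m) + enorm delta.
  by rewrite /w opprD addrA enormB.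
have := enorm_ge0 eta; have := enorm_ge0 delta; nra.
Qed.

End euclid.

(** * Bounding integrals by explicit primitives *)

Section ftc_compare.
Variable R : realType.
Notation mu := (@lebesgue_measure R).
Implicit Types (f g H : R -> R) (t s : R).

Lemma is_derive_continuous f (df : R -> R) :
  (forall s, is_derive s (1 : R) f (df s)) -> continuous f.
Proof.
move=> h s; apply: differentiable_continuous; apply/derivable1_diffP.
exact: ex_derive.
Qed.

Lemma continuous_itv_integrable f (a b : R) :
  continuous f -> mu.-integrable `[a, b] (EFin \o f).
Proof.
move=> cf; apply: continuous_compact_integrable; first exact: segment_compact.
exact: continuous_subspaceT.
Qed.

Lemma Rintegral_derive H (dH : R -> R) a t : a <= t ->
  (forall s, is_derive s (1 : R) H (dH s)) -> continuous dH ->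
  \int[mu]_(s in `[a, t]) dH s = H t - H a.
Proof.
rewrite le_eqVlt => /predU1P[<- _ _|at0 hH cdH].
  by rewrite set_itv1 Rintegral_set1 subrr.
have cH := is_derive_continuous hH.
rewrite /Rintegral (@continuous_FTC2 _ dH H) //.
- exact: continuous_subspaceT.
- split; first by move=> s _; exact: ex_derive.
  + by apply: cvg_at_right_filter; exact: cH.
  + by apply: cvg_at_left_filter; exact: cH.
- by move=> s _; rewrite derive1E; exact: derive_val.
Qed.

Lemma le_Rintegral_derive H (dH g : R -> R) a t : a <= t ->
  (forall s, is_derive s (1 : R) H (dH s)) -> continuous dH -> continuous g ->
  (forall s, a <= s <= t -> dH s <= g s) ->
  H t - H a <= \int[mu]_(s in `[a, t]) g s.
Proof.
move=> at0 hH cdH cg dHg; rewrite -(Rintegral_derive at0 hH cdH).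
by apply: le_Rintegral => //; exact: continuous_itv_integrable.
Qed.

Lemma ge_Rintegral_derive H (dH g : R -> R) a t : a <= t ->
  (forall s, is_derive s (1 : R) H (dH s)) -> continuous dH -> continuous g ->
  (forall s, a <= s <= t -> g s <= dH s) ->
  \int[mu]_(s in `[a, t]) g s <= H t - H a.
Proof.
move=> at0 hH cdH cg dHg; rewrite -(Rintegral_derive at0 hH cdH).
by apply: le_Rintegral => //; exact: continuous_itv_integrable.
Qed.

Lemma is_derive_quad (a b c s : R) :
  is_derive s (1 : R) (fun s => a + b * s + c * s ^+ 2) (b + 2 * c * s).
Proof.
apply: is_derive_eq.
rewrite /GRing.scale /=; ring.
Qed.

Lemma is_derive_cubic (b c d s : R) :
  is_derive s (1 : R) (fun s => b * s + c * s ^+ 2 + d * s ^+ 3)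
    (b + 2 * c * s + 3 * d * s ^+ 2).
Proof.
apply: is_derive_eq.
rewrite /GRing.scale /=; ring.
Qed.

Lemma continuous_quad (a b c : R) : continuous (fun s => a + b * s + c * s ^+ 2).
Proof. exact: (is_derive_continuous (is_derive_quad a b c)). Qed.

Lemma continuous_sqrt_quad (a b c : R) :
  continuous (fun s => Num.sqrt (a + b * s + c * s ^+ 2)).
Proof.
move=> s; apply: (@continuous_comp _ _ _ (fun s => a + b * s + c * s ^+ 2) Num.sqrt).
  exact: continuous_quad.
exact: sqrt_continuous.
Qed.

(** The last hypothesis is the squared form of: the derivative of the root is at most [g] in
    absolute value. The quadratic may vanish, and its root fail to be differentiable there, so
    [d ^+ 2] is added under the root and [d] tends to 0. *)
Lemma le_Rintegral_sqrt_quad (a b c : R) g t : 0 <= t -> continuous g ->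
  (forall s, 0 <= a + b * s + c * s ^+ 2) ->
  (forall s, 0 <= g s) ->
  (forall s, 0 <= s <= t ->
     (b + 2 * c * s) ^+ 2 <= 4 * g s ^+ 2 * (a + b * s + c * s ^+ 2)) ->
  `|Num.sqrt (a + b * t + c * t ^+ 2) - Num.sqrt a| <= \int[mu]_(s in `[0, t]) g s.
Proof.
move=> t0 cg q0 g0 qg.
pose q s := a + b * s + c * s ^+ 2.
have a0 : 0 <= a by have := q0 0; rewrite mulr0 expr0n mulr0 !addr0.
have sqrtD_le (x d : R) : 0 <= x -> 0 < d -> Num.sqrt x <= Num.sqrt (x + d ^+ 2) <= Num.sqrt x + d.
  move=> x0 d0; rewrite ler_wsqrtr ?lerDl ?sqr_ge0 //=.
  rewrite -ler_sqr ?nnegrE ?sqrtr_ge0 ?addr_ge0 ?sqrtr_ge0 ?(ltW d0) // sqr_sqrtr ?addr_ge0 ?sqr_ge0 //.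
  rewrite sqrrD sqr_sqrtr // lerD2r lerDl; apply: mulrn_wge0.
  by rewrite mulr_ge0 ?sqrtr_ge0 // ltW.
have main (d : R) : 0 < d ->
    `|Num.sqrt (q t + d ^+ 2) - Num.sqrt (q 0 + d ^+ 2)| <= \int[mu]_(s in `[0, t]) g s.
  move=> d0.
  have qd s : 0 < q s + d ^+ 2 by rewrite ltr_wpDl ?exprn_gt0 //; exact: q0.
  pose dH (s : R) : R := (2 * Num.sqrt (q s + d ^+ 2))^-1 * (b + 2 * c * s).
  have hH s : is_derive s (1 : R) (fun s => Num.sqrt (q s + d ^+ 2)) (dH s).
    have h1 : is_derive s (1 : R) (fun s => q s + d ^+ 2) (b + 2 * c * s).
      rewrite (_ : (fun s => _) = (fun s => (a + d ^+ 2) + b * s + c * s ^+ 2)).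
        exact: is_derive_quad.
      by apply/funext => z; rewrite /q; ring.
    have := @is_derive1_comp _ Num.sqrt (fun s => q s + d ^+ 2) s _ _ (is_derive1_sqrt (qd s)) h1.
    by [].
  have cdH : continuous dH.
    move=> s; apply: cvgM; last first.
      have := @continuous_quad b (2 * c) 0 s; rewrite /continuous_at.
      by under eq_fun do rewrite mul0r addr0; rewrite mul0r addr0.
    apply: cvgV; first by rewrite mulf_neq0 // gt_eqF // sqrtr_gt0.
    apply: cvgM; first exact: cvg_cst.
    have cq := @continuous_sqrt_quad (a + d ^+ 2) b c s.
    have E z : q z + d ^+ 2 = a + d ^+ 2 + b * z + c * z ^+ 2 by rewrite /q; ring.
    by rewrite E; under eq_fun do rewrite E.
  have dHg s : 0 <= s <= t -> `|dH s| <= g s.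
    move=> st.
    have D0 : 0 < 2 * Num.sqrt (q s + d ^+ 2) by rewrite mulr_gt0 // sqrtr_gt0.
    rewrite /dH normrM normfV (gtr0_norm D0) ler_pdivrMl //.
    rewrite -ler_sqr ?nnegrE ?mulr_ge0 ?sqrtr_ge0 // real_normK ?num_real //.
    rewrite !exprMn sqr_sqrtr ?(ltW (qd s)) //.
    rewrite (le_trans (qg s st))// /q.
    have := sqr_ge0 d; have := sqr_ge0 (g s); nra.
  rewrite ler_norml; apply/andP; split.
    rewrite lerNl opprB.
    have := @le_Rintegral_derive (fun s => - Num.sqrt (q s + d ^+ 2)) (fun s => - dH s) g 0 t t0.
    rewrite opprK addrC; apply => //.
      by move=> s; apply: cvgN; exact: cdH.
    by move=> s st; have := dHg s st; rewrite ler_norml => /andP[]; rewrite lerNl.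
  apply: (@le_Rintegral_derive (fun s => Num.sqrt (q s + d ^+ 2)) dH g 0 t t0) => //.
  by move=> s st; rewrite (le_trans (ler_norm _))// dHg.
apply/ler_addgt0Pr => e e0.
have d0 : 0 < e / 2 by rewrite divr_gt0.
have := main _ d0; rewrite {2}/q mulr0 expr0n mulr0 !addr0.
have /andP[] := sqrtD_le _ _ a0 d0; have /andP[] := sqrtD_le _ _ (q0 t) d0.
rewrite -/(q t) !ler_norml.
move=> h1 h2 h3 h4 /andP[h5 h6]; apply/andP; split; lra.
Qed.

End ftc_compare.

(** * Free flights *)

Section flight.
Variable R : realType.
Implicit Types (x v : 'cV[R]_3) (om t s xi : R).

Lemma relspeed_quad om x v : exists a b c, forall s,
  enorm (v - rotfield om (x + s *: v)) = Num.sqrt (a + b * s + c * s ^+ 2).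
Proof.
pose u := v - rotfield om x; pose w := rotfield om v.
exists (enorm u ^+ 2), (- 2 * dot u w), (enorm w ^+ 2) => s.
rewrite enormE; congr Num.sqrt.
have [a b c] := rotfieldE om (x + s *: v).
rewrite /dot !enorm_sqr /u /w !mxE /=; ring.
Qed.

Lemma continuous_relspeed om x v : continuous (fun s => enorm (v - rotfield om (x + s *: v))).
Proof.
have [a [b [c E]]] := relspeed_quad om x v.
rewrite (_ : (fun s => _) = (fun s => Num.sqrt (a + b * s + c * s ^+ 2))).
  exact: continuous_sqrt_quad.
by apply/funext.
Qed.

Lemma rel_dist_ge0 om x v t : 0 <= rel_dist om x v t.
Proof. by apply: Rintegral_ge0 => s _; exact: enorm_ge0. Qed.

Lemma rel_dist0 om x v : rel_dist om x v 0 = 0.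
Proof. by rewrite /rel_dist set_itv1 Rintegral_set1. Qed.

Lemma rel_dist_le om x v t : 0 <= om -> 0 <= t ->
  rel_dist om x v t <= t * (enorm (v - rotfield om x) + t * (om * enorm v)).
Proof.
move=> om0 t0; set a := enorm _; set b := om * _.
have := @ge_Rintegral_derive R (fun s => 0 + a * s + b * s ^+ 2) (fun s => a + 2 * b * s)
  (fun s => enorm (v - rotfield om (x + s *: v))) 0 t t0.
rewrite -/(rel_dist om x v t) => H; apply: (le_trans (H _ _ _ _)).
- by move=> s; exact: is_derive_quad.
- have := @continuous_quad R a (2 * b) 0; rewrite (_ : (fun s => _) = (fun s => a + 2 * b * s)) //.
  by apply/funext => s; rewrite mul0r addr0.
- exact: continuous_relspeed.
- move=> s /andP[s0 _]; rewrite (le_trans (enorm_relvel_le _ _ om0 s0))// lerD2l.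
  rewrite -/b; have : 0 <= b by rewrite mulr_ge0 ?enorm_ge0.
  by nra.
- lra.
Qed.

Lemma rel_dist_ge om x v t : 0 <= om -> 0 <= t ->
  t * (t * (om * radial v) / 2 - enorm (v - rotfield om x)) <= rel_dist om x v t.
Proof.
move=> om0 t0; set a := enorm _; set b := om * _.
have := @le_Rintegral_derive R (fun s => 0 + (- a) * s + (b / 2) * s ^+ 2) (fun s => - a + 2 * (b / 2) * s)
  (fun s => enorm (v - rotfield om (x + s *: v))) 0 t t0.
rewrite -/(rel_dist om x v t) => H; apply: (le_trans _ (H _ _ _ _)).
- lra.
- by move=> s; exact: is_derive_quad.
- have := @continuous_quad R (- a) (2 * (b / 2)) 0; rewrite (_ : (fun s => _) = (fun s => - a + 2 * (b / 2) * s)) //.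
  by apply/funext => s; rewrite mul0r addr0.
- exact: continuous_relspeed.
- move=> s /andP[s0 _]; have := enorm_relvel_ge x v om0 s0; rewrite -/a -/b; lra.
Qed.

(** The field of the medium is orthogonal to the radial direction, so only the velocity relative to
    the medium changes the distance to the axis. In squared form the inequality is Cauchy-Schwarz in
    the horizontal plane, with a sum of squares as defect. *)
Lemma radial_flight om x v t : 0 <= t ->
  `|radial (x + t *: v) - radial x| <= rel_dist om x v t.
Proof.
move=> t0.
pose a := x 0 0 ^+ 2 + x 1 0 ^+ 2; pose b := 2 * (x 0 0 * v 0 0 + x 1 0 * v 1 0).
pose c := v 0 0 ^+ 2 + v 1 0 ^+ 2.
have E s : a + b * s + c * s ^+ 2 = radial (x + s *: v) ^+ 2.
  by rewrite radial_sqr !mxE /a /b /c; ring.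
have -> : radial (x + t *: v) = Num.sqrt (a + b * t + c * t ^+ 2).
  by rewrite E sqrtr_sqr ger0_norm ?radial_ge0.
apply: le_Rintegral_sqrt_quad => //.
- exact: continuous_relspeed.
- by move=> s; rewrite E sqr_ge0.
- by move=> s; exact: enorm_ge0.
move=> s _; rewrite enorm_sqr !mxE /= /a /b /c.
set X := x 0 0 + s * v 0 0; set Y := x 1 0 + s * v 1 0.
rewrite -subr_ge0.
rewrite (_ : _ - _ = 4 * (((v 0 0 + om * Y) * Y - (v 1 0 - om * X) * X) ^+ 2 + v 2 0 ^+ 2 * (X ^+ 2 + Y ^+ 2))).
  by rewrite mulr_ge0 // addr_ge0 ?sqr_ge0 // mulr_ge0 ?addr_ge0 ?sqr_ge0.
rewrite /X /Y; ring.
Qed.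

(** A particle at rest on the axis never moves relative to the medium. These are the only states for
    which [rel_dist] fails to increase strictly on nonnegative times. *)
Definition degenerate x v := radial x = 0 /\ v = 0.

Lemma rel_dist_degenerate om x v t : 0 <= om -> 0 <= t -> degenerate x v -> rel_dist om x v t = 0.
Proof.
move=> om0 t0 [x0 v0]; apply/eqP; rewrite eq_le rel_dist_ge0 andbT.
rewrite (le_trans (rel_dist_le _ _ om0 t0))// v0 sub0r enormN enorm_rotfield // x0 enorm0.
by rewrite !mulr0 addr0 mulr0.
Qed.

(** Along a flight the relative velocity is u - s w, with u its initial value and w =
    [rotfield om v]. The lemma provides a component that is not the zero affine function of s. *)
Lemma nondegenerate_coord om x v : 0 < om -> ~ degenerate x v ->
  exists i, (v - rotfield om x) i 0 != 0 \/ rotfield om v i 0 != 0.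
Proof.
move=> om0 nd; apply: contrapT => H; apply: nd.
have h i : (v - rotfield om x) i 0 = 0 /\ rotfield om v i 0 = 0.
  by split; apply/eqP; apply: contrapT => /negP h; apply: H; exists i; [left|right].
have u0 : v - rotfield om x = 0 by apply/colP => i; rewrite [RHS]mxE; have [] := h i.
have w0 : rotfield om v = 0 by apply/colP => i; rewrite [RHS]mxE; have [] := h i.
have rv : om * radial v = 0 by rewrite -enorm_rotfield ?(ltW om0) // w0 enorm0.
have v0 : v = 0.
  apply: enorm_eq0; apply/eqP; rewrite -sqrf_eq0 enorm_sqr -radial_sqr; apply/eqP.
  have -> : radial v = 0 by move/eqP: rv; rewrite mulf_eq0 gt_eqF //= => /eqP.
  have /colP/(_ 2) := u0; rewrite !mxE /= subr0 => ->.
  by rewrite expr0n /= addr0.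
split => //.
have : om * radial x = 0 by rewrite -enorm_rotfield ?(ltW om0) // -enormN -(sub0r (rotfield om x)) -v0 u0 enorm0.
by move/eqP; rewrite mulf_eq0 gt_eqF //= => /eqP.
Qed.

Lemma rel_distB om x v s t : 0 <= s -> s <= t ->
  rel_dist om x v t - rel_dist om x v s =
  \int[lebesgue_measure]_(r in `[s, t]) enorm (v - rotfield om (x + r *: v)).
Proof.
move=> s0 st; rewrite /rel_dist Rintegral_itvB ?bnd_simp //.
  rewrite Rintegral_itv_obnd_cbnd //.
  have := @continuous_itv_integrable R _ s t (@continuous_relspeed om x v).
  by apply: integrableS => //; exact: subset_itv_oc_cc.
by apply: continuous_itv_integrable; exact: continuous_relspeed.
Qed.

(** The speed dominates |l| for a component l(r) = a - b r that is not identically zero. Since [M]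
    bounds |l| up to time [t], |l| is at least l^2 / M, which has an explicit cubic primitive
    [H]. *)
Lemma rel_dist_lt om x v s t : 0 < om -> ~ degenerate x v -> 0 <= s -> s < t ->
  rel_dist om x v s < rel_dist om x v t.
Proof.
move=> om0 nd s0 st; rewrite -subr_gt0 rel_distB ?(ltW st) //.
have [i ab] := nondegenerate_coord om0 nd.
pose a : R := (v - rotfield om x) i 0; pose b : R := rotfield om v i 0.
rewrite -/a -/b in ab.
pose M : R := 1 + `|a| + `|b| * t.
have t0 : 0 < t by exact: le_lt_trans st.
have M0 : 0 < M by rewrite /M -addrA ltr_pwDl // addr_ge0 // mulr_ge0 // ltW.
pose H (r : R) : R := M^-1 * a ^+ 2 * r + (- (M^-1 * a * b)) * r ^+ 2 + M^-1 * b ^+ 2 / 3 * r ^+ 3.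
have dH (r : R) : is_derive r (1 : R) H (M^-1 * (a - b * r) ^+ 2).
  have := is_derive_cubic (M^-1 * a ^+ 2) (- (M^-1 * a * b)) (M^-1 * b ^+ 2 / 3) r.
  by rewrite (_ : _ + _ = M^-1 * (a - b * r) ^+ 2) //; field; rewrite gt_eqF.
have cdH : continuous (fun r => M^-1 * (a - b * r) ^+ 2).
  have := @continuous_quad R (M^-1 * a ^+ 2) (- 2 * M^-1 * a * b) (M^-1 * b ^+ 2).
  by rewrite (_ : (fun r => _) = (fun r => M^-1 * (a - b * r) ^+ 2)) //; apply/funext => r; ring.
have cg := @continuous_relspeed om x v.
apply: lt_le_trans (le_Rintegral_derive (ltW st) dH cdH cg _); last first.
  move=> r /andP[sr rt].
  have ra : `|a - b * r| <= enorm (v - rotfield om (x + r *: v)).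
    rewrite (_ : a - b * r = (v - rotfield om (x + r *: v)) i 0) ?le_coord_enorm //.
    by rewrite rotfieldD rotfieldZ /a /b !mxE; ring.
  apply: le_trans ra; rewrite ler_pdivrMl // -(@real_normK _ (a - b * r)) ?num_real // expr2.
  apply: ler_wpM2r => //.
  rewrite (le_trans (ler_normB _ _))// normrM /M (ger0_norm (le_trans s0 sr)).
  have : `|b| * r <= `|b| * t by rewrite ler_wpM2l.
  lra.
rewrite (_ : H t - H s = M^-1 * ((t - s) / 3) * ((a - b * s) ^+ 2 + (a - b * s) * (a - b * t) + (a - b * t) ^+ 2)); last first.
  by rewrite /H; field; rewrite gt_eqF.
rewrite mulr_gt0 ?mulr_gt0 ?divr_gt0 ?invr_gt0 ?subr_gt0 //.
set A := a - b * s; set B := a - b * t.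
(* The form A^2 + A B + B^2 is definite: it vanishes only if the affine function is zero at both
   ends of the interval, hence identically. *)
rewrite (_ : _ + _ = (A + B / 2) ^+ 2 + 3 / 4 * B ^+ 2); last by field.
have q34 : 0 <= 3 / 4 * B ^+ 2 by have := sqr_ge0 B; lra.
rewrite lt_neqAle; apply/andP; split; last by rewrite addr_ge0 ?sqr_ge0.
apply/negP; rewrite eq_sym paddr_eq0 ?sqr_ge0 //.
move=> /andP[h1 /eqP h2].
have {}h2 : B = 0 by apply/eqP; rewrite -sqrf_eq0; apply/eqP; lra.
have {}h1 : A + B / 2 = 0 by apply/eqP; rewrite -sqrf_eq0.
have A0 : A = 0 by move: h1; rewrite h2 mul0r addr0.
have : b * (t - s) = 0 by move: A0 h2; rewrite /A /B; lra.
move/eqP; rewrite mulf_eq0 subr_eq0 (gt_eqF st) orbF => /eqP b0.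
have a0 : a = 0 by move: A0; rewrite /A b0; lra.
by case: ab; rewrite ?a0 ?b0 eqxx.
Qed.

(** If v has no horizontal part, the relative velocity is a nonzero constant and the distance grows
    linearly; otherwise it grows quadratically by [rel_dist_ge]. *)
Lemma rel_dist_unbounded om x v xi : 0 < om -> ~ degenerate x v ->
  exists2 t, 0 <= t & xi <= rel_dist om x v t.
Proof.
move=> om0 nd.
set a := enorm (v - rotfield om x).
have a0 : 0 <= a by exact: enorm_ge0.
have [v0|v0] := eqVneq (radial v) 0.
  have w0 : rotfield om v = 0 by apply: enorm_eq0; rewrite enorm_rotfield ?(ltW om0) // v0 mulr0.
  have a1 : 0 < a.
    rewrite lt_neqAle eq_sym a0 andbT; apply/negP => /eqP /enorm_eq0 u0.
    by have [i] := nondegenerate_coord om0 nd; rewrite u0 w0 !mxE eqxx; case.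
  exists (`|xi| / a); first by rewrite divr_ge0.
  have t0 : 0 <= `|xi| / a by rewrite divr_ge0.
  have := @le_Rintegral_derive R (fun s => 0 + a * s + 0 * s ^+ 2) (fun s => a + 2 * 0 * s)
    (fun s => enorm (v - rotfield om (x + s *: v))) 0 _ t0.
  rewrite -/(rel_dist om x v _) => H; apply: le_trans (H _ _ _ _).
  - by rewrite add0r mul0r addr0 mulrCA divff ?gt_eqF // mulr1 !mulr0 mul0r !addr0 subr0 ler_norm.
  - by move=> s; exact: is_derive_quad.
  - have := @continuous_quad R a (2 * 0) 0; rewrite (_ : (fun s => _) = (fun s => a + 2 * 0 * s)) //.
    by apply/funext => s; rewrite mul0r addr0.
  - exact: continuous_relspeed.
  - by move=> s _; rewrite rotfieldD rotfieldZ w0 scaler0 addr0 mulr0 mul0r addr0.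
have b0 : 0 < om * radial v by rewrite mulr_gt0 // lt_neqAle eq_sym v0 radial_ge0.
set b := om * _ in b0.
pose t := 1 + (2 * (a + `|xi|)) / b.
have t1 : 1 <= t by rewrite /t lerDl divr_ge0 ?(ltW b0) // mulr_ge0 // addr_ge0.
exists t; first exact: le_trans t1.
apply: le_trans (rel_dist_ge _ _ (ltW om0) _); last exact: le_trans t1.
rewrite -/a -/b.
have tb : t * b = b + 2 * (a + `|xi|) by rewrite /t mulrDl mul1r divfK // gt_eqF.
rewrite tb; have := ler_norm xi; have := normr_ge0 xi; nra.
Qed.

Lemma rel_dist_mono om x v s t : 0 <= s -> s <= t ->
  rel_dist om x v s <= rel_dist om x v t.
Proof.
move=> s0 st; rewrite -subr_ge0 rel_distB //.
by apply: Rintegral_ge0 => r _; exact: enorm_ge0.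
Qed.

Lemma rel_dist_onto om x v xi : 0 < om -> ~ degenerate x v -> 0 <= xi ->
  exists2 t, 0 <= t & rel_dist om x v t = xi.
Proof.
move=> om0 nd xi0; have [T T0 xiT] := rel_dist_unbounded xi om0 nd.
have c : {within `[0, T], continuous (rel_dist om x v)}.
  apply: (@parameterized_integral_continuous R 0 T) => //.
  by apply: continuous_itv_integrable; exact: continuous_relspeed.
have := IVT T0 c; move=> /(_ xi); rewrite rel_dist0.
case; first by rewrite ge_min xi0 /= le_max xiT orbT.
by move=> t; rewrite in_itv /= => /andP[t0 _] tE; exists t.
Qed.

Lemma free_timeE om x v xi :
  free_time om x v xi = odflt 0 ('oinv_([fun rel_dist om x v in `[0, +oo[%classic]) xi).
Proof. by []. Qed.

Lemma free_time_ge0 om x v xi : 0 <= free_time om x v xi.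
Proof.
rewrite free_timeE oinv_surj /=; case: pselect => //= h.
by case: cid2 => /= t; rewrite in_itv /= andbT.
Qed.

Lemma free_timeK om x v xi : 0 < om -> ~ degenerate x v -> 0 <= xi ->
  rel_dist om x v (free_time om x v xi) = xi.
Proof.
move=> om0 nd xi0; rewrite /free_time pinvK // inE.
have [t t0 tE] := rel_dist_onto om0 nd xi0.
by exists t => //=; rewrite in_itv /= t0.
Qed.

Lemma free_time_lt0 om x v xi : xi < 0 -> free_time om x v xi = 0.
Proof.
move=> xi0; rewrite free_timeE oinv_surj /=; case: pselect => //= h.
by have [t _ /esym] := h; have := rel_dist_ge0 om x v t; lra.
Qed.

(** Expresses the sublevel sets of the inverse through [rel_dist], which is how the free time is
    shown to be measurable. *)
Lemma free_time_le om x v xi t : 0 < om -> ~ degenerate x v -> 0 <= t ->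
  (free_time om x v xi <= t) = (xi <= rel_dist om x v t).
Proof.
move=> om0 nd t0; have [xi0|xi0] := ltP xi 0.
  by rewrite free_time_lt0 // t0 (le_trans (ltW xi0)) // rel_dist_ge0.
apply/idP/idP => h.
  by rewrite -(free_timeK om0 nd xi0) rel_dist_mono // free_time_ge0.
rewrite leNgt; apply/negP => /(rel_dist_lt om0 nd t0).
by rewrite free_timeK // ltNge h.
Qed.

Lemma free_time_degenerate om x v xi : 0 < om -> degenerate x v -> xi != 0 ->
  free_time om x v xi = 0.
Proof.
move=> om0 dg xi0; rewrite free_timeE oinv_surj /=; case: pselect => //= h; exfalso.
have [t /=] := h; rewrite in_itv /= andbT => t0; rewrite rel_dist_degenerate ?(ltW om0) //.
by move=> /eqP; rewrite eq_sym (negPf xi0).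
Qed.

(** Degenerate states and negative values of [xi] are covered too, thanks to the positive part;
    later estimates along a flight can thus be stated for every sample point. *)
Lemma rel_dist_free_time_le om x v xi s : 0 < om -> 0 <= s <= free_time om x v xi ->
  rel_dist om x v s <= Num.max xi 0.
Proof.
move=> om0 /andP[s0 st]; rewrite le_max.
have [dg|nd] := pselect (degenerate x v).
  by rewrite rel_dist_degenerate ?(ltW om0) // lexx orbT.
have [xi0|xi0] := ltP xi 0.
  have -> : s = 0 by apply/eqP; rewrite eq_le s0 andbT -(free_time_lt0 om x v xi0).
  by rewrite rel_dist0 lexx orbT.
by rewrite -[X in _ <= X](free_timeK om0 nd xi0) rel_dist_mono.
Qed.

End flight.

(** * Measurability *)

Section borel_measurability.
Variable R : realType.

Lemma measurable_borel_open (U : ptopologicalType) (O : set (borel U)) :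
  open (O : set U) -> measurable O.
Proof. by move=> oO; exact: sub_gen_smallest. Qed.

Lemma continuous_measurable_borel (U : ptopologicalType) (f : U -> R) :
  continuous f -> measurable_fun setT (f : borel U -> R).
Proof.
move=> /continuousP cf.
apply: (measurability _ (RGenOpens.measurableE R)) => _ [_ [a [b ->]] <-].
rewrite setTI; apply: measurable_borel_open; apply: cf; exact: interval_open.
Qed.

Lemma measurable_coord (i : 'I_3) :
  measurable_fun setT (fun x : borel 'cV[R]_3 => (x : 'cV[R]_3) i 0).
Proof.
by apply: (@continuous_measurable_borel 'cV[R]_3 (fun x => x i 0)); exact: coord_continuous.
Qed.

Let box (c : {ffun 'I_3 -> rat * rat}) : set 'cV[R]_3 :=
  [set y | forall i, ratr (c i).1 < y i 0 < ratr (c i).2].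

(** The union runs over all rational boxes, those not contained in [O] being replaced by the empty
    set, so that the index type stays countable. *)
Let open_box (O : set 'cV[R]_3) : open O ->
  O = \bigcup_c (if `[< box c `<=` O >] then box c else set0).
Proof.
move=> oO; apply/seteqP; split => [x Ox|x [c _]]; last by case: asboolP => // cO /cO.
have := open_nbhs_nbhs (conj oO Ox) => -[Q Qx QO].
have H i : {c : rat * rat | ratr c.1 < x i 0 < ratr c.2 &
    forall y : R, ratr c.1 < y < ratr c.2 -> Q i 0 y}.
  apply: cid2; have /nbhs_ballP[e /= e0 eQ] := Qx i 0.
  have [|a] := @rat_in_itvoo R (x i 0 - e) (x i 0); first by rewrite ltrBlDr ltrDl.
  rewrite in_itv /= => /andP[a1 a2].
  have [|b] := @rat_in_itvoo R (x i 0) (x i 0 + e); first by rewrite ltrDl.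
  rewrite in_itv /= => /andP[b1 b2].
  exists (a, b) => /=; first by rewrite a2 b1.
  move=> y /andP[ay yb]; apply: eQ; rewrite /ball /= ltr_norml; apply/andP; split; lra.
pose c := [ffun i => s2val (H i)].
have cx : box c x by move=> i; rewrite /c ffunE; case: (H i).
exists c => //; case: asboolP => // nO; exfalso; apply: nO => y yc.
apply: QO => i j; rewrite ord1; have := yc i; by rewrite /c ffunE; case: (H i) => q _ /= qQ; exact: qQ.
Qed.

(** Open sets are countable unions of boxes, and the preimage of a box is a condition on the
    coordinates. *)
Lemma measurable_fun_vec d (T : measurableType d) (h : T -> borel 'cV[R]_3) :
  (forall i, measurable_fun setT (fun w => (h w : 'cV[R]_3) i 0)) -> measurable_fun setT h.
Proof.
move=> mh; apply: (@measurability _ _ _ _ setT h (@open 'cV[R]_3)) => //.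
move=> _ [U oU <-]; rewrite setTI (open_box oU) preimage_bigcup.
apply: countable_bigcupT_measurable; first exact: countableP.
move=> c; case: asboolP => _; last by rewrite preimage_set0.
have mi i : measurable [set w | ratr (c i).1 < (h w : 'cV[R]_3) i 0 < ratr (c i).2].
  have : measurable ((fun w => (h w : 'cV[R]_3) i 0) @^-1` [set` `](ratr (c i).1 : R), ratr (c i).2[ ]).
    by rewrite -[X in measurable X]setTI; exact: mh.
  by congr measurable; apply/seteqP; split => w /=; rewrite in_itv.
rewrite (_ : _ @^-1` _ = [set w | ratr (c 0).1 < (h w : 'cV[R]_3) 0 0 < ratr (c 0).2] `&`
  ([set w | ratr (c 1).1 < (h w : 'cV[R]_3) 1 0 < ratr (c 1).2] `&`
   [set w | ratr (c 2).1 < (h w : 'cV[R]_3) 2 0 < ratr (c 2).2])).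
  by apply: measurableI => //; exact: measurableI.
by apply/seteqP; split => w /= => [H|[H0 [H1 H2]]]; [split => //; split|exact: ord3P].
Qed.

Lemma measurable_sqrt : measurable_fun setT (@Num.sqrt R).
Proof. by apply: continuous_measurable_fun; exact: sqrt_continuous. Qed.

Lemma measurable_fun_coord d (T : measurableType d) (h : T -> borel 'cV[R]_3) i :
  measurable_fun setT h -> measurable_fun setT (fun w => (h w : 'cV[R]_3) i 0).
Proof. by move=> mh; exact: (measurableT_comp (measurable_coord i)). Qed.

Lemma measurable_fun_enorm d (T : measurableType d) (h : T -> borel 'cV[R]_3) :
  measurable_fun setT h -> measurable_fun setT (fun w => enorm (h w)).
Proof.
move=> mh; rewrite (_ : (fun w => _) = (fun w => Num.sqrt ((h w : 'cV[R]_3) 0 0 ^+ 2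
   + (h w : 'cV[R]_3) 1 0 ^+ 2 + (h w : 'cV[R]_3) 2 0 ^+ 2))).
  apply: (measurableT_comp measurable_sqrt).
  by do 2?apply: measurable_funD; apply: measurable_funX; exact: measurable_fun_coord.
by apply/funext => w; rewrite enormE.
Qed.

Lemma measurable_fun_radial d (T : measurableType d) (h : T -> borel 'cV[R]_3) :
  measurable_fun setT h -> measurable_fun setT (fun w => radial (h w)).
Proof.
move=> mh; rewrite /radial; apply: (measurableT_comp measurable_sqrt).
by apply: measurable_funD; apply: measurable_funX; exact: measurable_fun_coord.
Qed.

Lemma measurable_fun_addv d (T : measurableType d) (f g : T -> borel 'cV[R]_3) :
  measurable_fun setT f -> measurable_fun setT g ->
  measurable_fun setT (fun w => (f w + g w : 'cV[R]_3) : borel 'cV[R]_3).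
Proof.
move=> mf mg; apply: measurable_fun_vec => i; under eq_fun do rewrite mxE.
by apply: measurable_funD; exact: measurable_fun_coord.
Qed.

Lemma measurable_fun_scalev d (T : measurableType d) (c : T -> R) (f : T -> borel 'cV[R]_3) :
  measurable_fun setT c -> measurable_fun setT f ->
  measurable_fun setT (fun w => (c w *: (f w : 'cV[R]_3)) : borel 'cV[R]_3).
Proof.
move=> mc mf; apply: measurable_fun_vec => i; under eq_fun do rewrite mxE.
by apply: measurable_funM => //; exact: measurable_fun_coord.
Qed.

Lemma measurable_fun_subv d (T : measurableType d) (f g : T -> borel 'cV[R]_3) :
  measurable_fun setT f -> measurable_fun setT g ->
  measurable_fun setT (fun w => (f w - g w : 'cV[R]_3) : borel 'cV[R]_3).
Proof.
move=> mf mg; apply: measurable_fun_vec => i; under eq_fun do rewrite !mxE.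
by apply: measurable_funB; exact: measurable_fun_coord.
Qed.

Lemma measurable_fun_rotfield d (T : measurableType d) om (f : T -> borel 'cV[R]_3) :
  measurable_fun setT f ->
  measurable_fun setT (fun w => rotfield om (f w) : borel 'cV[R]_3).
Proof.
move=> mf; apply: measurable_fun_vec.
have h w := rotfieldE om (f w : 'cV[R]_3).
apply: ord3P.
- rewrite (_ : (fun w => _) = (fun w => - om * (f w : 'cV[R]_3) 1 0)); last first.
    by apply/funext => w; have [] := h w.
  by apply: measurable_funM; [exact: measurable_cst|exact: measurable_fun_coord].
- rewrite (_ : (fun w => _) = (fun w => om * (f w : 'cV[R]_3) 0 0)); last first.
    by apply/funext => w; have [] := h w.
  by apply: measurable_funM; [exact: measurable_cst|exact: measurable_fun_coord].
- rewrite (_ : (fun w => _) = cst 0) //.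
  by apply/funext => w; have [] := h w.
Qed.

(** [rot] is measurable only off the origin, but its entries are multiplied by the norm, which is
    zero there; the product is measurable on both pieces. *)
Lemma measurable_fun_rot d (T : measurableType d) rot (f g : T -> borel 'cV[R]_3) :
  rotation_choice rot -> measurable_fun setT f -> measurable_fun setT g ->
  measurable_fun setT
    (fun w => (enorm (f w) *: (rot (f w) *m (g w : 'cV[R]_3))) : borel 'cV[R]_3).
Proof.
move=> [mrot _] mf mg; apply: measurable_fun_vec => i.
pose D : set (borel 'cV[R]_3) := [set u | (u : 'cV[R]_3) != 0].
have ent (j : 'I_3) : measurable_fun setT
    (fun u : borel 'cV[R]_3 => enorm u * rot u i j).
  have mD : measurable D.
    have -> : D = (fun u : borel 'cV[R]_3 => enorm u) @^-1` [set r | r != 0].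
      apply/seteqP; split => u /=; first by apply: contra => /eqP /enorm_eq0 ->.
      by apply: contra => /eqP ->; rewrite enorm0.
    apply: measurable_preimage; first exact: measurable_fun_enorm.
    by rewrite (_ : [set _ | _] = ~` [set 0]); [exact: measurableC|apply/seteqP; split => r /= /eqP].
  rewrite -(setUv D) measurable_funU //; last exact: measurableC.
  split.
    apply: measurable_funM; first by apply: measurable_funTS; exact: measurable_fun_enorm.
    have mij : measurable_fun setT (fun M : borel 'M[R]_3 => (M : 'M[R]_3) i j).
      by apply: (@continuous_measurable_borel 'M[R]_3 (fun M => M i j)); exact: coord_continuous.
    exact: (measurableT_comp mij mrot).
  apply: (eq_measurable_fun (fun=> 0 : R)) => //.
  by move=> u; rewrite inE /D /= => /negP; rewrite negbK => /eqP ->; rewrite enorm0 mul0r.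
rewrite (_ : (fun w => _) = (fun w => (enorm (f w) * rot (f w) i 0) * (g w : 'cV[R]_3) 0 0
   + (enorm (f w) * rot (f w) i 1) * (g w : 'cV[R]_3) 1 0
   + (enorm (f w) * rot (f w) i 2) * (g w : 'cV[R]_3) 2 0)).
  by do 2?apply: measurable_funD; apply: measurable_funM;
    [exact: (measurableT_comp (ent _))|exact: measurable_fun_coord
    |exact: (measurableT_comp (ent _))|exact: measurable_fun_coord
    |exact: (measurableT_comp (ent _))|exact: measurable_fun_coord].
by apply/funext => w; rewrite mxE mxE sum3 !mulrDr !mulrA.
Qed.

Lemma measurable_fun_collide d (T : measurableType d) om rot
    (x v eta delta : T -> borel 'cV[R]_3) :
  rotation_choice rot -> measurable_fun setT x -> measurable_fun setT v ->
  measurable_fun setT eta -> measurable_fun setT delta ->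
  measurable_fun setT
    (fun w => collide om rot (x w) (v w) (eta w) (delta w) : borel 'cV[R]_3).
Proof.
move=> hrot mx mv me md; rewrite /collide.
have mm : measurable_fun setT
    (fun w => (rotfield om (x w) + (delta w : 'cV[R]_3)) : borel 'cV[R]_3).
  by apply: measurable_fun_addv => //; exact: measurable_fun_rotfield.
apply: measurable_fun_addv => //; apply: measurable_fun_rot => //.
exact: measurable_fun_subv.
Qed.

End borel_measurability.

Section flight_measurability.
Variable R : realType.
Context d (T : measurableType d).
Implicit Types (x v : T -> borel 'cV[R]_3).

(** The relative distance is an integral over sections of a nonnegative function of sample point and
    time, so Tonelli gives its measurability. *)
Lemma measurable_fun_rel_dist om t x v :
  measurable_fun setT x -> measurable_fun setT v ->
  measurable_fun setT (fun w => rel_dist om (x w) (v w) t).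
Proof.
move=> mx mv.
pose f (p : T * R) : \bar R :=
  ((enorm ((v p.1 : 'cV[R]_3) - rotfield om ((x p.1 : 'cV[R]_3) + p.2 *: (v p.1 : 'cV[R]_3)))) * \1_(`[0, t]%classic : set R) p.2)%:E.
have f0 p : (0 <= f p)%E by rewrite lee_fin mulr_ge0 ?enorm_ge0.
have mv1 : measurable_fun setT (fun p : T * R => v p.1).
  by apply: measurableT_comp => //; exact: measurable_fst.
have mx1 : measurable_fun setT (fun p : T * R => x p.1).
  by apply: measurableT_comp => //; exact: measurable_fst.
have mf : measurable_fun setT f.
  apply/measurable_EFinP; apply: measurable_funM; last first.
    by apply: (measurableT_comp _ measurable_snd); exact: measurable_indic.
  apply: measurable_fun_enorm; apply: measurable_fun_subv => //.
  apply: measurable_fun_rotfield; apply: measurable_fun_addv => //.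
  by apply: measurable_fun_scalev => //; exact: measurable_snd.
have := @measurable_fun_fubini_tonelli_F _ _ _ _ R (@lebesgue_measure R) f mf f0.
rewrite /fubini_F => mF.
rewrite (_ : (fun w => _) = (fun w => fine (\int[lebesgue_measure]_y f (w, y)))); last first.
  apply/funext => w; rewrite /rel_dist /Rintegral integral_mkcond; congr fine.
  apply: eq_integral => s _; rewrite /f /patch /= indicE mem_setE.
  by case: ifPn => _; rewrite ?mulr1 ?mulr0.
apply: (measurableT_comp _ mF); exact: fine_measurable.
Qed.

Lemma measurable_degenerate x v : measurable_fun setT x -> measurable_fun setT v ->
  measurable [set w | degenerate (x w) (v w)].
Proof.
move=> mx mv.
rewrite (_ : [set w | _] = ((fun w => radial (x w)) @^-1` [set 0]) `&` ((fun w => enorm (v w)) @^-1` [set 0])).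
  by apply: measurableI; apply: measurable_preimage => //;
    [exact: measurable_fun_radial|exact: measurable_fun_enorm].
apply/seteqP; split => w /= []; first by move=> rx ->; rewrite enorm0.
by move=> rx /enorm_eq0.
Qed.

Lemma measurable_fun_free_time om x v (xi : T -> R) : 0 < om ->
  measurable_fun setT x -> measurable_fun setT v -> measurable_fun setT xi ->
  measurable_fun setT (fun w => free_time om (x w) (v w) (xi w)).
Proof.
move=> om0 mx mv mxi.
pose Dg := [set w | degenerate (x w) (v w)].
have mDg : measurable Dg by exact: measurable_degenerate.
apply: (measurability _ (RGenOInfty.measurableE R)) => _ [_ [t ->] <-].
rewrite setTI preimage_itvoy.
rewrite (_ : [set w | _] = ~` [set w | free_time om (x w) (v w) (xi w) <= t]); last first.
  by apply/seteqP; split => w /=; rewrite ltNge => /negP.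
apply: measurableC.
have [t0|t0] := ltP t 0.
  rewrite (_ : [set w | _] = set0) //; apply/seteqP; split => w //= h.
  by have := free_time_ge0 om (x w) (v w) (xi w); lra.
(* on degenerate states rel_dist vanishes identically, so that free_time is constant *)
pose c0 : R := 'pinv_(fun=> 0) `[0, +oo[ (fun=> 0 : R) 0.
have ftDg w : Dg w -> xi w = 0 -> free_time om (x w) (v w) (xi w) = c0.
  move=> Dw ->; rewrite /free_time (_ : rel_dist om (x w) (v w) = fun=> 0) //.
  apply/funext => s; have [s0|s0] := ltP s 0.
    by rewrite /rel_dist set_itv_ge ?Rintegral_set0 // bnd_simp -ltNge.
  by rewrite rel_dist_degenerate // ltW.
have mxi0 : measurable [set w | xi w = 0].
  by rewrite (_ : [set w | _] = xi @^-1` [set 0]) //; exact: measurable_preimage.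
(* Since [t >= 0] here, degenerate states with nonzero [xi], whose free time is 0, all belong to the
   set; those with [xi] zero belong to it according to the constant [c0]. *)
rewrite (_ : [set w | _] = (~` Dg `&` [set w | xi w <= rel_dist om (x w) (v w) t]) `|`
  ((Dg `\` [set w | xi w = 0]) `|` (Dg `&` [set w | xi w = 0] `&` [set w | c0 <= t]))).
  apply: measurableU; last first.
    apply: measurableU; first exact: measurableD.
    apply: measurableI; first exact: measurableI.
    by have [ct|ct] := boolP (c0 <= t); [rewrite (_ : [set w | _] = setT)|rewrite (_ : [set w | _] = set0)] => //;
      apply/seteqP; split.
  apply: measurableI; first exact: measurableC.
  rewrite (_ : [set w | _] = (fun w => xi w <= rel_dist om (x w) (v w) t) @^-1` [set true]) //.
  apply: measurable_preimage => //; apply: measurable_fun_ler => //.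
  exact: measurable_fun_rel_dist.
apply/seteqP; split => w /=.
  have [Dw|nDw] := pselect (Dg w); last by rewrite free_time_le //; left.
  by have [xi0|xi0] := pselect (xi w = 0); [rewrite ftDg //; right; right|right; left].
case => [[nDw]|[[Dw /eqP xi0]|[[Dw xi0] ct]]].
- by rewrite free_time_le.
- by rewrite free_time_degenerate.
- by rewrite ftDg.
Qed.

End flight_measurability.

(** * The Lyapunov function *)

Section lyapunov.
Variable R : realType.
Implicit Types kap rho a : R.

Definition nrm2 rho a : R := Num.sqrt (rho ^+ 2 + a ^+ 2).

(* When the relative speed is small, a flight changes nrm2 by about 2 (rho' - rho), hence lyap
   by about kap (rho' - rho); a collision acts on nrm2 only. *)
Definition lyap kap rho a : R := (2 - kap) * rho - (1 - kap) * nrm2 rho a.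

Lemma nrm2_ge0 rho a : 0 <= nrm2 rho a. Proof. exact: sqrtr_ge0. Qed.

Lemma nrm2_sqr rho a : nrm2 rho a ^+ 2 = rho ^+ 2 + a ^+ 2.
Proof. by rewrite sqr_sqrtr // addr_ge0 // sqr_ge0. Qed.

Lemma ler_of_sqr (x y : R) : 0 <= y -> x ^+ 2 <= y ^+ 2 -> x <= y.
Proof.
move=> y0 xy; have [x0|x0] := leP 0 x; last exact: ltW (lt_le_trans x0 y0).
by rewrite -ler_sqr.
Qed.

Lemma nrm2_gel rho a : rho <= nrm2 rho a.
Proof. by apply: ler_of_sqr; rewrite ?nrm2_ge0 // nrm2_sqr lerDl sqr_ge0. Qed.

Lemma nrm2_ger rho a : a <= nrm2 rho a.
Proof. by apply: ler_of_sqr; rewrite ?nrm2_ge0 // nrm2_sqr lerDr sqr_ge0. Qed.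

Lemma nrm2_le rho a : 0 <= rho -> 0 <= a -> nrm2 rho a <= rho + a.
Proof.
move=> r0 a0; apply: ler_of_sqr; rewrite ?addr_ge0 // nrm2_sqr.
have := mulr_ge0 r0 a0; lra.
Qed.

Lemma nrm2_lipr rho a b : 0 <= a -> 0 <= b -> nrm2 rho (a + b) <= nrm2 rho a + b.
Proof.
move=> a0 b0; apply: ler_of_sqr; first by rewrite addr_ge0 ?nrm2_ge0.
rewrite sqrrD !nrm2_sqr sqrrD.
have := ler_wpM2r b0 (nrm2_ger rho a); lra.
Qed.

Lemma nrm2_mono rho a b : 0 <= a -> a <= b -> nrm2 rho a <= nrm2 rho b.
Proof.
move=> a0 ab; apply: ler_of_sqr; first exact: nrm2_ge0.
by rewrite !nrm2_sqr lerD2l ler_sqr ?nnegrE // (le_trans a0).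
Qed.

Lemma lyap_le kap rho a : 0 <= kap <= 1 -> lyap kap rho a <= rho.
Proof. by move=> /andP[k0 k1]; rewrite /lyap; have := nrm2_gel rho a; nra. Qed.

Lemma lyap_ge kap rho a : 0 <= kap <= 1 -> 0 <= rho -> 0 <= a -> - a <= lyap kap rho a.
Proof.
by move=> /andP[k0 k1] r0 a0; rewrite /lyap; have := nrm2_le r0 a0; nra.
Qed.

(** The drop is (a^2 - b^2) / (N + Nb), hence at least (c / 2) a^2 / (2 N). Whether [rho <= a] or
    not, B N is at most 2 a^2, which gives the factor 1/8. *)
Lemma nrm2_drop (c B rho a b : R) : 0 < c <= 1 -> 0 <= rho -> 0 <= a -> 0 <= b ->
  b <= a - c / 2 * a -> 1 <= B -> B <= a -> B ^+ 2 * (rho + 1) <= a ^+ 2 ->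
  c * B / 8 <= nrm2 rho a - nrm2 rho b.
Proof.
move=> /andP[c0 c1] rho0 a0 b0 ba B1 Ba aB.
have hb := nrm2_ge0 rho b; have h := nrm2_ge0 rho a.
have ha := nrm2_ger rho a; have hl := nrm2_le rho0 a0.
have ca : 0 <= c / 2 * a by rewrite mulr_ge0 // divr_ge0 // ltW.
have ab : b <= a by rewrite (le_trans ba) // gerBl.
have NbN := nrm2_mono rho b0 ab.
have sb := nrm2_sqr rho b; have s := nrm2_sqr rho a.
set N := nrm2 rho a in s h ha hl NbN *; set Nb := nrm2 rho b in sb hb NbN *.
have N_gt0 : 0 < N by rewrite (lt_le_trans _ ha) // (lt_le_trans _ Ba) // (lt_le_trans _ B1).
have h1 : c / 2 * a ^+ 2 <= a ^+ 2 - b ^+ 2.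
  have : b ^+ 2 <= (a - c / 2 * a) * a by rewrite expr2; apply: ler_pM.
  by rewrite expr2; clear => *; lra.
have h2 : a ^+ 2 - b ^+ 2 <= (N - Nb) * (2 * N).
  have : (N - Nb) * (N + Nb) <= (N - Nb) * (2 * N).
    by rewrite ler_wpM2l ?subr_ge0 //; move: NbN; clear => *; lra.
  have -> : (N - Nb) * (N + Nb) = N ^+ 2 - Nb ^+ 2 by ring.
  by rewrite s sb; clear => *; lra.
have h4 : B * N <= 2 * a ^+ 2.
  have B0 : 0 <= B by exact: le_trans B1.
  have [ra|ar] := leP rho a.
    have : B * N <= a * (2 * a).
      by apply: ler_pM => //; move: hl ra; clear => *; lra.
    by rewrite expr2; clear => *; lra.
  have k1 : B * N <= B * (2 * rho).
    by rewrite ler_wpM2l //; move: hl ar; clear => *; lra.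
  have k2 : B * rho <= B ^+ 2 * (rho + 1).
    rewrite expr2 -mulrA ler_wpM2l //.
    by move: B1 rho0; clear => *; nra.
  by move: k1 k2 aB; clear => *; lra.
rewrite -(ler_pM2r (_ : 0 < 2 * N)) ?mulr_gt0 //.
have := ler_wpM2l (ltW c0) h4.
by move: h1 h2; clear => *; lra.
Qed.

(* One collision followed by one flight, seen through the potential [rho] (om times the
   distance to the axis) and the relative speed: [a] is turned into [b] by the collision
   and [(rho, b)] into [(rho', a')] by the flight. *)
Definition one_step rho a e D z b rho' a' :=
  [/\ [/\ 0 <= rho, 0 <= a, 0 <= b, 0 <= rho' & 0 <= a'],
      [/\ 0 <= e <= 1, 0 <= D & 0 <= z],
      b <= e * a + 2 * D,
      a' ^+ 2 - b ^+ 2 = rho' ^+ 2 - rho ^+ 2 &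
      `|rho' - rho| <= z].

Section step.
Variables (rho a e D z b rho' a' kap : R).
Hypothesis st : one_step rho a e D z b rho' a'.
Hypothesis kap01 : 0 <= kap <= 1.
Let N := nrm2 rho a.
Let Nb := nrm2 rho b.
Let N' := nrm2 rho' a'.

Let k0 : 0 <= kap. Proof. by case/andP: kap01. Qed.
Let k1 : kap <= 1. Proof. by case/andP: kap01. Qed.

Lemma nrm2_collision : Nb <= N + 2 * D.
Proof.
have [[rho0 a0 b0 _ _] [/andP[e0 e1] D0 _] bb _ _] := st.
apply: le_trans (nrm2_lipr rho a0 _); last by rewrite mulr_ge0.
by apply: nrm2_mono => //; rewrite (le_trans bb)// lerD2r ler_piMl.
Qed.

(** Conservation gives N'^2 - Nb^2 = 2 (rho'^2 - rho^2), so the factor is th = (rho + rho') / (Nb +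
    N'). The last identity measures its distance to 1, which is the distance between the variation
    of [lyap] in a flight and kap (rho' - rho). *)
Lemma flight_coef : exists th, [/\ 0 <= th <= 1, N' - Nb = 2 * (rho' - rho) * th &
  (Nb + N') * (1 - th) = (Nb - rho) + (N' - rho')].
Proof.
have [[rho0 a0 b0 rho'0 a'0] _ _ en _] := st.
have hb := nrm2_gel rho b; have h' := nrm2_gel rho' a'.
have sb := nrm2_sqr rho b; have s' := nrm2_sqr rho' a'.
rewrite -/Nb -/N' in hb h' sb s'.
have [S0|S0] := eqVneq (Nb + N') 0.
  have [? ?] : Nb = 0 /\ N' = 0 by split; lra.
  have [? ?] : rho = 0 /\ rho' = 0 by split; lra.
  by exists 1; rewrite S0; split; [rewrite ler01 lexx|lra|lra].
have Sp : 0 < Nb + N' by rewrite lt_neqAle eq_sym S0; lra.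
exists ((rho + rho') / (Nb + N')); split.
- by rewrite divr_ge0 ?(ltW Sp) ?addr_ge0 //= ler_pdivrMr // mul1r lerD.
- apply: (mulIf S0); rewrite mulrA divfK //.
  by transitivity (N' ^+ 2 - Nb ^+ 2); [ring|rewrite s' sb; lra].
- by rewrite mulrBr mulr1 mulrCA divff // mulr1; ring.
Qed.

Lemma lyap_flightE : lyap kap rho' a' - lyap kap rho a =
  (1 - kap) * (N - Nb) + ((2 - kap) * (rho' - rho) - (1 - kap) * (N' - Nb)).
Proof. by rewrite /lyap -/N -/N'; ring. Qed.

(** The variation is (rho' - rho) times kap + 2 (1 - kap) (1 - th), and this factor lies between 0
    and 2. *)
Lemma flight_part_ge : - (2 * z) <= (2 - kap) * (rho' - rho) - (1 - kap) * (N' - Nb).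
Proof.
have [th [/andP[th0 th1] E _]] := flight_coef.
have [_ [_ D0 z0] _ _ /ler_normlP[d1 d2]] := st.
rewrite (_ : _ - _ = (rho' - rho) * (kap + 2 * (1 - kap) * (1 - th))); last by rewrite E; ring.
set c := kap + _.
have c0 : 0 <= c by rewrite addr_ge0 // mulr_ge0 // ?mulr_ge0 ?subr_ge0.
have c2 : c <= 2.
  have : (1 - kap) * (1 - th) <= 1 - kap by rewrite ler_piMr ?subr_ge0 // gerBl.
  by rewrite /c; have := k0; lra.
by nra.
Qed.

Lemma lyap_step_ge : - (2 * z + 2 * D) <= lyap kap rho' a' - lyap kap rho a.
Proof.
have [_ [_ D0 z0] _ _ _] := st.
have h1 := flight_part_ge; have hc := nrm2_collision.
rewrite lyap_flightE.
have h2 : - (2 * D) <= (1 - kap) * (N - Nb).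
  by have := k0; have := k1; nra.
by lra.
Qed.

(** * Relative speed at most of order [sqrt rho] *)

Section moderate.
Variables (al r : R).
Hypothesis al0 : 0 <= al.
Hypothesis r1 : 1 <= r.
Hypothesis rhoE : rho = r ^+ 2.
Hypothesis aal : a <= al * r.

(** Chosen so that [err] dominates the sum of all remainders met below ([err_sum]): they are of
    order 1/r, at most quadratic in the noise and of degree at most four in [al]. *)
Let C := 20 * (1 + al) ^+ 4.
Let err := C * (1 + z + D) ^+ 2 / r.

Let r0 : 0 < r. Proof. exact: lt_le_trans r1. Qed.
Let rho_gt0 : 0 < rho. Proof. by rewrite rhoE exprn_gt0. Qed.
Let N0 : N - rho <= al ^+ 2 / 2.
Proof.
have [[rho0 a0 _ _ _] _ _ _ _] := st.
rewrite lerBlDr; apply: ler_of_sqr; first by rewrite addr_ge0 // divr_ge0 // sqr_ge0.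
rewrite nrm2_sqr sqrrD.
have : a ^+ 2 <= (al * r) ^+ 2 by rewrite ler_sqr ?nnegrE ?mulr_ge0 // ltW.
rewrite exprMn -rhoE; have := sqr_ge0 (al ^+ 2 / 2); lra.
Qed.

Let over_rho (x : R) : 0 <= x -> x / rho <= x / r.
Proof.
by move=> x0; rewrite ler_wpM2l // lef_pV2 ?posrE // rhoE expr2 -[leLHS]mulr1 ler_wpM2l // ltW.
Qed.

Let Y := 4 * a * D + 4 * D ^+ 2.

Let Y0 : 0 <= Y.
Proof.
have [[_ a0 _ _ _] [_ D0 _] _ _ _] := st.
by rewrite addr_ge0 ?mulr_ge0 ?sqr_ge0.
Qed.

Let b2 : b ^+ 2 <= e ^+ 2 * a ^+ 2 + Y.
Proof.
have [[_ a0 b0 _ _] [/andP[e0 e1] D0 _] bb _ _] := st.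
have : b ^+ 2 <= (e * a + 2 * D) ^+ 2.
  by rewrite ler_sqr ?nnegrE // addr_ge0 ?mulr_ge0.
have : e * a * D <= a * D by rewrite ler_wpM2r // ler_piMl.
by rewrite /Y; nra.
Qed.

Let Yrho : Y / rho <= (4 * al * D + 4 * D ^+ 2) / r.
Proof.
have [[_ a0 b0 _ _] [_ D0 _] _ _ _] := st.
rewrite ler_pdivrMr // mulrAC -mulrA rhoE expr2 mulfK ?gt_eqF //.
have : a * D <= al * r * D by rewrite ler_wpM2r.
have : D ^+ 2 <= D ^+ 2 * r by rewrite ler_peMr ?sqr_ge0.
by rewrite /Y; nra.
Qed.

(** The gain is (a^2 - b^2) / (N + Nb). The denominator differs from 2 rho by a bounded amount plus
    noise, and the numerator is at least (1 - e^2) a^2 up to the noise term [Y]. *)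
Lemma collision_gain :
  (1 - e ^+ 2) * (a ^+ 2 / (2 * rho)) - al ^+ 2 * (al ^+ 2 + 2 * D) / (4 * r)
    - (2 * al * D + 2 * D ^+ 2) / r <= N - Nb.
Proof.
have [[rho0 a0 b0 _ _] [/andP[e0 e1] D0 _] bb _ _] := st.
have hb := nrm2_gel rho b; have h := nrm2_gel rho a.
have sb := nrm2_sqr rho b; have s := nrm2_sqr rho a.
rewrite -/Nb -/N in hb h sb s.
pose S := N + Nb.
have S2 : 2 * rho <= S by rewrite /S; lra.
have S0 : 0 < S by rewrite (lt_le_trans _ S2) // mulr_gt0.
have SU : S - 2 * rho <= al ^+ 2 + 2 * D by rewrite /S; have := nrm2_collision; have := N0; lra.
pose X : R := (1 - e ^+ 2) * a ^+ 2.
have X0 : 0 <= X by rewrite mulr_ge0 ?sqr_ge0 // subr_ge0 expr_le1.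
have Xa : X <= al ^+ 2 * rho.
  rewrite rhoE -exprMn; apply: (@le_trans _ _ (a ^+ 2)).
    by rewrite ler_piMl ?sqr_ge0 // gerBl sqr_ge0.
  by rewrite ler_sqr ?nnegrE // mulr_ge0 // ltW.
have NN : N - Nb = (a ^+ 2 - b ^+ 2) / S.
  by apply: (mulIf (lt0r_neq0 S0)); rewrite divfK ?gt_eqF // /S; nra.
rewrite NN.
have h1 : (X - Y) / S <= (a ^+ 2 - b ^+ 2) / S.
  by rewrite ler_pM2r ?invr_gt0 // /X; have := b2; lra.
apply: le_trans h1; rewrite mulrBl.
have YS : Y / S <= (2 * al * D + 2 * D ^+ 2) / r.
  apply: (@le_trans _ _ (Y / (2 * rho))).
    by rewrite ler_wpM2l // lef_pV2 ?posrE // mulr_gt0.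
  by rewrite invfM mulrCA mulrC; have := Yrho; lra.
suff : (1 - e ^+ 2) * (a ^+ 2 / (2 * rho)) - al ^+ 2 * (al ^+ 2 + 2 * D) / (4 * r) <= X / S by lra.
(* The inverse is convex, so it lies above its tangent at 2 rho. *)
have i1 : (2 * rho)^-1 - (S - 2 * rho) / (4 * rho ^+ 2) <= S^-1.
  rewrite -subr_ge0.
  rewrite (_ : _ - _ = (S - 2 * rho) ^+ 2 / (4 * rho ^+ 2 * S)).
    by rewrite divr_ge0 ?sqr_ge0 // mulr_ge0 ?mulr_ge0 ?sqr_ge0 // ltW.
  by field; rewrite !gt_eqF.
have i2 : X * ((S - 2 * rho) / (4 * rho ^+ 2)) <= al ^+ 2 * (al ^+ 2 + 2 * D) / (4 * r).
  apply: (@le_trans _ _ (al ^+ 2 * rho * ((al ^+ 2 + 2 * D) / (4 * rho ^+ 2)))).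
    apply: ler_pM => //; first by rewrite divr_ge0 ?subr_ge0 // mulr_ge0 // sqr_ge0.
    by rewrite ler_pM2r // invr_gt0 mulr_gt0 // exprn_gt0.
  rewrite (_ : _ * _ = al ^+ 2 * (al ^+ 2 + 2 * D) / 4 / rho); last by field; rewrite gt_eqF.
  rewrite (_ : _ / (4 * r) = al ^+ 2 * (al ^+ 2 + 2 * D) / 4 / r); last by field; rewrite gt_eqF.
  by apply: over_rho; rewrite divr_ge0 // mulr_ge0 ?sqr_ge0 // addr_ge0 ?sqr_ge0 // mulr_ge0.
rewrite [(1 - _) * _]mulrA -/X; have := ler_wpM2l X0 i1; rewrite mulrBr; lra.
Qed.

(** By [flight_coef], (Nb + N') (1 - th) is bounded by a constant plus noise, so 1 - th is of order
    1/rho and the flight changes [lyap] by kap (rho' - rho) up to an error. *)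
Lemma flight_gain :
  kap * (rho' - rho) - 2 * z * (al ^+ 2 + 4 * D + 3 * z) / r
    <= (2 - kap) * (rho' - rho) - (1 - kap) * (N' - Nb).
Proof.
have [[rho0 a0 b0 rho'0 a'0] [_ D0 z0] _ _ /ler_normlP[d1 d2]] := st.
have [th [/andP[th0 th1] E F]] := flight_coef.
have hb := nrm2_gel rho b; have h' := nrm2_gel rho' a'; rewrite -/Nb -/N' in hb h'.
have S0 : 0 < Nb + N' by have := rho_gt0; lra.
have N'b : N' - Nb <= 2 * z.
  rewrite E; have : (rho' - rho) * th <= z * th by rewrite ler_wpM2r; lra.
  have : z * th <= z by rewrite ler_piMr.
  lra.
have t1 : (1 - th) * rho <= al ^+ 2 + 4 * D + 3 * z.
  apply: (@le_trans _ _ ((Nb + N') * (1 - th))).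
    by rewrite mulrC ler_wpM2r ?subr_ge0 //; lra.
  by rewrite F; have := nrm2_collision; have := N0; rewrite -/N -/Nb; lra.
have t2 : z * (1 - th) <= z * (al ^+ 2 + 4 * D + 3 * z) / r.
  rewrite -mulrA ler_wpM2l //.
  have q0 : 0 <= al ^+ 2 + 4 * D + 3 * z by rewrite !addr_ge0 ?mulr_ge0 ?sqr_ge0.
  by apply: le_trans (over_rho q0); rewrite ler_pdivlMr.
rewrite E.
have : - (z * (1 - th)) <= (1 - kap) * ((rho' - rho) * (1 - th)).
  have : - (z * (1 - th)) <= (rho' - rho) * (1 - th) by rewrite -mulNr ler_wpM2r; lra.
  have zt : 0 <= z * (1 - th) by rewrite mulr_ge0 // subr_ge0.
  have := k0; have := k1; nra.
nra.
Qed.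

(** Moving inwards consumes relative speed: as a'^2 is nonnegative, rho^2 - rho'^2 is at most b^2.
    Replacing rho + rho' by 2 rho costs the term in z^2. *)
Lemma flight_loss : - (e ^+ 2 * a ^+ 2 / (2 * rho)) - (2 * al * D + 2 * D ^+ 2 + z ^+ 2) / r
  <= rho' - rho.
Proof.
have [[rho0 a0 b0 rho'0 a'0] [_ D0 z0] _ en /ler_normlP[d1 d2]] := st.
have h1 : - (b ^+ 2 / (2 * rho)) - z ^+ 2 / (2 * rho) <= rho' - rho.
  have r20 : 0 < 2 * rho by rewrite mulr_gt0.
  rewrite -opprD -mulrDl -mulNr ler_pdivrMr //.
  have [xx|xx] := leP rho rho'; last by have := sqr_ge0 a'; nra.
  have : 0 <= (rho' - rho) * (2 * rho) by rewrite mulr_ge0 ?subr_ge0 // ltW.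
  by have := sqr_ge0 b; have := sqr_ge0 z; lra.
apply: le_trans h1.
have h2 : b ^+ 2 / (2 * rho) <= e ^+ 2 * a ^+ 2 / (2 * rho) + (2 * al * D + 2 * D ^+ 2) / r.
  apply: (@le_trans _ _ ((e ^+ 2 * a ^+ 2 + Y) / (2 * rho))).
    by rewrite ler_wpM2r ?b2 // invr_ge0 mulr_ge0 // ltW.
  rewrite mulrDl lerD2l invfM mulrCA mulrC; have := Yrho; lra.
have h3 : z ^+ 2 / (2 * rho) <= z ^+ 2 / r.
  apply: le_trans (over_rho (sqr_ge0 z)); rewrite invfM mulrCA ler_piMl ?mulr_ge0 ?sqr_ge0 ?invr_ge0 ?(ltW rho_gt0) //.
  lra.
have h4 : (2 * al * D + 2 * D ^+ 2 + z ^+ 2) / r = (2 * al * D + 2 * D ^+ 2) / r + z ^+ 2 / r.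
  by rewrite mulrDl.
rewrite h4; lra.
Qed.

Let err_sum :
  (al ^+ 2 * (al ^+ 2 + 2 * D) / 4 + (2 * al * D + 2 * D ^+ 2) +
   2 * z * (al ^+ 2 + 4 * D + 3 * z) + (2 * al * D + 2 * D ^+ 2 + z ^+ 2)) / r <= err.
Proof.
have [_ [_ D0 z0] _ _ _] := st.
rewrite ler_pM2r ?invr_gt0 // /C.
have zD : 0 <= z * D by rewrite mulr_ge0.
have zz := sqr_ge0 z; have DD := sqr_ge0 D.
set s2 := (1 + z + D) ^+ 2.
have [m1 m2 m3 m4 m5] : [/\ 1 <= s2, D <= s2, D ^+ 2 <= s2, z <= s2 & z ^+ 2 <= s2].
  by rewrite /s2; split; lra.
have m6 : z * D <= s2 by rewrite /s2; lra.
have al2 := sqr_ge0 al.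
have al4 : 0 <= al ^+ 2 * al ^+ 2 by rewrite mulr_ge0.
have c : (al ^+ 2 * al ^+ 2 / 4 + 5 / 2 * al ^+ 2 + 4 * al + 19) * s2 <= 20 * (1 + al) ^+ 4 * s2.
  rewrite ler_wpM2r ?sqr_ge0 // -subr_ge0.
  rewrite (_ : _ - _ = 1 + 76 * al + 235 / 2 * al ^+ 2 + 80 * (al * al ^+ 2)
    + 79 / 4 * (al ^+ 2 * al ^+ 2)); last by field.
  by rewrite !addr_ge0 ?mulr_ge0 // divr_ge0.
apply: le_trans c.
have h1 : al ^+ 2 * D <= al ^+ 2 * s2 by rewrite ler_wpM2l.
have h2 : al * D <= al * s2 by rewrite ler_wpM2l.
have h3 : al ^+ 2 * z <= al ^+ 2 * s2 by rewrite ler_wpM2l.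
have h4 : al ^+ 2 * al ^+ 2 * 1 <= al ^+ 2 * al ^+ 2 * s2 by rewrite ler_wpM2l.
move: s2 m1 m2 m3 m4 m5 m6 h1 h2 h3 h4 => s2 *; lra.
Qed.

Let err_split :
  al ^+ 2 * (al ^+ 2 + 2 * D) / (4 * r) + (2 * al * D + 2 * D ^+ 2) / r +
  2 * z * (al ^+ 2 + 4 * D + 3 * z) / r + (2 * al * D + 2 * D ^+ 2 + z ^+ 2) / r <= err.
Proof.
apply: le_trans err_sum; rewrite le_eqVlt; apply/orP; left; apply/eqP.
by field; rewrite gt_eqF.
Qed.

Let err1_ge0 : 0 <= al ^+ 2 * (al ^+ 2 + 2 * D) / (4 * r) + (2 * al * D + 2 * D ^+ 2) / r.
Proof.
have [_ [_ D0 z0] _ _ _] := st.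
by rewrite addr_ge0 // divr_ge0 ?mulr_ge0 ?addr_ge0 ?mulr_ge0 ?sqr_ge0 // ltW.
Qed.

Let err3_ge0 : 0 <= (2 * al * D + 2 * D ^+ 2 + z ^+ 2) / r.
Proof.
have [_ [_ D0 z0] _ _ _] := st.
by rewrite divr_ge0 ?addr_ge0 ?mulr_ge0 ?sqr_ge0 // ltW.
Qed.

(** For a slow particle the gain of the collision is dropped, and the radial displacement is kept as
    the source of drift. *)
Lemma lyap_drift_flat : kap * (rho' - rho) - err <= lyap kap rho' a' - lyap kap rho a.
Proof.
have [[rho0 a0 b0 rho'0 a'0] [/andP[e0 e1] D0 z0] _ en _] := st.
have g1 := collision_gain; have g2 := flight_gain; have h := err_split.
have e1' := err1_ge0; have e3' := err3_ge0; have q0 := k0; have q1 := k1.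
rewrite lyap_flightE.
set E1 := _ + _ / r in e1'.
have X0 : 0 <= (1 - e ^+ 2) * (a ^+ 2 / (2 * rho)).
  rewrite mulr_ge0 ?subr_ge0 ?expr_le1 // divr_ge0 ?sqr_ge0 // mulr_ge0 //.
have g1' : - E1 <= N - Nb by rewrite /E1; lra.
have g1'' : - E1 <= (1 - kap) * (N - Nb) by nra.
by rewrite /E1 in g1''; lra.
Qed.

(** Collision gain and worst flight loss combine through (1 - kap) (1 - e^2) - kap e^2 = 1 - e^2 -
    kap. *)
Lemma lyap_drift_gain :
  ((1 - e ^+ 2) - kap) * (a ^+ 2 / (2 * rho)) - err <= lyap kap rho' a' - lyap kap rho a.
Proof.
have [[rho0 a0 b0 rho'0 a'0] [/andP[e0 e1] D0 z0] _ en _] := st.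
have g1 := collision_gain; have g2 := flight_gain; have g3 := flight_loss.
have h := err_split.
have e1' := err1_ge0; have e3' := err3_ge0; have q0 := k0; have q1 := k1.
rewrite lyap_flightE.
set E1 := _ + _ / r in e1'; set E3 := _ / r in e3'.
pose X : R := a ^+ 2 / (2 * rho).
have X0 : 0 <= X by rewrite divr_ge0 ?sqr_ge0 // mulr_ge0.
have e20 : 0 <= e ^+ 2 by rewrite sqr_ge0.
have g1' : (1 - e ^+ 2) * X - E1 <= N - Nb by rewrite /E1 /X; lra.
have g3' : - (e ^+ 2 * X) - E3 <= rho' - rho by rewrite /E3 /X mulrA.
have g1'' : (1 - kap) * ((1 - e ^+ 2) * X) - E1 <= (1 - kap) * (N - Nb).
  have := ler_wpM2l (_ : 0 <= 1 - kap) g1'; rewrite subr_ge0 => /(_ q1); nra.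
have g3'' : - (kap * (e ^+ 2 * X)) - E3 <= kap * (rho' - rho).
  have := ler_wpM2l q0 g3'; nra.
rewrite -/X; rewrite /E1 in g1''; rewrite /E3 in g3''; lra.
Qed.

Lemma lyap_step_abs : `|lyap kap rho' a' - lyap kap rho a| <= al ^+ 2 / 2 + 2 * z + 2 * D.
Proof.
have [[rho0 a0 b0 rho'0 a'0] [/andP[e0 e1] D0 z0] _ en /ler_normlP[d1 d2]] := st.
apply/ler_normlP; split.
  by have := lyap_step_ge; have := sqr_ge0 al; lra.
have [th [/andP[th0 th1] E _]] := flight_coef.
have hb := nrm2_gel rho b; rewrite -/Nb in hb.
have q0 := k0; have q1 := k1; have hN := N0.
rewrite lyap_flightE E.
have h1 : (1 - kap) * (N - Nb) <= al ^+ 2 / 2.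
  have n0 : 0 <= N - rho by rewrite subr_ge0 nrm2_gel.
  have : (1 - kap) * (N - Nb) <= (1 - kap) * (N - rho) by rewrite ler_wpM2l ?subr_ge0 //; lra.
  have : (1 - kap) * (N - rho) <= N - rho by rewrite ler_piMl //; lra.
  lra.
set c := (2 - kap) * _ - _.
have cE : c = (rho' - rho) * (kap + 2 * (1 - kap) * (1 - th)) by rewrite /c; ring.
have c0 : 0 <= kap + 2 * (1 - kap) * (1 - th) by rewrite addr_ge0 // mulr_ge0 // ?mulr_ge0 ?subr_ge0.
have c2 : kap + 2 * (1 - kap) * (1 - th) <= 2.
  have : (1 - kap) * (1 - th) <= 1 - kap by rewrite ler_piMr ?subr_ge0 // gerBl.
  lra.
have : c <= 2 * z by rewrite cE; nra.
lra.
Qed.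

Lemma flight_loss_err : - (e ^+ 2 * a ^+ 2 / (2 * rho)) - err <= rho' - rho.
Proof.
have [_ [_ D0 z0] _ _ _] := st.
have := flight_loss; have := err_split; have := err1_ge0.
have : 0 <= 2 * z * (al ^+ 2 + 4 * D + 3 * z) / r.
  by rewrite divr_ge0 ?addr_ge0 ?mulr_ge0 ?addr_ge0 ?mulr_ge0 ?sqr_ge0 // ltW.
lra.
Qed.

End moderate.

(** The bound 4 / (1 - e0) on [B], hence on [a], keeps the noise 2 D, at most 2, below half of the
    speed loss (1 - e0) a; [nrm2_drop] applies to the other half. *)
Lemma lyap_big_gain e0 B : 0 <= e0 < 1 -> e <= e0 -> D <= 1 -> 1 <= B ->
  4 / (1 - e0) <= B -> B ^+ 2 * (rho + 1) <= a ^+ 2 ->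
  (1 - kap) * ((1 - e0) * B / 8) - 2 * z <= lyap kap rho' a' - lyap kap rho a.
Proof.
move=> /andP[e00 e01] ee0 D1 B1 B4 aB.
have [[rho0 a0 b0 _ _] _ bb _ _] := st.
have e0p : 0 < 1 - e0 by rewrite subr_gt0.
have aB1 : B <= a.
  apply: ler_of_sqr => //; apply: le_trans aB; rewrite ler_peMr ?sqr_ge0 //.
  by rewrite lerDr.
have a4 : 4 <= (1 - e0) * a.
  rewrite (@le_trans _ _ ((1 - e0) * B)) //; first by rewrite mulrC -ler_pdivrMr.
  by rewrite ler_wpM2l // ltW.
have ba : b <= a - (1 - e0) / 2 * a.
  have : e * a <= e0 * a by rewrite ler_wpM2r.
  by lra.
have c01 : 0 < 1 - e0 <= 1 by rewrite e0p gerBl.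
have gain := nrm2_drop c01 rho0 a0 b0 ba B1 aB1 aB.
rewrite lyap_flightE.
have h1 := flight_part_ge.
have h2 : (1 - kap) * ((1 - e0) * B / 8) <= (1 - kap) * (N - Nb) by rewrite ler_wpM2l // subr_ge0.
by lra.
Qed.

End step.
End lyapunov.

Section exponential_bounds.
Variable R : realType.
Implicit Types x y s c : R.

Lemma expR_le1Dxe y : expR y <= 1 + y * expR y.
Proof.
have := ler_wpM2r (expR_ge0 y) (expR_ge1Dx (- y)).
rewrite -expRD addNr expR0; lra.
Qed.

Lemma expR_quad_le y : expR y <= 1 + y + y ^+ 2 * expR `|y|.
Proof.
have h1 := expR_le1Dxe y; have h2 := expR_ge1Dx y.
suff : y * (expR y - 1) <= y ^+ 2 * expR `|y| by nra.
have [y0|y0] := leP 0 y.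
  rewrite ger0_norm // expr2 -mulrA ler_wpM2l //; lra.
have e1 : 1 <= expR `|y| by rewrite -[leLHS]expR0 ler_expR.
apply: (@le_trans _ _ (y ^+ 2)); first by rewrite expr2 ler_wnM2l ?(ltW y0) //; lra.
by rewrite ler_peMr ?sqr_ge0.
Qed.

Lemma expRN_le_half x : 0 <= x <= 1 -> expR (- x) <= 1 - x / 2.
Proof.
move=> /andP[x0 x1]; rewrite expRN.
have h := expR_ge1Dx x.
have e0 : 0 < expR x by exact: expR_gt0.
rewrite -div1r ler_pdivrMr //.
have : (1 + x) * (1 - x / 2) <= expR x * (1 - x / 2) by rewrite ler_wpM2r //; lra.
nra.
Qed.

Lemma le_expR_div c s : 0 < c -> s <= expR (c * s) / c.
Proof.
move=> c0; rewrite ler_pdivlMr // mulrC; have := expR_ge1Dx (c * s); lra.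
Qed.

Lemma sqr1D_le_expR c s : 0 < c -> 0 <= s ->
  (1 + s) ^+ 2 <= (1 + 2 / c) ^+ 2 * expR (c * s).
Proof.
move=> c0 s0; have c20 : 0 < c / 2 by rewrite divr_gt0.
have -> : c * s = c / 2 * s + c / 2 * s by field.
rewrite expRD -expr2 -exprMn ler_sqr ?nnegrE ?addr_ge0 ?mulr_ge0 ?addr_ge0 ?divr_ge0 ?expR_ge0 ?(ltW c0) //.
have := le_expR_div s c20.
have -> : expR (c / 2 * s) / (c / 2) = 2 / c * expR (c / 2 * s) by field; rewrite gt_eqF.
have : 1 <= expR (c / 2 * s).
  by rewrite -[leLHS]expR0 ler_expR mulr_ge0 // ltW.
lra.
Qed.

End exponential_bounds.

(** * Exponential contraction outside a compact set *)

Section contraction.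
Variable R : realType.
Variables (e0 p th0 Bq zmax K0 be0 c3 : R).
Implicit Types rho a s r : R.
Hypothesis e0_bnd : 0 <= e0 < 1.
Hypothesis p_bnd : 0 < p <= 1.
Hypothesis th0_gt0 : 0 < th0.
Hypothesis Bq1 : 1 <= Bq.
Hypothesis zmax0 : 0 <= zmax.
Hypothesis be00 : 0 < be0.
Hypothesis c30 : 0 < c3.
Hypothesis c31 : c3 <= 1.

(** Half of (1 - e0^2) p, a lower bound for the mean of 1 - e^2, so that the factor in
    [lyap_drift_gain] has mean at least [kappa]. *)
Definition kappa := (1 - e0 ^+ 2) * p / 2.

Let p0 : 0 < p. Proof. by case/andP: p_bnd. Qed.
Let p1 : p <= 1. Proof. by case/andP: p_bnd. Qed.
Let e00 : 0 <= e0. Proof. by case/andP: e0_bnd. Qed.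
Let e01 : e0 < 1. Proof. by case/andP: e0_bnd. Qed.
Let f0 : 0 < 1 - e0 ^+ 2. Proof. by rewrite subr_gt0 expr_lt1. Qed.
Let f1 : 1 - e0 ^+ 2 <= 1. Proof. by rewrite gerBl sqr_ge0. Qed.

Lemma kappa_gt0 : 0 < kappa. Proof. by rewrite divr_gt0 // mulr_gt0. Qed.

Lemma kappa_le : kappa <= 1 / 2.
Proof. by rewrite ler_pM2r // mulr_ile1 // ltW. Qed.

Let kap01 : 0 <= kappa <= 1.
Proof. by rewrite (ltW kappa_gt0) (le_trans kappa_le) //; lra. Qed.

(* The good event: dissipative collision, moderate noise, and a flight long enough to push
   a slow particle outwards. *)
Definition good_step (rho e D z b rho' : R) :=
  [/\ e <= e0, D <= 1, z <= zmax & (K0 <= rho -> b <= be0 * Num.sqrt rho -> c3 <= rho' - rho)].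

(* Integrated over a noise with P(G) >= p and E[exp (th0 (z + D))] <= Bq, the pointwise bound
   gives E[exp (- th (h' - h))] <= gam. *)
Definition step_contracts (th gam rho a : R) :=
  exists c0 c1 c2, [/\ 0 <= c1 <= c0, 0 <= c2, c0 - c1 * p + c2 * Bq <= gam &
    forall (e D z b rho' a' : R) (G : bool), one_step rho a e D z b rho' a' ->
      (G -> good_step rho e D z b rho') ->
      expR (- th * (lyap kappa rho' a' - lyap kappa rho a)) <=
        c0 - c1 * G%:R + c2 * expR (th0 * (z + D))].

(** [La] is the gain asked of a fast particle on the good event: p La / 2 pays for the noise term C1
    Bq and leaves 1. [B] is the threshold of the fast regime, beyond which a collision provides that
    gain; below it, [a] is at most [al] times [sqrt rho]. [eps0] separates slow from intermediate
    speeds: the first bound [c3 * p] lets the push win in mean, the second makes the push available.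
    [C2] and [C3] bound the second-order and error terms, and th de will be the mean first-order
    gain. *)
Let C1 : R := 4 / th0.
Let La : R := 2 * (C1 * Bq + 1) / p.
Let B : R := Num.max 1 (Num.max (4 / (1 - e0)) (16 * (La + 2 * zmax) / (1 - e0))).
Let al : R := 2 * B.
Let eps0 : R := Num.min 1 (Num.min (c3 * p) (be0 ^+ 2 / 4)).
Let C4 : R := (1 + 2 / (th0 / 2)) ^+ 2.
Let C2 : R := (al ^+ 2 / 2 + 2) ^+ 2 * expR (al ^+ 2 / 2) * C4.
Let C3 : R := 20 * (1 + al) ^+ 4 * C4.
Let de : R := kappa * eps0 / 2.

Let C10 : 0 < C1. Proof. by rewrite divr_gt0. Qed.
Let La0 : 0 < La.
Proof. by rewrite divr_gt0 // mulr_gt0 // addr_gt0 // mulr_gt0 // (lt_le_trans _ Bq1). Qed.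
Let B1 : 1 <= B. Proof. by rewrite le_max lexx. Qed.
Let B4 : 4 / (1 - e0) <= B. Proof. by rewrite !le_max lexx orbT. Qed.
Let BLa : La <= (1 - kappa) * ((1 - e0) * B / 8) - 2 * zmax.
Proof.
have h : 16 * (La + 2 * zmax) <= (1 - e0) * B.
  by rewrite [leRHS]mulrC -ler_pdivrMr ?subr_gt0 // !le_max lexx !orbT.
have hk := kappa_le.
have : (1 / 2) * ((1 - e0) * B / 8) <= (1 - kappa) * ((1 - e0) * B / 8).
  rewrite ler_wpM2r //; last lra.
  by rewrite divr_ge0 // (le_trans _ h) // mulr_ge0 // addr_ge0 ?(ltW La0) // mulr_ge0.
lra.
Qed.
Let al0 : 0 <= al. Proof. by rewrite mulr_ge0 // (le_trans _ B1). Qed.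
Let al2 : 2 <= al. Proof. by rewrite /al; have := B1; lra. Qed.
Let C40 : 0 < C4.
Proof. by rewrite exprn_gt0 // addr_gt0 // divr_gt0 // divr_gt0. Qed.
Let C20 : 0 < C2.
Proof.
rewrite mulr_gt0 // mulr_gt0 ?expR_gt0 // exprn_gt0 //.
by rewrite ltr_wpDl // divr_ge0 // sqr_ge0.
Qed.
Let C30 : 0 < C3.
Proof. by rewrite mulr_gt0 // mulr_gt0 // exprn_gt0 // ltr_wpDr. Qed.
Let eps00 : 0 < eps0.
Proof. by rewrite !lt_min ltr01 mulr_gt0 //= divr_gt0 // exprn_gt0. Qed.
Let eps01 : eps0 <= 1. Proof. by rewrite ge_min lexx. Qed.
Let eps0c : eps0 <= c3 * p. Proof. by rewrite !ge_min lexx orbT. Qed.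
Let eps0b : eps0 <= be0 ^+ 2 / 4. Proof. by rewrite !ge_min lexx !orbT. Qed.
Let de0 : 0 < de. Proof. by rewrite divr_gt0 // mulr_gt0 // kappa_gt0. Qed.
Let de1 : de <= 1.
Proof.
have : kappa * eps0 <= 1 by rewrite mulr_ile1 ?(ltW kappa_gt0) ?(ltW eps00) //; case/andP: kap01.
by rewrite /de; lra.
Qed.

(** In turn: exponentials of th times the noise fit into those of th0; [expRN_le_half] applies to th
    La; th X stays at most 1 and expR (th al^2 / 2) bounded; the second-order term is at most a
    quarter of the first-order gain. *)
Let th : R := Num.min (th0 / 8) (Num.min (La^-1) (Num.min ((al ^+ 2)^-1) (Num.min 1 (de / (4 * (C2 * Bq)))))).
Let Bq0 : 0 < Bq. Proof. exact: lt_le_trans Bq1. Qed.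
Let al20 : 0 < al ^+ 2. Proof. by rewrite exprn_gt0 // (lt_le_trans _ al2). Qed.
Let thp : 0 < th.
Proof.
rewrite !lt_min !invr_gt0 ltr01 La0 al20 divr_gt0 //= divr_gt0 // mulr_gt0 // mulr_gt0 //.
Qed.
Let th_th0 : th <= th0 / 8. Proof. by rewrite ge_min lexx. Qed.
Let th_La : th * La <= 1.
Proof. by rewrite -ler_pdivlMr // div1r !ge_min lexx !orbT. Qed.
Let th_al : th * al ^+ 2 <= 1.
Proof. by rewrite -ler_pdivlMr // div1r !ge_min lexx !orbT. Qed.
Let th_1 : th <= 1. Proof. by rewrite !ge_min lexx !orbT. Qed.
Let th_de : th * (C2 * Bq) <= de / 4.
Proof.
have CB : 0 < C2 * Bq by rewrite mulr_gt0.
rewrite -ler_pdivlMr //.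
have -> : de / 4 / (C2 * Bq) = de / (4 * (C2 * Bq)) by field; rewrite !gt_eqF.
by rewrite !ge_min lexx !orbT.
Qed.

(** Half of the mean gain th de is spent, a quarter on the second-order term and a quarter on the
    errors of order 1/r, for which [Kr] is taken large. *)
Let gam : R := 1 - th * de / 2.
Let Kr : R := Num.max 1 (Num.max (4 / be0) (8 * C3 * Bq / de)).
Let K : R := Num.max K0 (Kr ^+ 2).

(** No second-order expansion is needed: the good event gives at least [La], and in all cases [lyap]
    decreases by at most twice the noise. *)
Let case_far rho a : 0 <= rho -> 0 <= a -> B ^+ 2 * (rho + 1) <= a ^+ 2 ->
  step_contracts th gam rho a.
Proof.
move=> rho0 a0 aB; have thp' := thp.
exists 1, (th * La / 2), (th * C1).
have tL0 : 0 <= th * La by rewrite mulr_ge0 // ltW // ?La0.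
split.
- by rewrite divr_ge0 //=; have := th_La; lra.
- by rewrite mulr_ge0 // ltW // ?C10.
- have -> : th * La / 2 * p = th * (C1 * Bq + 1) by rewrite /La; field; rewrite !gt_eqF.
  have : th * de <= th by rewrite ler_piMr // ltW.
  by rewrite /gam; lra.
move=> e D z b rho' a' G st gd.
have [_ [_ D0 z0] _ _ _] := st.
set y := _ - _; set s := z + D.
have s0 : 0 <= s by rewrite addr_ge0.
have ys : - (2 * s) <= y by have := lyap_step_ge st kap01; rewrite -/y /s; lra.
have Q0 : 0 <= th * C1 * expR (th0 * s) by apply: mulr_ge0; [apply: mulr_ge0; exact: ltW|exact: expR_ge0].
case: G gd => gd.
  have [ee0 D1 zz _] := gd isT.
  have Ly : La <= y.
    have := lyap_big_gain st kap01 e0_bnd ee0 D1 B1 B4 aB.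
    by have := BLa; rewrite -/y; lra.
  rewrite mulr1.
  have h := @expRN_le_half R (th * La); rewrite tL0 th_La in h.
  apply: (@le_trans _ _ (expR (- (th * La)))).
    by rewrite ler_expR mulNr lerN2 ler_wpM2l // ltW.
  by have := h isT; lra.
rewrite mulr0 subr0.
apply: (@le_trans _ _ (expR (2 * th * s))).
  by rewrite ler_expR mulNr lerNl -mulrN (mulrC 2) -mulrA ler_wpM2l ?(ltW thp) //; lra.
apply: le_trans (expR_le1Dxe _) _; rewrite lerD2l.
have h1 : s <= 2 / th0 * expR (th0 / 2 * s).
  have := @le_expR_div R (th0 / 2) s; rewrite divr_gt0 // => /(_ isT).
  by rewrite (_ : _ / (th0 / 2) = 2 / th0 * expR (th0 / 2 * s)) //; field; rewrite gt_eqF.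
have h2 : expR (2 * th * s) <= expR (th0 / 2 * s).
  by rewrite ler_expR ler_wpM2r //; have := th_th0; have := th0_gt0; lra.
have -> : 2 * th * s * expR (2 * th * s) = 2 * th * (s * expR (2 * th * s)) by ring.
have -> : th * C1 * expR (th0 * s) = 2 * th * (2 / th0 * expR (th0 / 2 * s) * expR (th0 / 2 * s)).
  have -> : th0 * s = th0 / 2 * s + th0 / 2 * s by field.
  by rewrite expRD /C1; field; rewrite gt_eqF.
rewrite ler_wpM2l ?mulr_ge0 ?(ltW thp) //.
by apply: ler_pM => //; exact: expR_ge0.
Qed.

Let Kr1 : 1 <= Kr. Proof. by rewrite le_max lexx. Qed.
Let Krb : 4 / be0 <= Kr. Proof. by rewrite !le_max lexx orbT. Qed.
Let KrC : 8 * C3 * Bq / de <= Kr. Proof. by rewrite !le_max lexx !orbT. Qed.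
Let K_K0 : K0 <= K. Proof. by rewrite le_max lexx. Qed.
Let K_Kr : Kr ^+ 2 <= K. Proof. by rewrite le_max lexx orbT. Qed.

Section near.
Variables (rho a e D z b rho' a' : R).
Hypothesis Krho : K <= rho.
Hypothesis aB : a ^+ 2 < B ^+ 2 * (rho + 1).
Hypothesis st : one_step rho a e D z b rho' a'.
Let r := Num.sqrt rho.
Let y := lyap kappa rho' a' - lyap kappa rho a.
Let s := z + D.
Let Q := expR (th0 * s).

Let rho0 : 0 <= rho. Proof. by case: st => -[]. Qed.
Let a0 : 0 <= a. Proof. by case: st => -[]. Qed.
Let s0 : 0 <= s. Proof. by case: st => _ [_ D0 z0] _ _ _; rewrite addr_ge0. Qed.
Let rE : rho = r ^+ 2. Proof. by rewrite sqr_sqrtr. Qed.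
Let rK : Kr <= r.
Proof.
apply: ler_of_sqr; first exact: sqrtr_ge0.
by rewrite -rE (le_trans K_Kr).
Qed.
Let r1 : 1 <= r. Proof. exact: le_trans rK. Qed.
Let r0 : 0 < r. Proof. exact: lt_le_trans r1. Qed.
Let rho1 : 1 <= rho. Proof. by rewrite rE exprn_ege1. Qed.
Let aal : a <= al * r.
Proof.
apply: ler_of_sqr; first by rewrite mulr_ge0 // ltW.
apply: (le_trans (ltW aB)); rewrite exprMn -rE /al exprMn.
have : 0 <= B ^+ 2 * (rho - 1) by rewrite mulr_ge0 ?sqr_ge0 // subr_ge0.
have : 0 <= B ^+ 2 * rho by rewrite mulr_ge0 ?sqr_ge0.
by lra.
Qed.

Let s_sqr : (1 + z + D) ^+ 2 <= C4 * expR (th0 / 2 * s).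
Proof. by rewrite -addrA; apply: sqr1D_le_expR => //; rewrite divr_gt0. Qed.

Let halfQ : expR (th0 / 2 * s) <= Q.
Proof. by rewrite ler_expR ler_wpM2r // ler_pdivrMr // ler_peMr // ?ler1n // ltW. Qed.

Let Q0 : 0 <= Q. Proof. exact: expR_ge0. Qed.

Let err_le : 20 * (1 + al) ^+ 4 * (1 + z + D) ^+ 2 / r <= C3 / r * Q.
Proof.
rewrite mulrAC; apply: (@le_trans _ _ (20 * (1 + al) ^+ 4 / r * (C4 * Q))).
  rewrite ler_wpM2l ?divr_ge0 ?mulr_ge0 ?exprn_ge0 ?addr_ge0 ?(ltW r0) //.
  by rewrite (le_trans s_sqr) // ler_wpM2l // ltW.
by rewrite /C3 le_eqVlt; apply/orP; left; apply/eqP; field; rewrite gt_eqF.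
Qed.

(** The remainder is y^2 expR (th |y|) with |y| bounded by a constant plus twice the noise. The
    exponent th0 s is split in two halves, one absorbing the polynomial and the other the
    exponential. *)
Let exp_quad : expR (- th * y) <= 1 - th * y + th ^+ 2 * C2 * Q.
Proof.
have ya := lyap_step_abs st kap01 al0 r1 rE aal; rewrite -/y in ya.
apply: le_trans (expR_quad_le _) _.
rewrite mulNr lerD2l sqrrN normrN exprMn normrM (gtr0_norm thp) -[leLHS]mulrA -[leRHS]mulrA.
rewrite ler_wpM2l ?sqr_ge0 //.
pose m := (al ^+ 2 / 2 + 2) * (1 + z + D).
have al22 : 0 <= al ^+ 2 / 2 by rewrite divr_ge0 // ltW.
have [_ [_ D0 z0] _ _ _] := st.
have ym : `|y| <= m.
  apply: le_trans ya _; rewrite /m.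
  have : 0 <= al ^+ 2 / 2 * (z + D) by rewrite mulr_ge0.
  by lra.
have y2 : y ^+ 2 <= (al ^+ 2 / 2 + 2) ^+ 2 * (C4 * expR (th0 / 2 * s)).
  rewrite -real_normK ?num_real //.
  apply: (@le_trans _ _ (m ^+ 2)); first by rewrite ler_sqr ?nnegrE // (le_trans _ ym).
  by rewrite /m exprMn ler_wpM2l ?sqr_ge0.
have ey : expR (th * `|y|) <= expR (al ^+ 2 / 2) * expR (th0 / 2 * s).
  rewrite -expRD ler_expR.
  apply: (@le_trans _ _ (th * (al ^+ 2 / 2 + 2 * s))).
    rewrite ler_wpM2l ?(ltW thp) // (le_trans ya) // /s; lra.
  rewrite mulrDr; apply: lerD; first by rewrite ler_piMl.
  rewrite mulrA; apply: ler_wpM2r => //.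
  by have := th_th0; have := th0_gt0; lra.
apply: (@le_trans _ _ ((al ^+ 2 / 2 + 2) ^+ 2 * (C4 * expR (th0 / 2 * s)) * (expR (al ^+ 2 / 2) * expR (th0 / 2 * s)))).
  by apply: ler_pM; rewrite ?sqr_ge0 ?expR_ge0.
rewrite /C2 /Q (_ : th0 * s = th0 / 2 * s + th0 / 2 * s); last by field.
by rewrite expRD le_eqVlt; apply/orP; left; apply/eqP; ring.
Qed.

Variable G : bool.
Hypothesis gd : G -> good_step rho e D z b rho'.

Let tail_coef : R := 2 * th * C3 / r + th ^+ 2 * C2.

Let sq_e : 0 <= 1 - e ^+ 2.
Proof. by case: st => _ [/andP[e0' e1] _ _] _ _ _; rewrite subr_ge0 expr_le1. Qed.

(** The good event raises the factor of [X] in the drift from [- kappa] to at least 1 - e0^2 -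
    kappa; off it, a loss is possible. *)
Lemma step_mid X : X = a ^+ 2 / (2 * rho) ->
  expR (- th * y) <= (1 + th * kappa * X) - th * (1 - e0 ^+ 2) * X * G%:R + tail_coef * Q.
Proof.
move=> XE; apply: le_trans exp_quad _.
have dg := lyap_drift_gain st kap01 al0 r1 rE aal; rewrite -/y -XE in dg.
have el := err_le.
have X0 : 0 <= X by rewrite XE divr_ge0 ?sqr_ge0 // mulr_ge0.
have eG : (1 - e0 ^+ 2) * G%:R <= 1 - e ^+ 2.
  case: G gd => gd'; last by rewrite mulr0.
  have [ee0 _ _ _] := gd' isT.
  rewrite mulr1 lerD2l lerN2 ler_sqr ?nnegrE //.
  by case: st => _ [/andP[]].
have h1 : (1 - e0 ^+ 2) * G%:R * X - kappa * X - C3 / r * Q <= y.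
  apply: le_trans dg; rewrite mulrBl.
  by have := ler_wpM2r X0 eG; lra.
have h2 := ler_wpM2l (ltW thp) h1.
have CQ : 0 <= th * (C3 / r * Q).
  by apply: mulr_ge0; [exact: ltW|apply: mulr_ge0 => //; apply: divr_ge0; exact: ltW].
rewrite /tail_coef.
have -> : (2 * th * C3 / r + th ^+ 2 * C2) * Q = 2 * (th * (C3 / r * Q)) + th ^+ 2 * C2 * Q by ring.
have -> : th * (1 - e0 ^+ 2) * X * G%:R = th * ((1 - e0 ^+ 2) * G%:R * X) by ring.
have -> : th * kappa * X = th * (kappa * X) by ring.
by move: h2; rewrite !mulrBr; lra.
Qed.

(** On the good event the push applies and rho' - rho is at least [c3]; otherwise the flight loses
    at most a^2 / (2 rho), that is [eps0 / 2], up to the error. *)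
Lemma step_slow : a ^+ 2 <= eps0 * rho ->
  expR (- th * y) <= (1 + th * kappa * (eps0 / 2))
    - th * kappa * (c3 + eps0 / 2) * G%:R + tail_coef * Q.
Proof.
move=> ae; apply: le_trans exp_quad _.
have df := lyap_drift_flat st kap01 al0 r1 rE aal; rewrite -/y in df.
have fl := flight_loss_err st al0 r1 rE aal.
have el := err_le.
set err := _ / r in df fl el.
have err0 : 0 <= err.
  apply: divr_ge0; last exact: ltW.
  by apply: mulr_ge0; rewrite ?sqr_ge0 // mulr_ge0 // exprn_ge0 // addr_ge0.
have [_ [/andP[e0' e1] D0 z0] bb _ _] := st.
have push : (c3 + eps0 / 2) * G%:R - eps0 / 2 - err <= rho' - rho.
  case: G gd => gd'; last first.
    rewrite mulr0 sub0r; apply: le_trans fl; rewrite lerD2r lerN2.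
    rewrite ler_pdivrMr; last by rewrite mulr_gt0 // (lt_le_trans _ rho1).
    apply: (@le_trans _ _ (a ^+ 2)); first by rewrite ler_piMl ?sqr_ge0 // expr_le1.
    by apply: (le_trans ae); lra.
  have [_ D1 _] := gd' isT.
  move=> /(_ (le_trans K_K0 Krho)) /(_ _) pu; rewrite mulr1.
  suff : c3 <= rho' - rho by have := eps00; lra.
  apply: pu; rewrite -/r.
  have ar : a <= be0 / 2 * r.
    apply: ler_of_sqr; first by rewrite mulr_ge0 ?divr_ge0 // ltW.
    apply: (le_trans ae); rewrite exprMn -rE ler_wpM2r //.
    by rewrite (le_trans eps0b) // exprMn exprVn; lra.
  have br : 4 <= be0 * r by rewrite [leRHS]mulrC -ler_pdivrMr // (le_trans Krb).
  have : e * a <= a by rewrite ler_piMl.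
  by lra.
have h1 := ler_wpM2l (ltW kappa_gt0) push.
have h2 : kappa * err <= err by rewrite ler_piMl //; case/andP: kap01.
have h3 : kappa * ((c3 + eps0 / 2) * G%:R) - kappa * (eps0 / 2) - 2 * (C3 / r * Q) <= y.
  by move: h1; rewrite !mulrBr; lra.
have h4 := ler_wpM2l (ltW thp) h3.
rewrite /tail_coef.
have -> : (2 * th * C3 / r + th ^+ 2 * C2) * Q = 2 * (th * (C3 / r * Q)) + th ^+ 2 * C2 * Q by ring.
have -> : th * kappa * (c3 + eps0 / 2) * G%:R = th * (kappa * ((c3 + eps0 / 2) * G%:R)) by ring.
by move: h4; rewrite !mulrBr; lra.
Qed.
End near.

Let tail_coef (r : R) : R := 2 * th * C3 / r + th ^+ 2 * C2.

Let tail_le r : Kr <= r -> tail_coef r * Bq <= th * de / 2.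
Proof.
move=> Kr_r; have r0 : 0 < r by rewrite (lt_le_trans _ Kr_r) // (lt_le_trans _ Kr1).
have h1 : 8 * C3 * Bq <= de * r.
  by rewrite [leRHS]mulrC -ler_pdivrMr // (le_trans KrC).
have h2 : C3 / r * Bq <= de / 8.
  by rewrite mulrAC ler_pdivrMr //; lra.
have := ler_wpM2l (ltW thp) h2; have := ler_wpM2l (ltW thp) th_de.
rewrite /tail_coef.
have -> : (2 * th * C3 / r + th ^+ 2 * C2) * Bq = 2 * (th * (C3 / r * Bq)) + th * (th * (C2 * Bq)) by ring.
by lra.
Qed.

Let kpE : (1 - e0 ^+ 2) * p = 2 * kappa.
Proof. by rewrite /kappa; field. Qed.

Let case_near rho a : 0 <= rho -> 0 <= a -> K <= rho -> a ^+ 2 < B ^+ 2 * (rho + 1) ->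
  step_contracts th gam rho a.
Proof.
move=> rho0 a0 Krho aB.
have Kr_r : Kr <= Num.sqrt rho.
  apply: ler_of_sqr; first exact: sqrtr_ge0.
  by rewrite sqr_sqrtr // (le_trans K_Kr).
have r0 : 0 < Num.sqrt rho by rewrite (lt_le_trans _ Kr_r) // (lt_le_trans _ Kr1).
have rho1 : 1 <= rho.
  rewrite -(sqr_sqrtr rho0) exprn_ege1 // (le_trans Kr1) //.
have tl := tail_le Kr_r.
have t0 : 0 <= tail_coef (Num.sqrt rho).
  by apply: addr_ge0; [apply: divr_ge0; [apply: mulr_ge0; [apply: mulr_ge0|]|]|apply: mulr_ge0];
    rewrite ?sqr_ge0 //; exact: ltW.
have [ae|ea] := leP (a ^+ 2) (eps0 * rho).
  exists (1 + th * kappa * (eps0 / 2)), (th * kappa * (c3 + eps0 / 2)), (tail_coef (Num.sqrt rho)).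
  have tk0 : 0 <= th * kappa by rewrite mulr_ge0 // ltW // ?kappa_gt0.
  have e20 : 0 <= eps0 / 2 by rewrite divr_ge0 // ltW.
  have k1 : kappa <= 1 by case/andP: kap01.
  have tkc : th * kappa * c3 <= 1.
    by apply: mulr_ile1 => //; rewrite ?(ltW c30) // mulr_ile1 // ltW // ?kappa_gt0.
  split => //.
  - apply/andP; split; first by rewrite mulr_ge0 // addr_ge0 // ltW.
    by rewrite mulrDr; lra.
  (* Since [eps0 <= c3 * p], the mean first-order term is at most - th de. *)
  - have h1 : th * kappa * eps0 <= th * kappa * (c3 * p) by rewrite ler_wpM2l.
    have h2 : 0 <= th * kappa * (eps0 / 2 * p) by rewrite mulr_ge0 // mulr_ge0 // ltW.
    by rewrite /gam; move: tl; rewrite /de; lra.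
  - by move=> e D z b rho' a' G st gd; exact: (step_slow Krho aB st gd ae).
pose X : R := a ^+ 2 / (2 * rho).
have r20 : 0 < 2 * rho by rewrite mulr_gt0 // (lt_le_trans _ rho1).
have X0 : 0 <= X by rewrite divr_ge0 ?sqr_ge0 // ltW.
have Xe : eps0 / 2 <= X by rewrite ler_pdivlMr //; lra.
have XB : X <= al ^+ 2.
  rewrite ler_pdivrMr //; apply: (le_trans (ltW aB)).
  have h1 : 0 <= B ^+ 2 * (rho - 1) by rewrite mulr_ge0 ?sqr_ge0 // subr_ge0.
  have h2 : 0 <= B ^+ 2 * rho by rewrite mulr_ge0 ?sqr_ge0.
  by rewrite /al exprMn; lra.
have thX : th * X <= 1 by rewrite (le_trans _ th_al) // ler_wpM2l // ltW.
have thX0 : 0 <= th * X by rewrite mulr_ge0 // ltW.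
exists (1 + th * kappa * X), (th * (1 - e0 ^+ 2) * X), (tail_coef (Num.sqrt rho)).
split => //.
- have h1 : (1 - e0 ^+ 2) * (th * X) <= th * X by rewrite ler_piMl.
  have h2 : 0 <= kappa * (th * X) by rewrite mulr_ge0 // ltW // ?kappa_gt0.
  have h3 : 0 <= (1 - e0 ^+ 2) * (th * X) by rewrite mulr_ge0 // ltW.
  by apply/andP; split; lra.
- have -> : th * (1 - e0 ^+ 2) * X * p = (1 - e0 ^+ 2) * p * (th * X) by ring.
  rewrite kpE.
  (* By [kpE] the mean first-order term is - th kappa X, and [X] is at least [eps0 / 2] in this
     regime. *)
  have : th * kappa * (eps0 / 2) <= th * kappa * X by rewrite ler_wpM2l // mulr_ge0 // ltW // ?kappa_gt0.
  by rewrite /gam; move: tl; rewrite /de; lra.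
- by move=> e D z b rho' a' G st gd; exact: (step_mid Krho aB st gd).
Qed.

Lemma step_contracts_outside : exists th gam K A,
  [/\ 0 < th <= th0, 0 <= gam < 1, 0 <= K & 0 <= A /\
   forall rho a, 0 <= rho -> 0 <= a -> K <= rho \/ A <= a -> step_contracts th gam rho a].
Proof.
have K_ge0 : 0 <= K by rewrite (le_trans _ K_Kr) // sqr_ge0.
have td0 : 0 < th * de by rewrite mulr_gt0.
have td1 : th * de <= 1 by rewrite mulr_ile1 // ltW.
(* With [rho < K], a speed of at least B (K + 1) belongs to the fast regime. *)
exists th, gam, K, (B * (K + 1)); split => //.
- rewrite thp /=; have := th_th0; have := th0_gt0; lra.
- by rewrite /gam; apply/andP; split; lra.
have B0 : 0 <= B by exact: le_trans B1.
split; first by rewrite mulr_ge0 // addr_ge0.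
move=> rho a rho0 a0 KA.
have [aB|aB] := leP (B ^+ 2 * (rho + 1)) (a ^+ 2); first exact: case_far.
have [Krho|rhoK] := leP K rho; first exact: case_near.
exfalso; case: KA => [|Aa]; first by lra.
have : (B * (K + 1)) ^+ 2 <= a ^+ 2 by rewrite ler_sqr ?nnegrE // mulr_ge0 // addr_ge0.
rewrite exprMn.
have : B ^+ 2 * (rho + 1) <= B ^+ 2 * (K + 1) ^+ 2.
  by rewrite ler_wpM2l ?sqr_ge0 //; nra.
by lra.
Qed.

End contraction.

(** * One collision followed by one flight *)

Section geometric_step.
Variables (R : realType) (om : R) (rot : 'cV[R]_3 -> 'M[R]_3).
Hypothesis om0 : 0 < om.
Hypothesis hrot : rotation_choice rot.
Implicit Types (x v eta delta : 'cV[R]_3) (xi : R).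

Definition potential x : R := om * radial x.
Definition relspeed x v : R := enorm (v - rotfield om x).
Definition fly x v xi : 'cV[R]_3 := x + free_time om x v xi *: v.
Definition noise xi : R := om * Num.max xi 0.

Let om_ge0 : 0 <= om. Proof. exact: ltW. Qed.

Lemma potential_ge0 x : 0 <= potential x.
Proof. by rewrite mulr_ge0 ?radial_ge0. Qed.

Lemma relspeed_ge0 x v : 0 <= relspeed x v. Proof. exact: enorm_ge0. Qed.

Lemma noise_ge0 xi : 0 <= noise xi.
Proof. by rewrite mulr_ge0 // le_max lexx orbT. Qed.

Lemma relspeed_flight x v s :
  relspeed (x + s *: v) v ^+ 2 - relspeed x v ^+ 2 =
  potential (x + s *: v) ^+ 2 - potential x ^+ 2.
Proof. by have := flight_energy x v s om_ge0; rewrite /relspeed /potential; lra. Qed.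

Lemma potential_flight x v xi s : 0 <= s <= free_time om x v xi ->
  `|potential (x + s *: v) - potential x| <= noise xi.
Proof.
move=> /andP[s0 st]; rewrite /potential -mulrBr normrM (gtr0_norm om0) ler_wpM2l //.
apply: le_trans (radial_flight om x v s0) _.
by apply: rel_dist_free_time_le => //; rewrite s0.
Qed.

Lemma potential_fly x v xi : `|potential (fly x v xi) - potential x| <= noise xi.
Proof. by apply: potential_flight; rewrite free_time_ge0 lexx. Qed.

Lemma geo_one_step x v eta delta xi : enorm eta < 1 ->
  let v' := collide om rot x v eta delta in
  one_step (potential x) (relspeed x v) (enorm eta) (enorm delta) (noise xi)
    (relspeed x v') (potential (fly x v' xi)) (relspeed (fly x v' xi) v').
Proof.
move=> eta1 v'; split.
- by split; rewrite ?potential_ge0 ?relspeed_ge0.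
- by split; rewrite ?enorm_ge0 ?noise_ge0 // (ltW eta1).
- by apply: enorm_collide => //; exact: ltW.
- exact: relspeed_flight.
- exact: potential_fly.
Qed.

Lemma velocity_le x v : enorm v <= relspeed x v + potential x.
Proof.
rewrite /relspeed /potential -enorm_rotfield //.
by rewrite -{1}(subrK (rotfield om x) v) enormD.
Qed.

Lemma radial_velocity_ge x v : potential x - relspeed x v <= radial v.
Proof.
have rF : radial (rotfield om x) = potential x.
  rewrite /potential -enorm_rotfield //; apply: ge0_sqr_inj; rewrite ?radial_ge0 ?enorm_ge0 //.
  have [_ _ c] := rotfieldE om x.
  by rewrite radial_sqr enorm_sqr c expr0n /= addr0.
rewrite lerBlDr -rF.
have := radialD v (rotfield om x - v); rewrite addrC subrK => h.
apply: (le_trans h); rewrite lerD2l (le_trans (radial_le_enorm _)) //.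
by rewrite /relspeed -enormN opprB.
Qed.

Lemma potential_gt0_nondegenerate x v : 0 < potential x -> ~ degenerate x v.
Proof. by move=> p0 [r0 _]; move: p0; rewrite /potential r0 mulr0 ltxx. Qed.

(* A slow particle far from the axis is dragged outwards by the centrifugal effect. *)
Lemma geo_push : exists K0 be0 c3, [/\ 0 < be0, 0 < c3 <= 1 &
  forall x v xi, 1 <= xi <= 2 -> K0 <= potential x ->
    relspeed x v <= be0 * Num.sqrt (potential x) ->
    c3 <= potential (fly x v xi) - potential x].
Proof.
(* [si0] will bound from below the flight time in units of 1 / sqrt rho; [be] is so small that by
   then the relative speed has reached 3 be sqrt rho. *)
pose si0 := (2 * (1 + 2 * om))^-1.
have d0 : 0 < 2 * (1 + 2 * om) by rewrite mulr_gt0 // addr_gt0 // mulr_gt0.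
have si00 : 0 < si0 by rewrite invr_gt0.
have si0E : si0 * (1 + 2 * om) = 1 / 2.
  by rewrite /si0; field; rewrite gt_eqF // addr_gt0 // mulr_gt0.
have si01 : si0 <= 1.
  by rewrite invf_le1 //; have := om0; lra.
pose be := Num.min (1 / 2) (si0 * om / 8).
have be0 : 0 < be by rewrite lt_min !divr_gt0 // mulr_gt0.
have be12 : be <= 1 / 2 by rewrite ge_min lexx.
have be8 : 8 * be <= si0 * om.
  by rewrite mulrC -ler_pdivlMr // ge_min lexx orbT.
exists (Num.max 1 om), be, (2 * be ^+ 2); split => //.
  rewrite mulr_gt0 ?exprn_gt0 //=.
  have : be ^+ 2 <= (1 / 2) ^+ 2 by rewrite ler_sqr ?nnegrE // ltW.
  by rewrite expr_div_n; lra.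
move=> x v xi /andP[xi1 xi2]; rewrite ge_max => /andP[rho1 rhoom].
set rho := potential x in rho1 rhoom *; set b := relspeed x v; set r := Num.sqrt rho => bbe.
have rho0 : 0 < rho by exact: lt_le_trans rho1.
have r2 : rho = r ^+ 2 by rewrite sqr_sqrtr // ltW.
have r0 : 0 < r by rewrite sqrtr_gt0.
have r1 : 1 <= r by rewrite -sqrtr1 ler_wsqrtr.
have b0 : 0 <= b by exact: relspeed_ge0.
have brr : b <= r / 2 by apply: (le_trans bbe); rewrite mulrC ler_wpM2l ?(ltW r0) //; lra.
have rrho : r <= rho by rewrite r2 expr2 ler_peMr // ltW.
have nd : ~ degenerate x v by exact: potential_gt0_nondegenerate.
have xi0 : 0 <= xi by lra.
set t := free_time om x v xi.
have t0 : 0 <= t by exact: free_time_ge0.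
have tE : rel_dist om x v t = xi by exact: free_timeK.
have up := rel_dist_le x v om_ge0 t0; rewrite tE -/(relspeed x v) -/b in up.
have vle := velocity_le x v; rewrite -/b -/rho in vle.
have vge := radial_velocity_ge x v; rewrite -/b -/rho in vge.
(* As b is at most r / 2 and |v| at most 2 rho, covering a distance of at least 1 forces 1 <= si / 2
   + 2 om si^2, hence [si0 <= si]. *)
pose si := t * r.
have si_ge0 : 0 <= si by rewrite mulr_ge0 // ltW.
have tb : t * b <= si * (1 / 2) by rewrite /si -mulrA ler_wpM2l //; lra.
have tv : t * (t * (om * enorm v)) <= 2 * om * si ^+ 2.
  have -> : 2 * om * si ^+ 2 = t * (t * (om * (2 * rho))) by rewrite /si r2; ring.
  do 3 (rewrite ler_wpM2l //); lra.
have one : 1 <= si * (1 / 2) + 2 * om * si ^+ 2 by move: up; rewrite mulrDr; lra.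
have sige : si0 <= si.
  rewrite leNgt; apply/negP => slt.
  have h1 : si ^+ 2 <= si0 * 1.
    by rewrite expr2; apply: ler_pM => //; lra.
  have h2 : om * si ^+ 2 <= om * si0 by rewrite ler_wpM2l //; lra.
  lra.
(* The rotation of the medium under the particle builds up relative speed at rate om |v|; the
   initial one, at most be r, is subtracted. *)
have a'ge : 3 * be * r <= relspeed (fly x v xi) v.
  have := enorm_relvel_ge x v om_ge0 t0; rewrite -/(relspeed x v) -/b.
  apply: le_trans.
  have h1 : rho / 2 <= radial v by lra.
  have h2 : t * (om * (rho / 2)) <= t * (om * radial v) by rewrite !ler_wpM2l.
  have h3 : si0 * om * r <= si * om * r by rewrite !ler_wpM2r // ltW.
  have h4 : t * (om * (rho / 2)) = si * om * r / 2 by rewrite /si r2; field.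
  have h5 : 8 * be * r <= si0 * om * r by rewrite ler_wpM2r // ltW.
  lra.
have en := relspeed_flight x v t; rewrite -/(fly x v xi) -/b -/rho in en.
set a' := relspeed (fly x v xi) v in a'ge en; set rho' := potential (fly x v xi) in en *.
have a'2 : (3 * be * r) ^+ 2 <= a' ^+ 2.
  by rewrite ler_sqr ?nnegrE ?relspeed_ge0 // !mulr_ge0 // ltW.
have b2 : b ^+ 2 <= (be * r) ^+ 2.
  by rewrite ler_sqr ?nnegrE // mulr_ge0 // ltW.
have rho'0 : 0 <= rho' by exact: potential_ge0.
have key : 8 * be ^+ 2 * rho <= (rho' - rho) * (rho' + rho).
  by move: a'2 b2; rewrite !exprMn -r2; lra.
(* With [om <= rho] this gives rho' + rho <= 4 rho, whence the constant [2 * be ^+ 2]. *)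
have rle : rho' <= rho + 2 * om.
  have := potential_fly x v xi; rewrite -/rho -/rho' /noise (max_idPl xi0) => /ler_normlP[_].
  have : om * xi <= om * 2 by rewrite ler_wpM2l.
  lra.
have s0 : 0 < rho' + rho by rewrite ltr_wpDl.
have be20 : 0 < be ^+ 2 by rewrite exprn_gt0.
have : 2 * be ^+ 2 * (rho' + rho) <= (rho' - rho) * (rho' + rho).
  apply: le_trans key.
  have -> : 8 * be ^+ 2 * rho = 2 * be ^+ 2 * (4 * rho) by ring.
  by apply: ler_wpM2l; [apply: mulr_ge0 => //; exact: ltW|lra].
by rewrite ler_pM2r.
Qed.

Definition far_box N : set 'cV[R]_3 :=
  [set y | [/\ N <= y 0 0 <= N + 1, `|y 1 0| <= 1 & `|y 2 0| <= 1]].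

(* From a bounded region, one strong kick along the first axis followed by a long flight
   brings the particle arbitrarily far. *)
Lemma geo_escape K A e0 M kap : 0 <= K -> 0 <= A -> 0 <= e0 < 1 -> 0 <= M -> 0 <= kap <= 1 ->
  exists N Xi, 0 <= N /\ forall x v eta delta xi,
    potential x <= K -> relspeed x v <= A -> enorm eta <= e0 -> far_box N delta -> Xi <= xi ->
    let v' := collide om rot x v eta delta in
    M <= lyap kap (potential (fly x v' xi)) (relspeed (fly x v' xi) v').
Proof.
move=> K0 A0 /andP[e00 e01] M0 /andP[k0 k1].
have q0 : 0 < 1 - e0 by rewrite subr_gt0.
(* [N] solves N = 1 + K + e0 (A + N + 3): the kick beats the medium (at most K) and the reflected
   velocity (at most e0 (A + N + 3)), leaving a first velocity component of at least 1. *)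
pose N := (1 + K + e0 * (A + 3)) / (1 - e0).
have eA : 0 <= e0 * (A + 3) by rewrite mulr_ge0 // addr_ge0.
have N0 : 0 <= N by rewrite divr_ge0 ?(ltW q0) // !addr_ge0.
have NE : N = 1 + K + e0 * (A + N + 3).
  have : N * (1 - e0) = 1 + K + e0 * (A + 3) by rewrite divfK // gt_eqF.
  by lra.
(* [c] bounds the relative speed after the kick. A flight of duration [t0] brings the potential to
   at least om t0 - K = 2 (M + c), and the third threshold, for [xi], bounds the distance covered in
   that time. *)
pose c := A + 2 * (N + 3).
have c0 : 0 <= c by rewrite addr_ge0 // mulr_ge0 // addr_ge0.
pose t0 := (2 * (M + c) + K) / om.
have t00 : 0 <= t0 by rewrite divr_ge0 // addr_ge0 // mulr_ge0 // addr_ge0.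
exists N, (t0 * (c + t0 * (om * (c + K)))); split => //.
move=> x v eta delta xi xK vA ee0 fb Xxi.
have [/andP[d01 d02] d1 d2] := fb.
set v' := collide _ _ _ _ _ _; rewrite /=.
have eta1 : enorm eta <= 1 by lra.
have dN : enorm delta <= N + 3.
  have := enorm_le_coord delta; rewrite (ger0_norm (le_trans N0 d01)); lra.
have bc := @enorm_collide R om rot x v eta delta hrot eta1; rewrite -/v' -/(relspeed x v') -/(relspeed x v) in bc.
have a0 := relspeed_ge0 x v; have et0 := enorm_ge0 eta; have de0 := enorm_ge0 delta.
have b_c : relspeed x v' <= c.
  have : enorm eta * relspeed x v <= 1 * A by apply: ler_pM.
  rewrite /c; lra.
have v'0 : 1 <= v' 0 0.
  pose w := v - (rotfield om x + delta).
  have v'E : v' = enorm w *: (rot w *m eta) + (rotfield om x + delta) by [].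
  have w1 : enorm (enorm w *: (rot w *m eta)) <= e0 * (A + N + 3).
    have -> : enorm (enorm w *: (rot w *m eta)) = enorm w * enorm eta.
      have [->|w0] := eqVneq w 0; first by rewrite enorm0 scale0r enorm0 mul0r.
      by rewrite enormZ ger0_norm ?enorm_ge0 // enorm_rot //; have [] := hrot.2 _ w0.
    rewrite mulrC; apply: ler_pM => //; first exact: enorm_ge0.
    rewrite /w opprD addrA (le_trans (enormB _ _)) // -/(relspeed x v); lra.
  rewrite v'E [leRHS]mxE [X in _ + X]mxE.
  have h1 := le_coord_enorm (enorm w *: (rot w *m eta)) 0.
  have h2 := le_coord_enorm (rotfield om x) 0; rewrite enorm_rotfield // -/(potential x) in h2.
  have h3 : - enorm (enorm w *: (rot w *m eta)) <= (enorm w *: (rot w *m eta)) 0 0.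
    by move: h1; rewrite ler_norml => /andP[].
  have h4 : - potential x <= rotfield om x 0 0 by move: h2; rewrite ler_norml => /andP[].
  lra.
have rv : 1 <= radial v'.
  apply: ler_of_sqr; first exact: radial_ge0.
  have : 1 <= v' 0 0 ^+ 2 by rewrite exprn_ege1.
  by rewrite radial_sqr; have := sqr_ge0 (v' 1 0); lra.
have nd : ~ degenerate x v'.
  by move=> [_ v0]; move: v'0; rewrite v0 mxE; lra.
set t := free_time om x v' xi.
have t_ge0 : 0 <= t by exact: free_time_ge0.
have vle := velocity_le x v'.
have ev : enorm v' <= c + K by lra.
have up := rel_dist_le x v' om_ge0 t00; rewrite -/(relspeed x v') in up.
have up2 : rel_dist om x v' t0 <= xi.
  apply: (le_trans up); apply: le_trans Xxi; rewrite ler_wpM2l // lerD // ler_wpM2l // ler_wpM2l //.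
have tt0 : t0 <= t.
  rewrite leNgt; apply/negP => tlt.
  have xi0 : 0 <= xi by apply: le_trans up2; exact: rel_dist_ge0.
  by have := rel_dist_lt om0 nd t_ge0 tlt; rewrite free_timeK // ltNge up2.
set rho' := potential (fly x v' xi).
have rho'ge : om * t0 - K <= rho'.
  have : t * radial v' - radial x <= radial (fly x v' xi).
    rewrite lerBlDr -[t]ger0_norm // -radialZ.
    have := radialD (fly x v' xi) (- x); rewrite /fly -/t.
    have -> : x + t *: v' + - x = t *: v' by rewrite addrC addKr.
    by rewrite -(scaleN1r x) (radialZ (-1)) normrN normr1 mul1r.
  move=> /(ler_wpM2l om_ge0); rewrite -/(potential _) -/rho' mulrBr -/(potential x) => h.
  have : t0 * 1 <= t * radial v' by apply: ler_pM.
  move=> /(ler_wpM2l om_ge0); lra.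
have en := relspeed_flight x v' t; rewrite -/(fly x v' xi) -/rho' in en.
set a' := relspeed (fly x v' xi) v' in en *.
have omt : om * t0 = 2 * (M + c) + K by rewrite mulrC divfK // gt_eqF.
have rho'0 : 0 <= rho' by exact: potential_ge0.
(* By conservation the square is at most 2 rho'^2 + c^2, and 2 <= (3/2)^2. This leaves a value of
   [lyap] of at least rho' / 2 - c. *)
have n2 : nrm2 rho' a' <= 3 / 2 * rho' + c.
  apply: ler_of_sqr; first by rewrite addr_ge0 // mulr_ge0 // divr_ge0.
  rewrite nrm2_sqr.
  have b2 : relspeed x v' ^+ 2 <= c ^+ 2 by rewrite ler_sqr ?nnegrE ?relspeed_ge0.
  have := sqr_ge0 (potential x); have : 0 <= rho' * c by rewrite mulr_ge0.
  have := sqr_ge0 rho'; lra.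
have : (1 - kap) * nrm2 rho' a' <= (1 - kap) * (3 / 2 * rho' + c) by rewrite ler_wpM2l // subr_ge0.
have : 0 <= kap * rho' by rewrite mulr_ge0.
have : 0 <= kap * c by rewrite mulr_ge0.
rewrite /lyap; lra.
Qed.

End geometric_step.

(** * Laws of the innovations *)

Section density.
Local Open Scope ereal_scope.
Context d (T : measurableType d) (R : realType).
Variables (mu nu : {measure set T -> \bar R}) (f : T -> R).
Hypothesis mf : measurable_fun setT f.
Hypothesis f0 : forall x, (0 <= f x)%R.
Hypothesis nuE : forall A, measurable A -> nu A = \int[mu]_(x in A) (f x)%:E.

Let mfE : measurable_fun setT (EFin \o f). Proof. exact/measurable_EFinP. Qed.

Import HBNNSimple.

Let density_nnsfun (h : {nnsfun T >-> R}) :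
  \int[nu]_x (h x)%:E = \int[mu]_x ((h x)%:E * (f x)%:E).
Proof.
under eq_integral do rewrite fimfunE -fsumEFin//.
rewrite ge0_integral_fsum//; last 2 first.
- by move=> r; exact/measurable_EFinP/measurableT_comp.
- by move=> r x _; rewrite EFinM nnfun_muleindic_ge0.
under [RHS]eq_integral.
  move=> x _; rewrite fimfunE -fsumEFin// ge0_mule_fsuml; last first.
    by move=> r; rewrite EFinM nnfun_muleindic_ge0.
  over.
rewrite [RHS]ge0_integral_fsum//; last 2 first.
- move=> r; apply: emeasurable_funM => //.
  exact/measurable_EFinP/measurableT_comp.
- move=> r x _; apply: mule_ge0; last by rewrite lee_fin.
  by rewrite EFinM nnfun_muleindic_ge0.
apply: eq_fsbigr => r _.
have [r0|r0] := ltP r 0%R.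
  rewrite (_ : h @^-1` [set r] = set0); last first.
    by apply/seteqP; split => x //= hx; have : (0 <= h x)%R by []; rewrite hx leNgt r0.
  by rewrite !integral0_eq => // x _; rewrite indic0 ?mulr0 ?mul0e.
have mr : measurable (h @^-1` [set r]) by exact: measurable_funPTI.
rewrite (eq_integral (fun x => r%:E * (\1_(h @^-1` [set r]) x)%:E)); last first.
  by move=> x _; rewrite EFinM.
rewrite [RHS](eq_integral (fun x => r%:E * ((f x)%:E * (\1_(h @^-1` [set r]) x)%:E))); last first.
  by move=> x _; rewrite EFinM [X in _ = _ * X]muleC muleA.
rewrite !ge0_integralZl_EFin //; last 3 first.
- by move=> x _; rewrite mule_ge0 ?lee_fin.
- by apply: emeasurable_funM => //; exact/measurable_EFinP.
- exact/measurable_EFinP.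
congr (_ * _); rewrite integral_indic // setIT nuE //.
rewrite [LHS]integral_mkcond; apply: eq_integral => x _.
by rewrite patchE indicE; case: ifPn => _; rewrite ?mule1 ?mule0.
Qed.

(** Change of density on simple functions, extended by monotone convergence. *)
Lemma ge0_integral_density (g : T -> \bar R) : measurable_fun setT g ->
  (forall x, 0 <= g x) -> \int[nu]_x g x = \int[mu]_x (g x * (f x)%:E).
Proof.
move=> mg g0; pose g_ := nnsfun_approx measurableT mg.
have nd n m : (n <= m)%N -> forall x, (g_ n x <= g_ m x)%R.
  by move=> nm; exact/lefP/nd_nnsfun_approx.
have cg x : (g_ n x)%:E @[n --> \oo] --> g x by exact: cvg_nnsfun_approx.
transitivity (limn (fun n => \int[nu]_x (g_ n x)%:E)).
  rewrite -monotone_convergence //.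
  - by apply: eq_integral => x _; apply/esym/cvg_lim => //; exact: cg.
  - by move=> n; exact/measurable_EFinP.
  - by move=> n x _; rewrite lee_fin.
  - by move=> x _ n m nm; rewrite lee_fin; exact: nd.
under eq_fun do rewrite density_nnsfun.
rewrite -monotone_convergence //.
- apply: eq_integral => x _; apply/cvg_lim => //.
  by apply: cvgeZr => //; exact: cg.
- by move=> n; apply: emeasurable_funM => //; exact/measurable_EFinP.
- by move=> n x _; rewrite mule_ge0 ?lee_fin.
- by move=> x _ n m nm; rewrite lee_wpmul2r ?lee_fin //; exact: nd.
Qed.

End density.

Section iid_innovations.
Local Open Scope ereal_scope.
Context d (T : measurableType d) (R : realType) (P : probability T R).

Lemma independent_seq_head d' (T' : measurableType d') (X : nat -> {RV P >-> T'})
    (B : set T') (A : nat -> set T') k n :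
  independent_seq X -> measurable B -> (forall j, measurable (A j)) ->
  P (X k @^-1` B `&` \big[setI/setT]_(k.+1 <= j < n) (X j @^-1` A j)) =
  P (X k @^-1` B) * P (\big[setI/setT]_(k.+1 <= j < n) (X j @^-1` A j)).
Proof.
move=> iX mB mA.
pose A' j := if j == k then B else A j.
have mA' j : measurable (A' j) by rewrite /A'; case: ifP.
have kn : k \notin index_iota k.+1 n by rewrite mem_index_iota ltnn.
have E : \big[setI/setT]_(k.+1 <= j < n) (X j @^-1` A j) =
    \big[setI/setT]_(k.+1 <= j < n) (X j @^-1` A' j).
  by apply: eq_big_nat => j /andP[kj _]; rewrite /A' gtn_eqF.
rewrite E; have := iX (k :: index_iota k.+1 n) A'.
rewrite bigcap_seq !big_cons /= kn iota_uniq (_ : A' k = B); last by rewrite /A' eqxx.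
move=> -> //; congr (_ * _).
by rewrite -bigcap_seq iX ?iota_uniq.
Qed.

Lemma sigma_seq_head d' (T' : measurableType d') (X : nat -> {RV P >-> T'})
    (B : set T') (A : nat -> set T') k n :
  measurable B -> (forall j, measurable (A j)) ->
  sigma_seq X (X k @^-1` B `&` \big[setI/setT]_(k.+1 <= j < n) (X j @^-1` A j)).
Proof.
move=> mB mA.
pose G := \bigcup_k preimage_set_system setT (X k) measurable.
have sg j (D : set T') : measurable D -> measurable (X j @^-1` D : set (g_sigma_algebraType G)).
  by move=> mD; apply: sub_gen_smallest; exists j => //; exists D => //; rewrite setTI.
suff : measurable (X k @^-1` B `&` \big[setI/setT]_(k.+1 <= j < n) (X j @^-1` A j)
  : set (g_sigma_algebraType G)) by [].
by apply: measurableI; [exact: sg|apply: bigsetI_measurable => j _; exact: sg].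
Qed.

Context d1 d2 d3 (Z1 : measurableType d1) (Z2 : measurableType d2) (Z3 : measurableType d3).
Variables (X : nat -> {RV P >-> Z1}) (Y : nat -> {RV P >-> Z2}) (Z : nat -> {RV P >-> Z3}).

(** The constraints are regrouped by sequence: [independent3] separates the three groups, and inside
    each group the constraint of index [k] splits off from the later ones. *)
Lemma iid_indep_innov : independent_seq X -> independent_seq Y -> independent_seq Z ->
  independent3 P (sigma_seq X) (sigma_seq Y) (sigma_seq Z) -> indep_innov P X Y Z.
Proof.
move=> iX iY iZ iXYZ A B C k n ABC D1 D2 D3 mD1 mD2 mD3.
have mA j : measurable (A j) by have [] := ABC j.
have mB j : measurable (B j) by have [] := ABC j.
have mC j : measurable (C j) by have [] := ABC j.
have cylE : cyl X Y Z A B C k.+1 n = \big[setI/setT]_(k.+1 <= j < n) (X j @^-1` A j) `&`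
    (\big[setI/setT]_(k.+1 <= j < n) (Y j @^-1` B j) `&`
     \big[setI/setT]_(k.+1 <= j < n) (Z j @^-1` C j)).
  by rewrite /cyl !big_split.
set a := \big[_/_]_(_ <= j < _) (X j @^-1` _) in cylE.
set b := \big[_/_]_(_ <= j < _) (Y j @^-1` _) in cylE.
set c := \big[_/_]_(_ <= j < _) (Z j @^-1` _) in cylE.
have key E1 E2 E3 : measurable E1 -> measurable E2 -> measurable E3 ->
    P (X k @^-1` E1 `&` a `&` (Y k @^-1` E2 `&` b) `&` (Z k @^-1` E3 `&` c)) =
    P (X k @^-1` E1) * P a * (P (Y k @^-1` E2) * P b) * (P (Z k @^-1` E3) * P c).
  move=> mE1 mE2 mE3; rewrite (iXYZ _ _ _ (sigma_seq_head _ _ mE1 mA)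
    (sigma_seq_head _ _ mE2 mB) (sigma_seq_head _ _ mE3 mC)).
  by rewrite !independent_seq_head.
have abc : P (cyl X Y Z A B C k.+1 n) = P a * P b * P c.
  have := key setT setT setT measurableT measurableT measurableT.
  by rewrite !preimage_setT !setTI !probability_setT !mul1e cylE setIA.
rewrite abc cylE.
have -> : X k @^-1` D1 `&` (Y k @^-1` D2 `&` (Z k @^-1` D3 `&` (a `&` (b `&` c)))) =
  X k @^-1` D1 `&` a `&` (Y k @^-1` D2 `&` b) `&` (Z k @^-1` D3 `&` c).
  by apply/seteqP; split => w /=; tauto.
rewrite key //.
by rewrite [X in X * _ = _]muleACA [LHS]muleACA.
Qed.

End iid_innovations.

Section laws.
Context d (T : measurableType d) (R : realType) (P : probability T R).
Notation leb := (@lebesgue_measure R).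

Lemma ge0_integral_law (X : T -> R) (f : R -> R) :
  measurable_fun setT X -> measurable_fun setT f -> (forall x, 0 <= f x) ->
  (forall A : set R, measurable A -> P (X @^-1` A) = \int[leb]_(x in A) (f x)%:E)%E ->
  forall g : R -> R, measurable_fun setT g -> (forall x, 0 <= g x) ->
  (\int[P]_w (g (X w))%:E = \int[leb]_x ((g x)%:E * (f x)%:E))%E.
Proof.
move=> mX mf f0 PX g mg g0.
have mX' : measurable_fun setT (X : T -> measurableTypeR R) by exact: mX.
pose Y : {mfun T >-> measurableTypeR R} :=
  @mfun_Sub _ _ T (measurableTypeR R) X (mem_set mX').
have mg' : measurable_fun setT (fun x : measurableTypeR R => (g x)%:E).
  by apply/measurable_EFinP; exact: mg.
have E := @ge0_integral_pushforward _ _ T (measurableTypeR R) R Y mX' P setT (fun x => (g x)%:E) measurableT mg'.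
transitivity (\int[pushforward P Y]_x (g x)%:E)%E.
  by rewrite E ?preimage_setT // => x _; rewrite lee_fin.
exact: (@ge0_integral_density _ (measurableTypeR R)).
Qed.


(** Tilting by expR (c x) turns the density of rate la into la / (la - c) times the density of rate
    la - c. *)
Lemma exponential_moment (X : {RV P >-> R}) (la c : R) : 0 < la -> c < la ->
  has_law X (exponential_prob la) ->
  (\int[P]_w (expR (c * X w))%:E = (la / (la - c))%:E)%E.
Proof.
move=> la0 cla lawX.
have mf := measurable_exponential_pdf la.
have mg : measurable_fun setT (fun x : R => expR (c * x)).
  apply: (measurableT_comp (@measurable_expR R)).
  by apply: measurable_funM.
have lc0 : 0 < la - c by rewrite subr_gt0.
rewrite (ge0_integral_law (X := X) (f := exponential_pdf la) _ mf _ _ mg) //.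
- rewrite (eq_integral (fun x : measurableTypeR R => (la / (la - c))%:E * (exponential_pdf (la - c) x)%:E)%E).
    rewrite ge0_integralZl_EFin //.
    + by rewrite integral_exponential_pdf // mule1.
    + by move=> x _; rewrite lee_fin exponential_pdf_ge0 // ltW.
    + by apply/measurable_EFinP; exact: measurable_exponential_pdf.
    + by rewrite divr_ge0 // ltW.
  move=> x _; rewrite -!EFinM; congr EFin.
  have [x0|x0] := ltP x 0; first by rewrite !lt0_exponential_pdf // !mulr0.
  rewrite !exponential_pdfE // mulrCA -expRD.
  have -> : c * x + - la * x = - (la - c) * x by ring.
  by field; rewrite gt_eqF.
- by move=> x; rewrite exponential_pdf_ge0 // ltW.
Qed.

Lemma gaussian3_coord (X : {RV P >-> borel 'cV[R]_3}) (s : R) :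
  has_law X (gaussian3 s) ->
  forall A0 A1 A2 : set R, measurable A0 -> measurable A1 -> measurable A2 ->
  (P [set w | [/\ A0 ((X w : 'cV[R]_3) 0%R 0%R), A1 ((X w : 'cV[R]_3) 1%R 0%R) &
    A2 ((X w : 'cV[R]_3) 2%R 0%R)]] =
  normal_prob 0 s A0 * normal_prob 0 s A1 * normal_prob 0 s A2)%E.
Proof.
move=> lawX A0 A1 A2 mA0 mA1 mA2.
pose B : set (borel 'cV[R]_3) := [set y : 'cV[R]_3 | [/\ A0 (y 0 0), A1 (y 1 0) & A2 (y 2 0)]].
have mB : measurable B.
  rewrite (_ : B = (fun y : borel 'cV[R]_3 => (y : 'cV[R]_3) 0 0) @^-1` A0 `&`
    ((fun y : borel 'cV[R]_3 => (y : 'cV[R]_3) 1 0) @^-1` A1 `&`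
     (fun y : borel 'cV[R]_3 => (y : 'cV[R]_3) 2 0) @^-1` A2)).
    by do 2?apply: measurableI; apply: measurable_preimage => //; exact: measurable_coord.
  by apply/seteqP; split => y /= []; [split | move=> ? []; split].
transitivity (distribution P X B); first by [].
rewrite lawX // /gaussian3.
rewrite (_ : [set p | _] = (A0 `*` A1) `*` A2); last first.
  apply/seteqP; split => -[[p0 p1] p2] /=; rewrite /B /=; have [-> -> ->] := vec3E p0 p1 p2.
    by case.
  by case=> -[].
rewrite product_measure1E //; last exact: measurableX.
by congr (_ * _)%E; exact: product_measure1E.
Qed.

Lemma gaussian3_coord_law (X : {RV P >-> borel 'cV[R]_3}) (s : R) i (A : set R) :
  has_law X (gaussian3 s) -> measurable A ->
  P ((fun w => (X w : 'cV[R]_3) i 0) @^-1` A) = normal_prob 0 s A.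
Proof.
move=> lawX mA; have H := gaussian3_coord lawX.
have n1 : normal_prob 0 s setT = 1%E by exact: probability_setT.
move: i; apply: ord3P.
- have := H A setT setT mA measurableT measurableT; rewrite n1 !mule1 => <-.
  by congr (P _); apply/seteqP; split => w //= -[].
- have := H setT A setT measurableT mA measurableT; rewrite n1 mul1e mule1 => <-.
  by congr (P _); apply/seteqP; split => w //= -[].
- have := H setT setT A measurableT measurableT mA; rewrite n1 !mul1e => <-.
  by congr (P _); apply/seteqP; split => w //= -[].
Qed.

(** Completing the square: the tilted density is a multiple of the normal density of mean c s^2. *)
Lemma gaussian_moment (X : {RV P >-> R}) (s c : R) : 0 < s ->
  has_law X (normal_prob 0 s) ->
  (\int[P]_w (expR (c * X w))%:E = (expR (c ^+ 2 * s ^+ 2 / 2))%:E)%E.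
Proof.
move=> s0 lawX; have sn0 : s != 0 by rewrite gt_eqF.
have mf := measurable_normal_pdf (0 : R) s.
have mg : measurable_fun setT (fun x : R => expR (c * x)).
  apply: (measurableT_comp (@measurable_expR R)).
  by apply: measurable_funM.
rewrite (ge0_integral_law (X := X) (f := normal_pdf 0 s) _ mf _ _ mg) //.
- rewrite (eq_integral (fun x : measurableTypeR R => (expR (c ^+ 2 * s ^+ 2 / 2))%:E * (normal_pdf (c * s ^+ 2) s x)%:E)%E).
    rewrite ge0_integralZl_EFin //.
    + by rewrite integral_normal_pdf mule1.
    + by move=> x _; rewrite lee_fin normal_pdf_ge0.
    + by apply/measurable_EFinP; exact: measurable_normal_pdf.
  move=> x _; rewrite -!EFinM; congr EFin.
  rewrite !normal_pdfE // mulrCA [RHS]mulrCA /normal_fun; congr (_ * _).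
  rewrite -!expRD; by congr expR; field.
- by move=> x; exact: normal_pdf_ge0.
Qed.

Lemma integral_itv_pos (f : R -> R) (a b m : R) : a < b -> 0 < m ->
  measurable_fun setT f -> (forall x, a <= x <= b -> m <= f x) ->
  (0 < \int[leb]_(x in `[a, b]) (f x)%:E)%E.
Proof.
move=> ab m0 mf mle.
apply: (@lt_le_trans _ _ (\int[leb]_(x in `[a, b]) m%:E)%E).
  rewrite integral_cst //= lebesgue_measure_itv /= lte_fin ab -EFinB -EFinM lte_fin.
  by rewrite mulr_gt0 // subr_gt0.
apply: ge0_le_integral => //.
- by move=> x _; rewrite lee_fin ltW.
- by apply/measurable_EFinP; exact: measurable_funTS.
Qed.

Lemma normal_prob_itv_gt0 (s a b : R) : 0 < s -> a < b -> (0 < normal_prob 0 s `[a, b])%E.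
Proof.
move=> s0 ab; have sn0 : s != 0 by rewrite gt_eqF.
pose M := `|a| + `|b|.
apply: (@integral_itv_pos _ _ _ (normal_peak s * expR (- M ^+ 2 / (s ^+ 2 *+ 2)))) => //.
- by rewrite mulr_gt0 ?expR_gt0 // normal_peak_gt0.
- exact: measurable_normal_pdf.
move=> x /andP[ax xb]; rewrite normal_pdfE // ler_wpM2l ?normal_peak_ge0 //.
rewrite ler_expR subr0 ler_wpM2r ?invr_ge0 ?mulrn_wge0 ?sqr_ge0 // lerN2.
rewrite -(real_normK (num_real x)) ler_sqr ?nnegrE ?addr_ge0 // ler_norml.
have := ler_norm b; have := normr_ge0 a; have := normr_ge0 b; have := ler_norm (- a); rewrite normrN /M.
by move=> *; apply/andP; split; lra.
Qed.

Lemma exponential_prob_itv_gt0 (la a b : R) : 0 < la -> 0 <= a -> a < b ->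
  (0 < exponential_prob la `[a, b])%E.
Proof.
move=> la0 a0 ab.
apply: (@integral_itv_pos _ _ _ (la * expR (- la * b))) => //.
- by rewrite mulr_gt0 // expR_gt0.
- exact: measurable_exponential_pdf.
move=> x /andP[ax xb]; rewrite exponential_pdfE ?(le_trans a0) // ler_wpM2l ?(ltW la0) //.
by rewrite ler_expR !mulNr lerN2 ler_wpM2l // ltW.
Qed.

(** The events on which the norm is at most 1 - 1/(n+1) exhaust the space, so they cannot all be
    null. *)
Lemma contraction_prob (X : {RV P >-> borel 'cV[R]_3}) :
  (forall w, enorm (X w : 'cV[R]_3) < 1) ->
  exists2 e0 : R, 0 <= e0 < 1 & (0 < P [set w | (enorm (X w : 'cV[R]_3) <= e0)%R])%E.
Proof.
move=> X1.
pose F n := [set w | enorm (X w : 'cV[R]_3) <= 1 - n.+1%:R^-1].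
have mF n : measurable (F n).
  rewrite (_ : F n = (fun w => enorm (X w : 'cV[R]_3)) @^-1` `]-oo, 1 - n.+1%:R^-1]).
    by apply: measurable_preimage => //; apply: measurable_fun_enorm.
  by apply/seteqP; split => w /=; rewrite in_itv.
apply: contrapT => H.
have F0 n : P (F n) = 0%E.
  apply/eqP; rewrite eq_le measure_ge0 andbT leNgt; apply/negP => Fn.
  apply: H; exists (1 - n.+1%:R^-1) => //.
  by rewrite subr_ge0 invf_le1 ?ler1n //= ltrBlDr ltrDl invr_gt0.
have FT : \bigcup_n F n = setT.
  apply/seteqP; split => // w _.
  have h : 0 < 1 - enorm (X w : 'cV[R]_3) by rewrite subr_gt0.
  have [n hn] := ltr_add_invr h; exists n => //; rewrite /F /= lerBrDr addrC -lerBrDr; rewrite add0r in hn; exact: ltW.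
have : P setT = 0%E.
  apply: measure_negligible => //; rewrite -FT; apply: negligible_bigcup => k.
  by exists (F k); split => //; exact: F0.
by rewrite probability_setT => /eqP; rewrite onee_eq0.
Qed.

End laws.

(** * Expectation bounds and exponential moments of the noise *)

Section expectation_bounds.
Context d (T : measurableType d) (R : realType) (P : probability T R).

Lemma le_expectation (f g : T -> R) : measurable_fun setT f -> measurable_fun setT g ->
  (forall w, 0 <= f w) -> (forall w, f w <= g w) ->
  (\int[P]_w (f w)%:E <= \int[P]_w (g w)%:E)%E.
Proof.
move=> mf mg f0 fg; apply: ge0_le_integral => //.
- by move=> w _; rewrite lee_fin.
- exact/measurable_EFinP.
- exact/measurable_EFinP.
- by move=> w _; rewrite lee_fin.
Qed.

Lemma expectationD_le (f g : T -> R) (a b : R) : measurable_fun setT f -> measurable_fun setT g ->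
  (forall w, 0 <= f w) -> (forall w, 0 <= g w) ->
  (\int[P]_w (f w)%:E <= a%:E)%E -> (\int[P]_w (g w)%:E <= b%:E)%E ->
  (\int[P]_w (f w + g w)%:E <= (a + b)%:E)%E.
Proof.
move=> mf mg f0 g0 fa gb; under eq_integral do rewrite EFinD.
rewrite ge0_integralD //; first by rewrite EFinD leeD.
- by move=> w _; rewrite lee_fin.
- exact/measurable_EFinP.
- by move=> w _; rewrite lee_fin.
- exact/measurable_EFinP.
Qed.

Lemma expectationZ_le (f : T -> R) (c a : R) : measurable_fun setT f -> 0 <= c ->
  (forall w, 0 <= f w) -> (\int[P]_w (f w)%:E <= a%:E)%E ->
  (\int[P]_w (c * f w)%:E <= (c * a)%:E)%E.
Proof.
move=> mf c0 f0 fa; under eq_integral do rewrite EFinM.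
rewrite ge0_integralZl_EFin //; first by rewrite EFinM lee_wpmul2l.
- by move=> w _; rewrite lee_fin.
- exact/measurable_EFinP.
Qed.

Lemma integral_prob_cst (c : R) : (\int[P]_w c%:E = c%:E)%E.
Proof. by rewrite integral_cst //= probability_setT mule1. Qed.

(** Rewritten with the indicator of the complement, the bound has nonnegative terms only, so
    integrals of nonnegative functions suffice. *)
Lemma expectation_affine_le (Y Q : T -> R) (G : set T) (c0 c1 c2 p B : R) :
  measurable_fun setT Y -> measurable_fun setT Q -> measurable G ->
  (forall w, 0 <= Y w) -> (forall w, 0 <= Q w) -> 0 <= c1 <= c0 -> 0 <= c2 ->
  (p%:E <= P G)%E -> (\int[P]_w (Q w)%:E <= B%:E)%E ->
  (forall w, Y w <= c0 - c1 * \1_G w + c2 * Q w) ->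
  (\int[P]_w (Y w)%:E <= (c0 - c1 * p + c2 * B)%:E)%E.
Proof.
move=> mY mQ mG Y0 Q0 /andP[c10 c1c0] c20 pG QB YH.
have mI : measurable_fun setT (\1_(~` G) : T -> R).
  by apply: measurable_indic; exact: measurableC.
have IG w : \1_(~` G) w = 1 - \1_G w :> R.
  rewrite !indicE in_setC; case: (w \in G) => /=; lra.
have I0 w : 0 <= \1_(~` G) w :> R by rewrite indicE.
have PI : (\int[P]_w (\1_(~` G) w)%:E <= (1 - p)%:E)%E.
  rewrite integral_indic // ?setIT; last exact: measurableC.
  apply: (@le_trans _ _ (1 - P G)%E).
    by rewrite le_eqVlt; apply/orP; left; apply/eqP; exact: probability_setC.
  have := probability_le1 P mG; have := measure_ge0 P G; move: pG.
  by case: (P G) => //= r; rewrite !lee_fin => *; lra.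
apply: (@le_trans _ _ (\int[P]_w ((c0 - c1 + c1 * \1_(~` G) w) + c2 * Q w)%:E)%E).
  apply: le_expectation => //.
    by apply: measurable_funD; [apply: measurable_funD => //|]; apply: measurable_funM.
  by move=> w; rewrite (le_trans (YH w)) // IG; lra.
have -> : c0 - c1 * p + c2 * B = (c0 - c1 + c1 * (1 - p)) + c2 * B by ring.
have m1 : measurable_fun setT (fun w => c1 * \1_(~` G) w) by apply: measurable_funM.
have z1 w : 0 <= c1 * \1_(~` G) w by apply: mulr_ge0.
have z0 : 0 <= c0 - c1 by rewrite subr_ge0.
apply: expectationD_le => //.
- exact: measurable_funD.
- exact: measurable_funM.
- by move=> w; exact: addr_ge0.
- by move=> w; exact: mulr_ge0.
- apply: expectationD_le => //; first by rewrite integral_prob_cst.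
  exact: expectationZ_le.
- exact: expectationZ_le.
Qed.

End expectation_bounds.

Section noise_moments.
Context d (T : measurableType d) (R : realType) (P : probability T R).

Lemma measurable_fun_expRM (f : T -> R) (c : R) : measurable_fun setT f ->
  measurable_fun setT (fun w => expR (c * f w)).
Proof.
by move=> mf; apply: (measurableT_comp (@measurable_expR R)); exact: measurable_funM.
Qed.

Lemma pos_part_moment (X : {RV P >-> R}) (la c : R) : 0 < la -> 0 <= c < la ->
  has_law X (exponential_prob la) ->
  (\int[P]_w (expR (c * Num.max (X w) 0))%:E <= (1 + la / (la - c))%:E)%E.
Proof.
move=> la0 /andP[c0 cla] lawX.
have mX : measurable_fun setT X by [].
have mM : measurable_fun setT (fun w => Num.max (X w) 0) by exact: measurable_maxr.
apply: (@le_trans _ _ (\int[P]_w (1 + expR (c * X w))%:E)%E).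
  apply: le_expectation.
  - exact: measurable_fun_expRM.
  - by apply: measurable_funD => //; exact: measurable_fun_expRM.
  - by move=> w; exact: expR_ge0.
  - move=> w; have [X0|X0] := leP (X w) 0; last by rewrite lerDr.
    by rewrite mulr0 expR0 lerDl expR_ge0.
apply: expectationD_le => //.
- exact: measurable_fun_expRM.
- by rewrite integral_prob_cst.
- by rewrite (exponential_moment la0 cla lawX).
Qed.

Lemma abs_gaussian_moment (X : {RV P >-> R}) (s c : R) : 0 < s -> 0 <= c ->
  has_law X (normal_prob 0 s) ->
  (\int[P]_w (expR (c * `|X w|))%:E <= (2 * expR (c ^+ 2 * s ^+ 2 / 2))%:E)%E.
Proof.
move=> s0 c0 lawX.
have mX : measurable_fun setT X by [].
apply: (@le_trans _ _ (\int[P]_w (expR (c * X w) + expR (- c * X w))%:E)%E).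
  apply: le_expectation.
  - by apply: measurable_fun_expRM; exact: measurableT_comp.
  - by apply: measurable_funD; exact: measurable_fun_expRM.
  - by move=> w; exact: expR_ge0.
  - move=> w; have [X0|X0] := ger0P (X w); first by rewrite lerDl expR_ge0.
    by rewrite mulrN -mulNr lerDr expR_ge0.
have -> : 2 * expR (c ^+ 2 * s ^+ 2 / 2) = expR (c ^+ 2 * s ^+ 2 / 2) + expR ((- c) ^+ 2 * s ^+ 2 / 2).
  by rewrite sqrrN mulr_natl mulr2n.
apply: expectationD_le; try exact: measurable_fun_expRM; try by move=> w; exact: expR_ge0.
- by rewrite (gaussian_moment c s0 lawX).
- by rewrite (gaussian_moment (- c) s0 lawX).
Qed.

(** Separates the coordinates without appeal to their independence, at the price of tripling the
    exponents. *)
Lemma expR_sum3_le (x y z : R) : expR (x + y + z) <= expR (3 * x) + expR (3 * y) + expR (3 * z).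
Proof.
pose m := Num.max x (Num.max y z).
have [h1 [h2 h3]] : x <= m /\ y <= m /\ z <= m by rewrite /m !le_max !lexx !orbT.
apply: (@le_trans _ _ (expR (3 * m))); first by rewrite ler_expR; lra.
have := expR_ge0 (3 * x); have := expR_ge0 (3 * y); have := expR_ge0 (3 * z).
have [->|[->|->]] : m = x \/ m = y \/ m = z by rewrite /m; case: (leP y z) => _; case: leP => _; auto.
all: by move=> *; lra.
Qed.

Lemma enorm_gaussian_moment (X : {RV P >-> borel 'cV[R]_3}) (s c : R) : 0 < s -> 0 <= c ->
  has_law X (gaussian3 s) ->
  (\int[P]_w (expR (c * enorm (X w : 'cV[R]_3)))%:E <=
     (6 * expR ((3 * c) ^+ 2 * s ^+ 2 / 2))%:E)%E.
Proof.
move=> s0 c0 lawX.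
have mX : measurable_fun setT X by [].
have mXi i : measurable_fun setT (fun w => (X w : 'cV[R]_3) i 0) by exact: measurable_fun_coord.
pose F i w := expR (3 * c * `|(X w : 'cV[R]_3) i 0|).
have mF i : measurable_fun setT (F i).
  by apply: measurable_fun_expRM; exact: measurableT_comp.
have F0 i w : 0 <= F i w by exact: expR_ge0.
have EF i : (\int[P]_w (F i w)%:E <= (2 * expR ((3 * c) ^+ 2 * s ^+ 2 / 2))%:E)%E.
  pose Xi : {RV P >-> R} := mfun_Sub (mem_set (mXi i)).
  have lawXi : has_law Xi (normal_prob 0 s).
    by move=> A mA; rewrite -(gaussian3_coord_law i lawX mA).
  by apply: (abs_gaussian_moment s0 _ lawXi); rewrite mulr_ge0.
apply: (@le_trans _ _ (\int[P]_w (F 0 w + F 1 w + F 2 w)%:E)%E).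
  apply: le_expectation.
  - by apply: measurable_fun_expRM; exact: measurable_fun_enorm.
  - by do 2?apply: measurable_funD.
  - by move=> w; exact: expR_ge0.
  - move=> w; rewrite /F -!mulrA; apply: le_trans (expR_sum3_le _ _ _).
    by rewrite ler_expR -!mulrDr ler_wpM2l // enorm_le_coord.
set b := expR _ in EF *; have -> : 6 * b = 2 * b + 2 * b + 2 * b by ring.
apply: expectationD_le => //; last by apply: expectationD_le.
- exact: measurable_funD.
- by move=> w; exact: addr_ge0.
Qed.

End noise_moments.

Section noise_probabilities.
Context d (T : measurableType d) (R : realType) (P : probability T R).

Lemma gaussian3_box_gt0 (X : {RV P >-> borel 'cV[R]_3}) (s a0 b0 a1 b1 a2 b2 : R) (B : set T) :
  0 < s -> has_law X (gaussian3 s) -> a0 < b0 -> a1 < b1 -> a2 < b2 -> measurable B ->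
  (forall w, a0 <= (X w : 'cV[R]_3) 0 0 <= b0 -> a1 <= (X w : 'cV[R]_3) 1 0 <= b1 ->
    a2 <= (X w : 'cV[R]_3) 2 0 <= b2 -> B w) ->
  (0 < P B)%E.
Proof.
move=> s0 lawX ab0 ab1 ab2 mB HB.
pose I (a b : R) : set R := `[a, b]%classic.
have mXi i : measurable_fun setT (fun w => (X w : 'cV[R]_3) i 0) by exact: measurable_fun_coord.
have mI a b : measurable (I a b) by exact: measurable_itv.
have H := gaussian3_coord lawX (mI a0 b0) (mI a1 b1) (mI a2 b2).
apply: lt_le_trans (le_measure P _ _ _); last first.
- move=> w; apply: (_ : [set w | [/\ I a0 b0 ((X w : 'cV[R]_3) 0 0),
    I a1 b1 ((X w : 'cV[R]_3) 1 0) & I a2 b2 ((X w : 'cV[R]_3) 2 0)]] w -> B w).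
  by move=> [/=]; rewrite /I /= !in_itv /=; exact: HB.
- by rewrite inE.
- rewrite inE (_ : [set w | _] = (fun w => (X w : 'cV[R]_3) 0 0) @^-1` I a0 b0 `&`
    ((fun w => (X w : 'cV[R]_3) 1 0) @^-1` I a1 b1 `&`
     (fun w => (X w : 'cV[R]_3) 2 0) @^-1` I a2 b2)).
    by do 2?apply: measurableI; apply: measurable_preimage.
  by apply/seteqP; split => w /= []; [split | move=> ? []; split].
- suff : (0 < normal_prob 0 s (I a0 b0) * normal_prob 0 s (I a1 b1) * normal_prob 0 s (I a2 b2))%E.
    by rewrite -H.
  by rewrite !mule_gt0 // normal_prob_itv_gt0.
Qed.

Lemma exponential_ge_gt0 (X : {RV P >-> R}) (la a b : R) (B : set T) :
  0 < la -> has_law X (exponential_prob la) -> 0 <= a -> a < b -> measurable B ->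
  (forall w, a <= X w <= b -> B w) -> (0 < P B)%E.
Proof.
move=> la0 lawX a0 ab mB HB.
have H := lawX `[a, b]%classic (measurable_itv _).
have mX : measurable_fun setT X by [].
apply: lt_le_trans (le_measure P _ _ _); last first.
- by move=> w; apply: (_ : (X @^-1` `[a, b]) w -> B w) => /=; rewrite in_itv /=; exact: HB.
- by rewrite inE.
- by rewrite inE; apply: measurable_preimage => //; exact: measurable_itv.
- by move: (exponential_prob_itv_gt0 la0 a0 ab); rewrite -H.
Qed.

End noise_probabilities.

Section innovations.
Context d (T : measurableType d) (R : realType) (P : probability T R).

Record collision_noise (lambda sigma : R) (eta delta : nat -> {RV P >-> borel 'cV[R]_3})
    (xi : nat -> {RV P >-> R}) : Prop := CollisionNoise {
  noise_lambda_gt0 : 0 < lambda;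
  noise_sigma_gt0 : 0 < sigma;
  noise_eta_iid : iid eta;
  noise_delta_iid : iid delta;
  noise_xi_iid : iid xi;
  noise_indep : independent3 P (sigma_seq eta) (sigma_seq delta) (sigma_seq xi);
  noise_eta_ball : forall k w, enorm (eta k w : 'cV[R]_3) < 1;
  noise_delta_law : forall k, has_law (delta k) (gaussian3 sigma);
  noise_xi_law : forall k, has_law (xi k) (exponential_prob lambda) }.

Variables (lambda sigma om : R).
Variables (eta delta : nat -> {RV P >-> borel 'cV[R]_3}) (xi : nat -> {RV P >-> R}).
Hypothesis om_gt0 : 0 < om.
Hypothesis noisy : collision_noise lambda sigma eta delta xi.
Let lambda_gt0 := noise_lambda_gt0 noisy.
Let sigma_gt0 := noise_sigma_gt0 noisy.
Let eta_iid := noise_eta_iid noisy.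
Let delta_iid := noise_delta_iid noisy.
Let xi_iid := noise_xi_iid noisy.
Let indep := noise_indep noisy.
Let eta_ball := noise_eta_ball noisy.
Let delta_law := noise_delta_law noisy.
Let xi_law := noise_xi_law noisy.

Lemma walk_innov : indep_innov P eta delta xi.
Proof. by apply: iid_indep_innov => //; [case: eta_iid|case: delta_iid|case: xi_iid]. Qed.

Definition innov_event k (A B : set (borel 'cV[R]_3)) (C : set R) : set T :=
  eta k @^-1` A `&` (delta k @^-1` B `&` xi k @^-1` C).

Lemma measurable_innov_event k A B C : measurable A -> measurable B -> measurable C ->
  measurable (innov_event k A B C).
Proof. by move=> mA mB mC; do 2?apply: measurableI; apply: measurable_preimage. Qed.

Lemma innov_eventE k A B C : measurable A -> measurable B -> measurable C ->
  (P (innov_event k A B C) =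
   P (eta 0%N @^-1` A) * P (delta 0%N @^-1` B) * P (xi 0%N @^-1` C))%E.
Proof.
move=> mA mB mC.
have ABC : mseq (fun=> A) (fun=> B) (fun=> C) by [].
have := @walk_innov _ _ _ k k.+1 ABC _ _ _ mA mB mC.
rewrite /cyl big_geq // setIT probability_setT mule1 /innov_event => ->.
by congr (_ * _ * _)%E; [case: eta_iid|case: delta_iid|case: xi_iid] => _ h; exact: h.
Qed.

Lemma innov_event_lb A B C : measurable A -> measurable B -> measurable C ->
  (0 < P (eta 0%N @^-1` A))%E -> (0 < P (delta 0%N @^-1` B))%E -> (0 < P (xi 0%N @^-1` C))%E ->
  exists2 p : R, 0 < p <= 1 & forall k, (p%:E <= P (innov_event k A B C))%E.
Proof.
move=> mA mB mC pA pB pC.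
exists (fine (P (innov_event 0 A B C))).
  have f := fin_num_measure P (innov_event 0 A B C) (measurable_innov_event 0 mA mB mC).
  rewrite -lee_fin -lte_fin fineK // probability_le1; last exact: measurable_innov_event.
  by rewrite andbT innov_eventE // !mule_gt0.
move=> k; rewrite fineK; last exact: fin_num_measure (measurable_innov_event 0 mA mB mC).
by rewrite !innov_eventE.
Qed.

Let menorm : measurable_fun setT (fun y : borel 'cV[R]_3 => enorm (y : 'cV[R]_3)).
Proof. exact: measurable_fun_enorm. Qed.

Definition eta_le e0 : set (borel 'cV[R]_3) := [set y | enorm (y : 'cV[R]_3) <= e0].

Lemma measurable_eta_le e0 : measurable (eta_le e0).
Proof.
rewrite (_ : eta_le e0 = (fun y : borel 'cV[R]_3 => enorm (y : 'cV[R]_3)) @^-1` `]-oo, e0]).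
  by apply: measurable_preimage => //; exact: measurable_itv.
by apply/seteqP; split => w /=; rewrite in_itv.
Qed.

Lemma measurable_far_box N : measurable (far_box N : set (borel 'cV[R]_3)).
Proof.
pose I (i : 'I_3) (a b : R) := (fun y : borel 'cV[R]_3 => (y : 'cV[R]_3) i 0) @^-1` `[a, b].
have mI i a b : measurable (I i a b).
  by apply: measurable_preimage; [exact: measurable_coord|exact: measurable_itv].
rewrite (_ : far_box N = I 0 N (N + 1) `&` (I 1 (- 1) 1 `&` I 2 (- 1) 1)).
  by do 2?apply: measurableI.
by apply/seteqP; split => w; rewrite /I /far_box /= !in_itv /= !ler_norml => -[] // ? [].
Qed.

Lemma good_event_lb : exists e0 p : R, [/\ 0 <= e0 < 1, 0 < p <= 1,
  (0 < P (eta 0%N @^-1` eta_le e0))%E &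
  forall k, (p%:E <= P (innov_event k (eta_le e0) (eta_le 1%R) `[1%R, 2%R]%classic))%E].
Proof.
have [e0 e01 pe] := contraction_prob (eta_ball 0).
exists e0.
have pd : (0 < P (delta 0%N @^-1` eta_le 1%R))%E.
  (* Coordinates bounded by 1/4 give a norm of at most 3/4. *)
  apply: (@gaussian3_box_gt0 _ _ _ _ (delta 0%N) sigma (- (1/4)) (1/4) (- (1/4)) (1/4) (- (1/4)) (1/4)) => //.
  + by lra.
  + by lra.
  + by lra.
  + by apply: measurable_preimage => //; exact: measurable_eta_le.
  + move=> w; rewrite -!ler_norml /eta_le /= => h0 h1 h2.
    by apply: le_trans (enorm_le_coord _) _; lra.
have px : (0 < P (xi 0%N @^-1` `[1%R, 2%R]%classic))%E.
  apply: (@exponential_ge_gt0 _ _ _ _ (xi 0%N) lambda 1 2) => //; first by lra.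
  by apply: measurable_preimage => //; exact: measurable_itv.
have [p p01 H] := innov_event_lb (measurable_eta_le e0) (measurable_eta_le 1) (measurable_itv _) pe pd px.
by exists p.
Qed.

Lemma escape_event_lb e0 N Xi : (0 < P (eta 0%N @^-1` eta_le e0))%E -> 
  exists2 p : R, 0 < p <= 1 &
    forall k, (p%:E <= P (innov_event k (eta_le e0) (far_box N) `[Xi, +oo[%classic))%E.
Proof.
move=> pe; apply: innov_event_lb => //.
- exact: measurable_eta_le.
- exact: measurable_far_box.
- apply: (@gaussian3_box_gt0 _ _ _ _ (delta 0%N) sigma N (N + 1) (- 1) 1 (- 1) 1) => //.
  + by lra.
  + by apply: measurable_preimage => //; exact: measurable_far_box.
  + by move=> w h0 h1 h2; split; rewrite ?ler_norml.
- apply: (@exponential_ge_gt0 _ _ _ _ (xi 0%N) lambda (Num.max Xi 0) (Num.max Xi 0 + 1)) => //.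
  + by rewrite le_max lexx orbT.
  + by lra.
  + by apply: measurable_preimage => //; exact: measurable_itv.
  + by move=> w /=; rewrite in_itv /= andbT ge_max => /andP[/andP[]].
Qed.

Lemma measurable_fun_noise (X : T -> R) : measurable_fun setT X ->
  measurable_fun setT (fun w => noise om (X w)).
Proof. by move=> mX; apply: measurable_funM => //; exact: measurable_maxr. Qed.

(** The exponential of th (x + y) is at most the sum of those of 2 th x and 2 th y. The value lambda
    / (4 om) makes 2 th om half of the rate of [xi], so the first has finite mean; the Gaussian has
    all exponential moments. *)
Lemma innov_moment : exists th B : R, [/\ 0 < th, 1 <= B &
  forall k, (\int[P]_w (expR (th * (noise om (xi k w) + enorm (delta k w : 'cV[R]_3))))%:E <= B%:E)%E].
Proof.
pose th := lambda / (4 * om).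
have th0 : 0 < th by rewrite divr_gt0 // mulr_gt0.
have c_la : 0 <= 2 * th * om < lambda.
  have -> : 2 * th * om = lambda / 2 by rewrite /th; field; rewrite gt_eqF.
  by have := lambda_gt0; move=> ?; apply/andP; split; lra.
have c0 : 0 <= 2 * th by lra.
exists th, (1 + lambda / (lambda - 2 * th * om) + 6 * expR ((3 * (2 * th)) ^+ 2 * sigma ^+ 2 / 2)); split => //.
  have h1 : 0 <= lambda / (lambda - 2 * th * om).
    by apply: divr_ge0; [exact: ltW|rewrite subr_ge0; case/andP: c_la => _ /ltW].
  have := expR_ge0 ((3 * (2 * th)) ^+ 2 * sigma ^+ 2 / 2); lra.
move=> k.
have mx : measurable_fun setT (xi k) by [].
have mn := measurable_fun_noise mx.
have md : measurable_fun setT (fun w => enorm (delta k w : 'cV[R]_3)) by exact: measurable_fun_enorm.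
apply: (@le_trans _ _ (\int[P]_w (expR (2 * th * om * Num.max (xi k w) 0) + expR (2 * th * enorm (delta k w : 'cV[R]_3)))%:E)%E).
  apply: le_expectation.
  - by apply: measurable_fun_expRM; exact: measurable_funD.
  - by apply: measurable_funD; apply: measurable_fun_expRM => //; exact: measurable_maxr.
  - by move=> w; exact: expR_ge0.
  - move=> w; rewrite -mulrA -/(noise om (xi k w)).
    set x := noise _ _; set y := enorm _.
    have [xy|yx] := leP x y.
      apply: (@le_trans _ _ (expR (2 * th * y))); last by rewrite lerDr expR_ge0.
      by rewrite ler_expR (mulrC 2) -[leRHS]mulrA (ler_pM2l th0); lra.
    apply: (@le_trans _ _ (expR (2 * th * x))); last by rewrite lerDl expR_ge0.
    by rewrite ler_expR (mulrC 2) -[leRHS]mulrA (ler_pM2l th0); lra.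
apply: expectationD_le; try by move=> w; exact: expR_ge0.
- by apply: measurable_fun_expRM => //; exact: measurable_maxr.
- exact: measurable_fun_expRM.
- exact: pos_part_moment.
- exact: enorm_gaussian_moment.
Qed.

End innovations.

(** * The Markov chain of pre-collision states *)

Section walk_chain.
Context d (T : measurableType d) (R : realType) (P : probability T R).
Variables (om : R) (rot : 'cV[R]_3 -> 'M[R]_3) (x0 v0 : 'cV[R]_3).
Variables (eta delta : nat -> {RV P >-> borel 'cV[R]_3}) (xi : nat -> {RV P >-> R}).

Definition walkX k w := walk_pos om rot x0 v0 (eta^~ w) (delta^~ w) (xi^~ w) k.
Definition walkV k w := walk_vel om rot x0 v0 (eta^~ w) (delta^~ w) (xi^~ w) k.
Definition walkT k w := walk_time om rot x0 v0 (eta^~ w) (delta^~ w) (xi^~ w) k.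

Lemma walkXS k w : walkX k.+1 w = fly om (walkX k w) (walkV k w) (xi k w).
Proof. by rewrite /walkX /walkV /walk_pos /walk_vel /=; case: walk => -[]. Qed.

Lemma walkVS k w : walkV k.+1 w =
  collide om rot (walkX k.+1 w) (walkV k w) (eta k.+1 w) (delta k.+1 w).
Proof. by rewrite /walkX /walkV /walk_pos /walk_vel /=; case: walk => -[]. Qed.

Lemma walkTS k w : walkT k.+1 w = walkT k w + free_time om (walkX k w) (walkV k w) (xi k w).
Proof. by rewrite /walkX /walkV /walkT /walk_pos /walk_vel /walk_time /=; case: walk => -[]. Qed.

Notation state := (borel 'cV[R]_3 * borel 'cV[R]_3)%type.
Notation innovation := (borel 'cV[R]_3 * borel 'cV[R]_3 * R)%type.

(* The state just before the k-th collision: X_k together with the velocity V_(k-1) on the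
   flight leading to it. The step out of state 0 has no collision. *)
Definition walk_state k w : state :=
  (walkX k w, if k is k'.+1 then walkV k' w else v0).

Definition turn k (s : state) (z : innovation) : 'cV[R]_3 :=
  if k is 0 then s.2 else collide om rot s.1 s.2 z.1.1 z.1.2.

Definition walk_step k (sz : state * innovation) : state :=
  let v := turn k sz.1 sz.2 in (fly om sz.1.1 v sz.2.2, v).

Definition innov k w : innovation := (eta k w, delta k w, xi k w).

Lemma walk_turn k w : walkV k w = turn k (walk_state k w) (innov k w).
Proof. by case: k => // k; rewrite walkVS. Qed.

(** Cutting the walk just before collisions makes step [k] use the innovations of index [k] only, as
    the Markov property requires. *)
Lemma walk_stateS k w : walk_state k.+1 w = walk_step k (walk_state k w, innov k w).
Proof. by rewrite /walk_step -walk_turn -walkXS. Qed.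

Hypothesis om_gt0 : 0 < om.
Hypothesis hrot : rotation_choice rot.

Lemma measurable_fun_fly d' (T' : measurableType d') (x v : T' -> borel 'cV[R]_3) (s : T' -> R) :
  measurable_fun setT x -> measurable_fun setT v -> measurable_fun setT s ->
  measurable_fun setT (fun w => fly om (x w) (v w) (s w) : borel 'cV[R]_3).
Proof.
move=> mx mv ms; apply: measurable_fun_addv => //; apply: measurable_fun_scalev => //.
exact: measurable_fun_free_time.
Qed.

Lemma measurable_walk_step k : measurable_fun setT (walk_step k).
Proof.
have m11 : measurable_fun setT (fun sz : state * innovation => sz.1.1).
  by apply: measurableT_comp.
have m12 : measurable_fun setT (fun sz : state * innovation => sz.1.2).
  by apply: measurableT_comp.
have m22 : measurable_fun setT (fun sz : state * innovation => sz.2.2).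
  by apply: measurableT_comp.
have m21 : measurable_fun setT (fun sz : state * innovation => sz.2.1) by apply: measurableT_comp.
have mt : measurable_fun setT (fun sz : state * innovation => turn k sz.1 sz.2 : borel 'cV[R]_3).
  case: k => [|k]; first exact: m12.
  by apply: measurable_fun_collide => //; apply: measurableT_comp m21.
have mf := measurable_fun_fly m11 mt m22.
exact: measurable_fun_pair mf mt.
Qed.

Hypothesis hinnov : indep_innov P eta delta xi.

Let mN1 k : measurable_fun setT (eta k). Proof. by []. Qed.
Let mN2 k : measurable_fun setT (delta k). Proof. by []. Qed.
Let mN3 k : measurable_fun setT (xi k). Proof. by []. Qed.

Lemma measurable_walk_state k : measurable_fun setT (walk_state k).
Proof.
apply: (measurable_chain mN1 mN2 mN3 (step := walk_step) (s0 := (x0, v0))) => //.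
- exact: measurable_walk_step.
- exact: walk_stateS.
Qed.

Lemma measurable_walkX k : measurable_fun setT (walkX k : T -> borel 'cV[R]_3).
Proof. exact: (measurableT_comp measurable_fst (measurable_walk_state k)). Qed.

Lemma measurable_walkV k : measurable_fun setT (walkV k : T -> borel 'cV[R]_3).
Proof. exact: (measurableT_comp measurable_snd (measurable_walk_state k.+1)). Qed.

Lemma measurable_walkT k : measurable_fun setT (walkT k).
Proof.
elim: k => [|k IH]; first exact: measurable_cst.
rewrite (_ : walkT k.+1 = fun w => walkT k w + free_time om (walkX k w) (walkV k w) (xi k w)).
  apply: measurable_funD => //; apply: measurable_fun_free_time => //.
  + exact: measurable_walkX.
  + exact: measurable_walkV.
by apply/funext => w; rewrite walkTS.
Qed.

Lemma walk_drift (f : state -> R) (g c : R) k :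
  measurable_fun setT f -> (forall s, 0 <= f s) -> 0 <= g -> 0 <= c ->
  (forall s, \int[P]_w (f (walk_step k (s, innov k w)))%:E <= (g * f s + c)%:E)%E ->
  (\int[P]_w (f (walk_state k.+1 w))%:E <= g%:E * \int[P]_w (f (walk_state k w))%:E + c%:E)%E.
Proof.
move=> mf f0 g0 c0 H.
apply: (chain_drift mN1 mN2 mN3 hinnov (step := walk_step) (s0 := (x0, v0))) => //.
- exact: measurable_walk_step.
- exact: walk_stateS.
Qed.

Lemma measurable_step_of k s : measurable_fun setT (fun w => walk_step k (s, innov k w)).
Proof.
apply: (measurableT_comp (measurable_walk_step k)); apply: measurable_fun_pair => //.
by do 2?apply: measurable_fun_pair.
Qed.

End walk_chain.

(** * Linear escape *)

Section damping.
Variable R : realType.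
Implicit Types (eps x y q : R).

(* The slope eps beyond 1 is so small that, in a compact set, leaving for values below 1/2 with
   a fixed probability outweighs any bounded growth. *)
Definition damp eps x := Num.min x (1 - eps + eps * x).

Lemma damp_ge1 eps x : 0 <= eps <= 1 -> 1 <= x -> damp eps x = 1 - eps + eps * x.
Proof. by move=> /andP[e0 e1] x1; apply/min_idPr; have : 0 <= (1 - eps) * (x - 1) by [apply: mulr_ge0; lra]; lra. Qed.

Lemma damp_le1 eps x : 0 <= eps <= 1 -> x <= 1 -> damp eps x = x.
Proof. by move=> /andP[e0 e1] x1; apply/min_idPl; have : 0 <= (1 - eps) * (1 - x) by [apply: mulr_ge0; lra]; lra. Qed.

Lemma damp_le eps x : damp eps x <= x. Proof. by rewrite /damp ge_min lexx. Qed.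

Lemma damp_le_affine eps x : damp eps x <= 1 - eps + eps * x.
Proof. by rewrite /damp ge_min lexx orbT. Qed.

Lemma damp_ge0 eps x : 0 <= eps <= 1 -> 0 <= x -> 0 <= damp eps x.
Proof. by move=> /andP[e0 e1] x0; rewrite le_min x0 addr_ge0 ?subr_ge0 // mulr_ge0. Qed.

Lemma damp_mono eps x y : 0 <= eps -> x <= y -> damp eps x <= damp eps y.
Proof.
move=> e0 xy; rewrite le_min (le_trans (damp_le _ _) xy) (le_trans (damp_le_affine _ _)) //.
by rewrite lerD2l ler_wpM2l.
Qed.

Lemma damp_scale eps q x : 0 <= eps <= 1 -> 1 <= q -> 0 <= x ->
  damp eps (q * x) <= q * damp eps x.
Proof.
move=> /andP[e0 e1] q1 x0; rewrite /damp minr_pMr ?(le_trans _ q1) // le_min.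
rewrite ge_min lexx /= ge_min; apply/orP; right.
have : 0 <= (q - 1) * (1 - eps) by apply: mulr_ge0; lra.
lra.
Qed.

Lemma damp_ge1_ge1 eps x : 0 <= eps <= 1 -> 1 <= x -> 1 <= damp eps x.
Proof.
move=> e01 x1; rewrite (damp_ge1 e01 x1); have /andP[e0 _] := e01.
by have : 0 <= eps * (x - 1) by [rewrite mulr_ge0 // subr_ge0]; lra.
Qed.

Lemma damp_step_ge1 eps x y c0 c1 c2 i q : 0 <= eps -> y <= x * (c0 - c1 * i + c2 * q) ->
  damp eps y <= 1 - eps + eps * x * c0 - eps * x * c1 * i + eps * x * c2 * q.
Proof.
by move=> e0 xy; apply: le_trans (damp_le_affine _ _) _; have := ler_wpM2l e0 xy; lra.
Qed.

Lemma damp_step_le1 eps x y c0 c1 c2 i q : y <= x * (c0 - c1 * i + c2 * q) ->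
  damp eps y <= x * c0 - x * c1 * i + x * c2 * q.
Proof. by move=> xy; apply: le_trans (damp_le _ _) _; lra. Qed.

(** Above 1 the mean is at most 1 - eps + eps gam x, that is [damp eps x] minus eps (1 - gam) x, and
    x dominates [damp eps x]. *)
Lemma damp_gain_ge1 eps gam x c0 c1 c2 p B : 0 <= eps <= 1 -> gam <= 1 -> 1 <= x ->
  c0 - c1 * p + c2 * B <= gam ->
  1 - eps + eps * x * c0 - eps * x * c1 * p + eps * x * c2 * B <=
  (1 - eps * (1 - gam)) * damp eps x.
Proof.
move=> e01 g1 x1 cg; have /andP[e0 e1] := e01.
have x0 : 0 <= eps * x by rewrite mulr_ge0 // (le_trans _ x1).
have h1 := ler_wpM2l x0 cg.
have g0 : 0 <= eps * (1 - gam) by rewrite mulr_ge0 // subr_ge0.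
have h2 := ler_wpM2l g0 (damp_le eps x).
have h3 := damp_ge1 e01 x1.
by rewrite mulrBl mul1r {1}h3; lra.
Qed.

Lemma damp_gain_le1 eps gam x c0 c1 c2 p B : 0 <= eps <= 1 -> gam <= 1 -> 0 <= x <= 1 ->
  c0 - c1 * p + c2 * B <= gam ->
  x * c0 - x * c1 * p + x * c2 * B <= (1 - eps * (1 - gam)) * damp eps x.
Proof.
move=> e01 g1 /andP[x0 x1] cg; rewrite (damp_le1 e01 x1); have /andP[e0 e1] := e01.
have h1 := ler_wpM2l x0 cg.
have : 0 <= (1 - eps) * (1 - gam) * x by rewrite !mulr_ge0 // subr_ge0.
lra.
Qed.

Lemma damp_escape eps y m q (i : bool) : 0 <= eps <= 1 -> 0 <= m * q -> y <= m * q ->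
  (i -> y <= 1 / 2) -> damp eps y <= 1 - 1 / 2 * i%:R + eps * m * q.
Proof.
move=> /andP[e0 e1] mq ymq; have h := ler_wpM2l e0 ymq; have h0 := mulr_ge0 e0 mq.
case: i => [/(_ isT) y2|_]; first by apply: le_trans (damp_le _ _) _; rewrite (_ : true%:R = 1 :> R) //; lra.
by apply: le_trans (damp_le_affine _ _) _; rewrite (_ : false%:R = 0 :> R) //; lra.
Qed.

Lemma half_itv : 0 <= (1 / 2 : R) <= 1.
Proof. by apply/andP; split; lra. Qed.

Lemma escape_gain q x : 0 <= q <= 1 -> 1 <= x -> 1 - 1 / 2 * q + q / 4 <= (1 - q / 4) * x.
Proof.
move=> /andP[q0 q1] x1.
have : 0 <= (1 - q / 4) * (x - 1) by apply: mulr_ge0; lra.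
lra.
Qed.

Lemma expR_le_half (th K h : R) : 0 < th -> K + 1 / th <= h -> expR (th * (K - h)) <= 1 / 2.
Proof.
move=> th0 hM; apply: (@le_trans _ _ (expR (- 1))); last by have := @expRN_le_half R 1; lra.
rewrite ler_expR; have := ler_wpM2l (ltW th0) hM; rewrite mulrDr mulrCA divff ?gt_eqF // mulr1.
lra.
Qed.

End damping.

Section escape.
Context d (T : measurableType d) (R : realType) (P : probability T R).
Variables (lambda sigma om : R) (rot : 'cV[R]_3 -> 'M[R]_3) (x0 v0 : 'cV[R]_3).
Variables (eta delta : nat -> {RV P >-> borel 'cV[R]_3}) (xi : nat -> {RV P >-> R}).
Hypothesis om_gt0 : 0 < om.
Hypothesis hrot : rotation_choice rot.
Hypothesis noisy : collision_noise lambda sigma eta delta xi.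
Notation state := (borel 'cV[R]_3 * borel 'cV[R]_3)%type.
Notation zeta := (innov eta delta xi).
Notation step := (walk_step om rot).
Let hinnov := walk_innov noisy.
Let om_ge0 : 0 <= om. Proof. exact: ltW. Qed.

Definition kick k w : R := noise om (xi k w) + enorm (delta k w : 'cV[R]_3).

Lemma kick_ge0 k w : 0 <= kick k w.
Proof. by rewrite addr_ge0 ?noise_ge0 ?enorm_ge0. Qed.

Lemma measurable_kick k : measurable_fun setT (kick k).
Proof.
apply: measurable_funD; first exact: measurable_fun_noise.
exact: measurable_fun_enorm.
Qed.

Definition rho_of (s : state) : R := potential om s.1.
Definition spd_of (s : state) : R := relspeed om s.1 s.2.

Lemma rho_of_ge0 s : 0 <= rho_of s. Proof. exact: potential_ge0. Qed.
Lemma spd_of_ge0 s : 0 <= spd_of s. Proof. exact: relspeed_ge0. Qed.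

Lemma measurable_rho_of : measurable_fun setT rho_of.
Proof. by apply: measurable_funM => //; exact: measurable_fun_radial. Qed.

Lemma measurable_spd_of : measurable_fun setT spd_of.
Proof. by apply: measurable_fun_enorm; apply: measurable_fun_subv => //; exact: measurable_fun_rotfield. Qed.

Lemma walk_one_step k s w : let s' := step k (s, zeta k w) in
  exists e b, one_step (rho_of s) (spd_of s) e (enorm (delta k w : 'cV[R]_3)) (noise om (xi k w)) b
    (rho_of s') (spd_of s').
Proof.
case: k => [|k] /=; last first.
  eexists; eexists; exact: (geo_one_step om_gt0 hrot s.1 s.2 (delta k.+1 w) (xi k.+1 w) (noise_eta_ball noisy k.+1 w)).
exists 1, (spd_of s); split.
- by split; rewrite ?potential_ge0 ?relspeed_ge0.
- by split; rewrite ?enorm_ge0 ?noise_ge0 // ler01 lexx.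
- by rewrite mul1r lerDl mulr_ge0 ?enorm_ge0.
- exact: relspeed_flight.
- exact: potential_fly.
Qed.

(** The shift by [K] makes the weight at least 1 where rho is at most [K], so the compact set lies
    in the flattened range of [damp]. *)
Definition lyap_weight th K kap (s : state) : R :=
  expR (th * (K - lyap kap (rho_of s) (spd_of s))).

Lemma lyap_weight_ge0 th K kap s : 0 <= lyap_weight th K kap s.
Proof. exact: expR_ge0. Qed.

Lemma measurable_lyap_weight th K kap : measurable_fun setT (lyap_weight th K kap).
Proof.
apply: measurable_fun_expRM; apply: measurable_funB => //.
have mr := measurable_rho_of; have ms := measurable_spd_of.
apply: measurable_funB; apply: measurable_funM => //.
apply: (measurableT_comp (@measurable_sqrt R)).
by apply: measurable_funD; apply: measurable_funX.
Qed.

Lemma measurable_damp eps (f : state -> R) : measurable_fun setT f ->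
  measurable_fun setT (fun s => damp eps (f s)).
Proof.
move=> mf; apply: measurable_minr => //.
by apply: measurable_funD => //; exact: measurable_funM.
Qed.

Lemma lyap_weight_step th K kap k s w : 0 <= th -> 0 <= kap <= 1 ->
  lyap_weight th K kap (step k (s, zeta k w)) <= expR (2 * th * kick k w) * lyap_weight th K kap s.
Proof.
move=> th0 kap01; have [e [b st]] := walk_one_step k s w.
have := lyap_step_ge st kap01; rewrite /lyap_weight /kick -expRD ler_expR.
set h' := lyap _ (rho_of (walk_step _ _ _ _)) _; set h := lyap _ _ _.
set z := noise _ _; set D := enorm _ => H.
have : 0 <= th * (h' - h + 2 * z + 2 * D) by apply: mulr_ge0 => //; lra.
lra.
Qed.

(** Steps with a collision contract. The last bound covers any step and serves for the initial
    flight, which no collision precedes. *)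
Lemma walk_damped_drift : exists th K kap eps g B, [/\ 0 < th, 0 <= K, 0 <= kap <= 1, 0 < eps <= 1 &
  [/\ 0 <= g < 1, 0 <= B,
  forall k s, (\int[P]_w (damp eps (lyap_weight th K kap (step k.+1 (s, zeta k.+1 w))))%:E <=
    (g * damp eps (lyap_weight th K kap s))%:E)%E &
  forall k s, (\int[P]_w (damp eps (lyap_weight th K kap (step k (s, zeta k w))))%:E <=
    (B * damp eps (lyap_weight th K kap s))%:E)%E]].
Proof.
have [e0 [p [e01 p01 pe Hgood]]] := good_event_lb noisy.
have [th00 [B [th000 B1 HB]]] := innov_moment om_gt0 noisy.
have [K0 [be0 [c3 [be00 /andP[c30 c31] push]]]] := geo_push om_gt0.
(* Halved because one step may multiply the weight by the exponential of 2 th times the kick. *)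
pose th0 := th00 / 2.
have th0_gt0 : 0 < th0 by rewrite divr_gt0.
have th0_le : th0 <= th00 by rewrite /th0; lra.
have zmax0 : 0 <= 2 * om by rewrite mulr_ge0.
have [th [gam [K [A [/andP[th_gt0 th_th0] /andP[gam0 gam1] K_ge0 [A_ge0 Hc]]]]]] :=
  step_contracts_outside K0 e01 p01 th0_gt0 B1 zmax0 be00 c30 c31.
have th_ge0 := ltW th_gt0.
pose kap := kappa e0 p.
have kap01 : 0 <= kap <= 1.
  by rewrite ltW ?kappa_gt0 // (le_trans (kappa_le e01 p01)) //; lra.
have M0 : 0 <= K + 1 / th by rewrite addr_ge0 // divr_ge0.
(* At height [K + 1 / th] of [lyap] the weight is at most expR (- 1), below 1/2. *)
have [N [Xi [N0 esc]]] := geo_escape om_gt0 hrot K_ge0 A_ge0 e01 M0 kap01.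
have [p1 /andP[p1_gt0 p1_le1] Hesc] := escape_event_lb noisy N Xi pe.
pose Wm := expR (th * (K + A)).
have Wm1 : 1 <= Wm by rewrite -[leLHS]expR0 ler_expR mulr_ge0 // addr_ge0.
have B0 : 0 < B by exact: lt_le_trans B1.
have Wm0 : 0 < Wm by exact: lt_le_trans Wm1.
(* On the compact set the weight is at most [Wm] and grows in mean by at most [B]; with this slope
   the growth costs p1 / 4, while the escape gains p1 / 2. *)
pose eps := p1 / (4 * Wm * B).
have den : 1 <= 4 * Wm * B.
  by have := ler_pM ler01 ler01 Wm1 B1; rewrite mulr1 -mulrA; lra.
have den0 : 0 < 4 * Wm * B by exact: lt_le_trans den.
have eps0 : 0 < eps by rewrite divr_gt0.
have eps1 : eps <= 1 by rewrite ler_pdivrMr // mul1r (le_trans p1_le1).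
have eps01 : 0 <= eps <= 1 by rewrite ltW.
have epsE : eps * Wm * B = p1 / 4 by rewrite /eps; field; rewrite !gt_eqF.
pose W := lyap_weight th K kap.
have W0 s : 0 <= W s by exact: lyap_weight_ge0.
have mdW k s : measurable_fun setT (fun w => damp eps (W (step k (s, zeta k w)))).
  apply: (measurableT_comp (measurable_damp eps (measurable_lyap_weight th K kap))).
  exact: measurable_step_of.
have dW0 s : 0 <= damp eps (W s) by exact: damp_ge0.
pose Q k w := expR (th00 * kick k w).
have mQ k : measurable_fun setT (Q k) by apply: measurable_fun_expRM; exact: measurable_kick.
have Q0 k w : 0 <= Q k w by exact: expR_ge0.
have Q1 k w : 1 <= Q k w.
  by rewrite -[leLHS]expR0 ler_expR mulr_ge0 ?kick_ge0 // ltW.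
have Qle k w c : c <= th00 -> expR (c * kick k w) <= Q k w.
  by move=> c00; rewrite ler_expR ler_wpM2r // kick_ge0.
have WQ k s w : W (step k (s, zeta k w)) <= Q k w * W s.
  apply: le_trans (lyap_weight_step K k s w th_ge0 kap01) _.
  by apply: ler_wpM2r => //; apply: Qle; move: th_th0; rewrite /th0; lra.
(* The worse of two rates: the net gain p1 / 4 on the compact set, and outside it the contraction
   weakened by the slope. *)
exists th, K, kap, eps, (Num.max (1 - p1 / 4) (1 - eps * (1 - gam))), B.
have epsg : 0 <= eps * (1 - gam) <= 1.
  have gp : 0 <= 1 - gam by rewrite subr_ge0 ltW.
  have gp1 : 1 - gam <= 1 by rewrite gerBl.
  have e00 := ltW eps0.
  by apply/andP; split; [exact: mulr_ge0|exact: mulr_ile1].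
have gmax1 : Num.max (1 - p1 / 4) (1 - eps * (1 - gam)) < 1.
  rewrite gt_max; apply/andP; split; first by lra.
  have : 0 < eps * (1 - gam) by rewrite mulr_gt0 // subr_gt0.
  lra.
split => //; first by rewrite eps0.
split => //.
- by rewrite gmax1 andbT le_max; apply/orP; left; lra.
- exact: ltW.
- move=> k s; set f' := fun w => _.
  set rho := rho_of s; set a := spd_of s.
  have hK : lyap kap rho a <= rho by exact: lyap_le.
  have [out|ins] := pselect (K <= rho \/ A <= a).
    have [c0 [c1 [c2 [c10 c20 cg Hst]]]] := Hc rho a (rho_of_ge0 s) (spd_of_ge0 s) out.
    pose G := innov_event eta delta xi k.+1 (eta_le e0) (eta_le 1) `[1, 2]%classic.
    have mG : measurable G.
      by apply: measurable_innov_event; rewrite //; exact: measurable_eta_le.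
    have key w : W (step k.+1 (s, zeta k.+1 w)) <= W s * (c0 - c1 * \1_G w + c2 * Q k.+1 w).
      have st := geo_one_step om_gt0 hrot s.1 s.2 (delta k.+1 w) (xi k.+1 w) (noise_eta_ball noisy k.+1 w).
      have gd : (w \in G) -> good_step e0 (2 * om) K0 be0 c3 rho (enorm (eta k.+1 w : 'cV[R]_3))
          (enorm (delta k.+1 w : 'cV[R]_3)) (noise om (xi k.+1 w))
          (relspeed om s.1 (collide om rot s.1 s.2 (eta k.+1 w) (delta k.+1 w)))
          (potential om (fly om s.1 (collide om rot s.1 s.2 (eta k.+1 w) (delta k.+1 w)) (xi k.+1 w))).
        rewrite inE => -[He [Hd /=]]; rewrite in_itv /= => /andP[x1 x2]; split => //.
          rewrite /noise mulrC ler_wpM2r // ge_max x2 /=; exact: ler0n.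
        by move=> rK bs; apply: push => //; rewrite x1.
      have := Hst _ _ _ _ _ _ _ st gd; rewrite indicE => H.
      have -> : W (step k.+1 (s, zeta k.+1 w)) = W s * expR (- th * (lyap kap
         (potential om (fly om s.1 (collide om rot s.1 s.2 (eta k.+1 w) (delta k.+1 w)) (xi k.+1 w)))
         (relspeed om (fly om s.1 (collide om rot s.1 s.2 (eta k.+1 w) (delta k.+1 w)) (xi k.+1 w))
            (collide om rot s.1 s.2 (eta k.+1 w) (delta k.+1 w))) - lyap kap rho a)).
        by rewrite /W /lyap_weight -expRD /=; congr expR; rewrite /rho_of /spd_of /rho /a; ring.
      apply: ler_wpM2l => //; apply: le_trans H _; rewrite lerD2l ler_wpM2l //.
      exact: Qle.
    have pG := Hgood k.+1.
    (* The new damped value is bounded by the affine branch when the old weight is above 1 and by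
       the identity branch otherwise, so that the bound stays proportional to the old damped
       value. *)
    have [W1|W1] := leP 1 (W s).
      apply: le_trans (expectation_affine_le (c0 := 1 - eps + eps * W s * c0) (c1 := eps * W s * c1)
        (c2 := eps * W s * c2) (mdW k.+1 s) (mQ k.+1) mG _ (Q0 k.+1) _ _ pG (HB k.+1) _) _.
      + by move=> w; exact: dW0.
      + have eW : 0 <= eps * W s by rewrite mulr_ge0 // ltW.
        case/andP: c10 => c10 c1c0; rewrite mulr_ge0 //=.
        apply: (@le_trans _ _ (eps * W s * c0)); first exact: ler_wpM2l.
        by rewrite lerDr subr_ge0.
      + by apply: mulr_ge0 => //; apply: mulr_ge0 => //; exact: ltW.
      + by move=> w; apply: damp_step_ge1 => //; exact: ltW.
      rewrite lee_fin.
      apply: (@le_trans _ _ ((1 - eps * (1 - gam)) * damp eps (W s))); last first.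
        by apply: ler_wpM2r => //; rewrite le_max lexx orbT.
      by apply: damp_gain_ge1 => //; exact: ltW.
    apply: le_trans (expectation_affine_le (c0 := W s * c0) (c1 := W s * c1)
      (c2 := W s * c2) (mdW k.+1 s) (mQ k.+1) mG _ (Q0 k.+1) _ _ pG (HB k.+1) _) _.
    + by move=> w; exact: dW0.
    + case/andP: c10 => c10 c1c0; rewrite mulr_ge0 //=; exact: ler_wpM2l.
    + by rewrite mulr_ge0.
    + by move=> w; exact: damp_step_le1.
    rewrite lee_fin.
    apply: (@le_trans _ _ ((1 - eps * (1 - gam)) * damp eps (W s))); last first.
      by apply: ler_wpM2r => //; rewrite le_max lexx orbT.
    by apply: damp_gain_le1 => //; [exact: ltW|rewrite W0 ltW].
  have rK : rho <= K by rewrite leNgt; apply/negP => h; apply: ins; left; exact: ltW.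
  have aA : a <= A by rewrite leNgt; apply/negP => h; apply: ins; right; exact: ltW.
  pose G := innov_event eta delta xi k.+1 (eta_le e0) (far_box N) `[Xi, +oo[%classic.
  have mG : measurable G.
    apply: measurable_innov_event; rewrite //; [exact: measurable_eta_le|exact: measurable_far_box].
  have W1 : 1 <= W s.
    by rewrite -[leLHS]expR0 ler_expR mulr_ge0 // subr_ge0 (le_trans hK).
  have Ws : W s <= Wm.
    rewrite ler_expR ler_wpM2l // lerD2l lerNl (le_trans _ (lyap_ge kap01 (rho_of_ge0 s) (spd_of_ge0 s))) //.
    by rewrite lerN2.
  have key w : damp eps (W (step k.+1 (s, zeta k.+1 w))) <=
      1 - 1 / 2 * \1_G w + eps * Wm * Q k.+1 w.
    rewrite indicE; apply: damp_escape => //; first by rewrite mulr_ge0 // ltW.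
      by apply: le_trans (WQ _ _ _) _; rewrite mulrC ler_wpM2r.
    rewrite inE => -[He [Hd /=]]; rewrite in_itv /= andbT => hx.
    by apply: expR_le_half => //; exact: (esc _ _ _ _ _ rK aA He Hd hx).
  apply: le_trans (expectation_affine_le (c0 := 1) (c1 := 1 / 2)
      (c2 := eps * Wm) (mdW k.+1 s) (mQ k.+1) mG _ (Q0 k.+1) _ _ (Hesc k.+1) (HB k.+1) key) _.
  + by move=> w; exact: dW0.
  + exact: half_itv.
  + by apply: mulr_ge0; exact: ltW.
  rewrite lee_fin epsE.
  have W1' := damp_ge1_ge1 eps01 W1.
  apply: (@le_trans _ _ ((1 - p1 / 4) * damp eps (W s))).
    by apply: escape_gain => //; rewrite ltW.
  by apply: ler_wpM2r => //; rewrite le_max lexx.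
- move=> k s.
  apply: (@le_trans _ _ (\int[P]_w (damp eps (W s) * Q k w)%:E)%E).
    apply: le_expectation => //.
    + by apply: measurable_funM.
    move=> w; apply: (@le_trans _ _ (damp eps (Q k w * W s))).
      by apply: damp_mono; [exact: ltW|exact: WQ].
    by rewrite [leRHS]mulrC; exact: damp_scale.
  by rewrite (mulrC B); apply: expectationZ_le => //; exact: HB.
Qed.

End escape.

(** * Borel-Cantelli and summable bounds *)

Section borel_cantelli.
Context d (T : measurableType d) (R : realType) (P : probability T R).

Lemma ae_eventually (F : nat -> set T) (u : nat -> R) (C : R) : (forall n, measurable (F n)) ->
  (forall n, P (F n) <= (u n)%:E)%E -> (forall N, \sum_(0 <= n < N) u n <= C) ->
  {ae P, forall w, exists N, forall n, (N <= n)%N -> ~ F n w}.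
Proof.
move=> mF Fu uC; exists (lim_sup_set F); split.
- by apply: bigcap_measurable => // k _; exact: bigcup_measurable.
- apply: lim_sup_set_cvg0 => //; apply: (@le_lt_trans _ _ C%:E); last exact: ltry.
  apply: lime_le; first by apply: is_cvg_nneseries.
  apply: nearW => N; rewrite (le_trans _ (_ : (\sum_(0 <= n < N) u n)%:E <= C%:E)%E) ?lee_fin //.
  by rewrite -sumEFin; apply: lee_sum => n _; exact: Fu.
- move=> w /= H k _; apply: contrapT => Hk; apply: H; exists k => n kn Fn.
  by apply: Hk; exists n.
Qed.

Lemma markov_expectation (Y : T -> R) (a c : R) : measurable_fun setT Y -> (forall w, 0 <= Y w) ->
  0 < c -> (\int[P]_w (Y w)%:E <= a%:E)%E -> (P [set w | (c <= Y w)%R] <= (a / c)%:E)%E.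
Proof.
move=> mY Y0 c0 Ya.
have mF : measurable [set w | c <= Y w].
  rewrite (_ : [set w | _] = Y @^-1` `[c, +oo[); first by apply: measurable_preimage => //; exact: measurable_itv.
  by apply/seteqP; split => w /=; rewrite in_itv /= andbT.
rewrite -[X in (X <= _)%E](_ : (\int[P]_w (\1_[set w | c <= Y w] w)%:E)%E = _); last first.
  by rewrite integral_indic // setIT.
have c1 : 0 <= c^-1 by rewrite invr_ge0 ltW.
apply: (@le_trans _ _ (\int[P]_w (c^-1 * Y w)%:E)%E); last first.
  by rewrite (mulrC a); exact: expectationZ_le.
apply: le_expectation => //; first exact: measurable_funM.
move=> w; rewrite indicE; case: (boolP (w \in _)) => [|_]; last by rewrite mulr_ge0.
by rewrite inE /= => cY; rewrite mulrC ler_pdivlMr // mul1r.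
Qed.

Lemma ae_eventually_lt (Y : nat -> T -> R) (u : nat -> R) (C c : R) :
  (forall n, measurable_fun setT (Y n)) -> (forall n w, 0 <= Y n w) -> 0 < c ->
  (forall n, \int[P]_w (Y n w)%:E <= (u n)%:E)%E -> (forall N, \sum_(0 <= n < N) u n <= C) ->
  {ae P, forall w, exists N, forall n, (N <= n)%N -> Y n w < c}.
Proof.
move=> mY Y0 c0 Yu uC.
have mF n : measurable [set w | c <= Y n w].
  rewrite (_ : [set w | _] = Y n @^-1` `[c, +oo[); first by apply: measurable_preimage => //; exact: measurable_itv.
  by apply/seteqP; split => w /=; rewrite in_itv /= andbT.
have := @ae_eventually (fun n => [set w | c <= Y n w]) (fun n => u n / c) (C / c) mF.
move=> /(_ (fun n => markov_expectation (mY n) (Y0 n) c0 (Yu n))).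
have h N : \sum_(0 <= n < N) u n / c <= C / c by rewrite -mulr_suml ler_wpM2r // invr_ge0 ltW.
move=> /(_ h) [A [mA PA0 H]]; exists A; split => //.
move=> w nw; apply: H => -[N HN]; apply: nw; exists N => n Nn.
by rewrite ltNge; apply/negP; exact: HN.
Qed.

End borel_cantelli.

Section summable_bounds.
Variable R : realType.

Lemma sum_geometric_le (g C : R) N : 0 <= g < 1 -> 0 <= C ->
  \sum_(0 <= n < N) C * g ^+ n <= C / (1 - g).
Proof.
move=> /andP[g0 g1] C0; have g1' : 0 < 1 - g by rewrite subr_gt0.
rewrite ler_pdivlMr // -mulr_sumr -mulrA ler_piMr //.
suff -> : (\sum_(0 <= n < N) g ^+ n) * (1 - g) = 1 - g ^+ N by rewrite gerBl exprn_ge0.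
elim: N => [|N IH]; first by rewrite big_geq // mul0r expr0 subrr.
by rewrite big_nat_recr //= mulrDl IH exprS; ring.
Qed.

Lemma sum_invsqr_le N : \sum_(0 <= n < N) (n.+1%:R ^+ 2)^-1 <= 2 :> R.
Proof.
case: N => [|N]; first by rewrite big_geq.
suff : \sum_(0 <= n < N.+1) (n.+1%:R ^+ 2)^-1 <= 2 - N.+1%:R^-1 :> R.
  by move=> h; apply: le_trans h _; rewrite gerBl invr_ge0.
elim: N => [|N IH]; first by rewrite big_nat1 expr1n invr1; lra.
rewrite big_nat_recr //=.
apply: (@le_trans _ _ (2 - N.+1%:R^-1 + (N.+2%:R ^+ 2)^-1)); first by rewrite lerD2r.
have a0 : 0 < N.+1%:R :> R by [].
have b0 : 0 < N.+2%:R :> R by [].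
have ab : N.+2%:R = N.+1%:R + 1 :> R by rewrite -natr1.
have : (N.+2%:R ^+ 2)^-1 <= N.+1%:R^-1 - N.+2%:R^-1 :> R.
  have -> : N.+1%:R^-1 - N.+2%:R^-1 = (N.+1%:R * N.+2%:R)^-1 :> R.
    move: ab b0; move: (N.+1%:R : R) (N.+2%:R : R) a0 => a b a0 -> b0.
    by field; rewrite !gt_eqF.
  by rewrite lef_pV2 ?posrE ?exprn_gt0 ?mulr_gt0 // expr2 ler_wpM2r // ab lerDl.
by move: (N.+1%:R^-1 : R) (N.+2%:R ^- 2 : R) (N.+2%:R^-1 : R) => y x z; lra.
Qed.

End summable_bounds.

Section linear_escape.
Context d (T : measurableType d) (R : realType) (P : probability T R).
Variables (lambda sigma om : R) (rot : 'cV[R]_3 -> 'M[R]_3) (x0 v0 : 'cV[R]_3).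
Variables (eta delta : nat -> {RV P >-> borel 'cV[R]_3}) (xi : nat -> {RV P >-> R}).
Hypothesis om_gt0 : 0 < om.
Hypothesis hrot : rotation_choice rot.
Hypothesis noisy : collision_noise lambda sigma eta delta xi.
Let hinnov := walk_innov noisy.
Notation X := (walkX om rot x0 v0 eta delta xi).
Notation S := (walk_state om rot x0 v0 eta delta xi).

Lemma ae_linear_escape : exists2 beta : R, 0 < beta &
  {ae P, forall w, exists N, forall n, (N <= n)%N -> beta * n%:R < radial (X n w)}.
Proof.
have [th [K [kap [eps [g [B [th0 K0 kap01 /andP[eps0 eps1]]]]]]]] :=
  walk_damped_drift om_gt0 hrot noisy.
move=> [/andP[g0 g1] B0 Hd H0].
have eps01 : 0 <= eps <= 1 by rewrite ltW.
pose f s := damp eps (lyap_weight om th K kap s).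
have f0 s : 0 <= f s by apply: damp_ge0 => //; exact: lyap_weight_ge0.
have mf : measurable_fun setT f by apply: measurable_damp; exact: measurable_lyap_weight.
have mfS n : measurable_fun setT (fun w => f (S n w)).
  by apply: (measurableT_comp mf); exact: measurable_walk_state.
pose C := B * f (x0, v0).
have C0 : 0 <= C by rewrite mulr_ge0.
have Ef n : (\int[P]_w (f (S n.+1 w))%:E <= (C * g ^+ n)%:E)%E.
  elim: n => [|n IH].
    have := walk_drift x0 v0 om_gt0 hrot hinnov mf f0 B0 (lexx 0) (k := 0).
    rewrite expr0 mulr1; move=> /(_ _)/le_trans; apply.
      by move=> s; rewrite addr0; exact: H0.
    by rewrite adde0 (integral_prob_cst P (f (x0, v0))) -EFinM lexx.
  have := walk_drift x0 v0 om_gt0 hrot hinnov mf f0 g0 (lexx 0) (k := n.+1).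
  move=> /(_ _)/le_trans; apply.
    by move=> s; rewrite addr0; exact: Hd.
  by rewrite adde0 exprS mulrCA EFinM; apply: lee_wpmul2l; rewrite ?lee_fin.
(* Some q > 1 with g q < 1, which makes the means of q^n f(S n) summable; [beta] is the speed at
   which the weight, without its shift, equals q^(- n). *)
pose q := 2 / (1 + g).
have g1p : 0 < 1 + g by rewrite ltr_pwDl.
have q1 : 1 < q by rewrite /q ltr_pdivlMr // mul1r; lra.
have q0 : 0 < q by exact: lt_trans q1.
have gq : 0 <= g * q < 1.
  by rewrite mulr_ge0 ?(ltW q0) //= /q mulrA ltr_pdivrMr // mul1r; lra.
pose beta := ln q / (th * om).
have beta0 : 0 < beta by rewrite divr_gt0 ?mulr_gt0 // ln_gt0.
exists beta => //.
have mY n : measurable_fun setT (fun w => q ^+ n.+1 * f (S n.+1 w)).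
  exact: (measurable_funM (measurable_cst _) (mfS n.+1)).
have Y0 n w : 0 <= q ^+ n.+1 * f (S n.+1 w) by rewrite mulr_ge0 // exprn_ge0 // ltW.
have EY n : (\int[P]_w (q ^+ n.+1 * f (S n.+1 w))%:E <= (q * C * (g * q) ^+ n)%:E)%E.
  have -> : q * C * (g * q) ^+ n = q ^+ n.+1 * (C * g ^+ n) by rewrite exprMn exprS; ring.
  exact: (expectationZ_le (mfS n.+1) (exprn_ge0 _ (ltW q0)) (fun w => f0 _) (Ef n)).
have sum N := sum_geometric_le N gq (mulr_ge0 (ltW q0) C0).
have [A [mA PA0 HA]] := ae_eventually_lt mY Y0 ltr01 EY sum.
exists A; split => // w nw; apply: HA => -[N HN]; apply: nw.
exists N.+1 => -[//|n] Nn; rewrite ltNge; apply/negP => Xn.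
have := HN n Nn; apply/negP; rewrite -leNgt.
have E : expR (- th * om * (beta * n.+1%:R)) = (q ^+ n.+1)^-1.
  have -> : - th * om * (beta * n.+1%:R) = - (n.+1%:R * ln q).
    by rewrite /beta; field; rewrite !gt_eqF.
  by rewrite expRN expRM_natl lnK.
have qn0 : 0 < q ^+ n.+1 by rewrite exprn_gt0.
have W1 : (q ^+ n.+1)^-1 <= lyap_weight om th K kap (S n.+1 w).
  rewrite -E ler_expR.
  have h1 : lyap kap (rho_of om (S n.+1 w)) (spd_of om (S n.+1 w)) <= om * (beta * n.+1%:R).
    by apply: (le_trans (lyap_le _ _ kap01)); apply: ler_wpM2l => //; exact: ltW.
  have := ler_wpM2l (ltW th0) h1; have := mulr_ge0 (ltW th0) K0; lra.
have qn1 : (q ^+ n.+1)^-1 <= 1 by rewrite invf_le1 // exprn_ege1 // ltW.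
have : (q ^+ n.+1)^-1 <= f (S n.+1 w).
  by rewrite -(damp_le1 eps01 qn1); apply: damp_mono => //; exact: ltW.
by move=> h; rewrite -(mulfV (lt0r_neq0 qn0)) ler_pM2l.
Qed.

End linear_escape.

(** * Slow relative speed *)

Section speed_ratio_step.
Variable R : realType.
Implicit Types (rho a e D z b M de th : R).

Lemma sqrD_le (x y de : R) : 0 < de -> (x + y) ^+ 2 <= (1 + de) * x ^+ 2 + (1 + de^-1) * y ^+ 2.
Proof.
move=> d0; rewrite -subr_ge0.
have -> : (1 + de) * x ^+ 2 + (1 + de^-1) * y ^+ 2 - (x + y) ^+ 2 = de^-1 * (de * x - y) ^+ 2.
  by field; rewrite gt_eqF.
by rewrite mulr_ge0 ?sqr_ge0 // invr_ge0 ltW.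
Qed.

(** An outward flight adds (rho' - rho) (rho' + rho), at most 2 z (M + rho'), to b^2. An inward one
    lowers the speed, but also the denominator, by a factor of at most 1 + z / M. *)
Lemma flight_ratio rho a e D z b (rho' a' : R) M : one_step rho a e D z b rho' a' -> 0 < M ->
  a' ^+ 2 <= (M + rho') * ((1 + z / M) * (b ^+ 2 / (M + rho)) + 2 * z).
Proof.
move=> [[rho0 a0 b0 rho'0 a'0] [_ D0 z0] _ en /ler_normlP[d1 d2]] M0.
have r0 : 0 < M + rho by rewrite ltr_pwDl.
have r'0 : 0 < M + rho' by rewrite ltr_pwDl.
have zM : 0 <= z / M by rewrite divr_ge0 // ltW.
have bq : 0 <= b ^+ 2 / (M + rho) by rewrite divr_ge0 ?sqr_ge0 // ltW.
have bE : b ^+ 2 = (M + rho) * (b ^+ 2 / (M + rho)) by rewrite mulrC divfK // gt_eqF.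
set B := b ^+ 2 / (M + rho) in bq bE *.
have zB : 0 <= z / M * B by rewrite mulr_ge0.
have rz : 0 <= (M + rho') * z by rewrite mulr_ge0 // ltW.
have [le|gt] := leP rho' rho.
  have h1 : a' ^+ 2 <= b ^+ 2.
    have : rho' ^+ 2 <= rho ^+ 2 by rewrite ler_sqr.
    by lra.
  have h2 : M + rho <= (M + rho') * (1 + z / M).
    rewrite mulrDr mulr1 mulrDl mulrCA divff ?gt_eqF // mulr1.
    have : 0 <= rho' * (z / M) by rewrite mulr_ge0.
    by lra.
  apply: (le_trans h1); rewrite bE mulrDr mulrA.
  apply: (@le_trans _ _ ((M + rho') * (1 + z / M) * B)); first by rewrite ler_wpM2r.
  by rewrite lerDl mulrCA mulr_ge0.
have h1 : (rho' - rho) * (rho' + rho) <= z * (2 * (M + rho')).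
  by apply: ler_pM => //; lra.
have h2 : (M + rho) * B <= (M + rho') * B by rewrite ler_wpM2r //; lra.
have h3 : 0 <= (M + rho') * (z / M * B) by rewrite mulr_ge0 // ltW.
have -> : a' ^+ 2 = b ^+ 2 + (rho' - rho) * (rho' + rho) by move: en; lra.
by rewrite bE; lra.
Qed.

Lemma ratio_step rho a e D z b (rho' a' : R) M de : one_step rho a e D z b rho' a' -> 1 <= M ->
  0 < de ->
  a' ^+ 2 / (M + rho') <=
  (1 + z / M) * (1 + de) * e ^+ 2 * (a ^+ 2 / (M + rho)) + (1 + de^-1) * (4 * (1 + z) * D ^+ 2 + 2 * z).
Proof.
move=> st M1 d0; have M0 : 0 < M by exact: lt_le_trans M1.
have h := flight_ratio st M0.
have [[rho0 a0 b0 rho'0 a'0] [/andP[e0 e1] D0 z0] bb _ _] := st.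
have r0 : 0 < M + rho by rewrite ltr_pwDl.
have r'0 : 0 < M + rho' by rewrite ltr_pwDl.
have zM : 0 <= z / M by rewrite divr_ge0 // ltW.
have zMz : z / M <= z by rewrite ler_pdivrMr // ler_peMr.
have di : 0 < de^-1 by rewrite invr_gt0.
have ri : (M + rho)^-1 <= 1 by rewrite invf_le1 // (le_trans M1) // lerDl.
have ri0 : 0 <= (M + rho)^-1 by rewrite invr_ge0 ltW.
have hb : b ^+ 2 <= (1 + de) * (e * a) ^+ 2 + (1 + de^-1) * (2 * D) ^+ 2.
  apply: le_trans (sqrD_le _ _ d0); rewrite ler_sqr ?nnegrE //.
  by rewrite addr_ge0 // mulr_ge0.
have hq : b ^+ 2 / (M + rho) <= (1 + de) * e ^+ 2 * (a ^+ 2 / (M + rho)) + (1 + de^-1) * (4 * D ^+ 2).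
  apply: (le_trans (ler_wpM2r ri0 hb)).
  have : 0 <= (1 + de^-1) * (4 * D ^+ 2) * (1 - (M + rho)^-1).
    by rewrite !mulr_ge0 ?subr_ge0 ?sqr_ge0 ?addr_ge0 // ltW.
  set i := (M + rho)^-1; have -> : (2 * D) ^+ 2 = 4 * D ^+ 2 by ring.
  have -> : ((1 + de) * (e * a) ^+ 2 + (1 + de^-1) * (4 * D ^+ 2)) * i =
    (1 + de) * e ^+ 2 * (a ^+ 2 * i) + (1 + de^-1) * (4 * D ^+ 2) * i by ring.
  by move: (_ * (4 * D ^+ 2)) => u; lra.
rewrite ler_pdivrMr // mulrC; apply: (le_trans h); rewrite ler_pM2l //.
have z1 : 0 <= 1 + z / M by rewrite addr_ge0.
have h1 := ler_wpM2l z1 hq.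
set F := (1 + de) * e ^+ 2 * (a ^+ 2 / (M + rho)) in h1 *.
have -> : (1 + z / M) * (1 + de) * e ^+ 2 * (a ^+ 2 / (M + rho)) = (1 + z / M) * F by rewrite /F; ring.
have h2 : (1 + z / M) * ((1 + de^-1) * (4 * D ^+ 2)) <= (1 + z) * ((1 + de^-1) * (4 * D ^+ 2)).
  apply: ler_wpM2r; last by rewrite lerD2l.
  by rewrite !mulr_ge0 ?sqr_ge0 ?addr_ge0 // ltW.
have h3 : 0 <= de^-1 * (2 * z) by rewrite !mulr_ge0 // ltW.
rewrite mulrDr in h1.
have -> : (1 + de^-1) * (4 * (1 + z) * D ^+ 2 + 2 * z) =
  (1 + z) * ((1 + de^-1) * (4 * D ^+ 2)) + 2 * z + de^-1 * (2 * z) by ring.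
by move: h1 h2 h3; set u := (1 + z / M) * (b ^+ 2 / (M + rho)); set v := (1 + z / M) * F;
  set x := (1 + z / M) * ((1 + de^-1) * (4 * D ^+ 2)); set y := (1 + z) * _; set t := de^-1 * _;
  move: u v x y t => u v x y t; lra.
Qed.

Lemma pow6_le_expR th s : 0 < th -> 0 <= s -> (1 + s) ^+ 6 <= (1 + 2 / (th / 3)) ^+ 6 * expR (th * s).
Proof.
move=> th0 s0; have t3 : 0 < th / 3 by rewrite divr_gt0.
have h := sqr1D_le_expR t3 s0.
have -> : th * s = 3%:R * (th / 3 * s) by field.
rewrite expRM_natl !(exprM _ 2 3) -exprMn.
apply: (lerXn2r 3) => //; rewrite nnegrE; first exact: sqr_ge0.
by apply: mulr_ge0; [exact: sqr_ge0|exact: expR_ge0].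
Qed.

(** Squared for the sake of Borel-Cantelli: with a bounded second moment of the ratio, the
    probabilities of exceeding a multiple of n are of order 1/n^2, hence summable. *)
Definition speed_ratio M rho a : R := (a ^+ 2 / (M + rho)) ^+ 2.

(** [ratio_step] is squared by means of [sqrD_le]. The random flight length costs only the factor
    proportional to 1/M, small for large M; the noise is cubic before squaring, whence the power
    6. *)
Lemma speed_ratio_step th (e0 : R) M de : 0 < th -> 0 <= e0 <= 1 -> 1 <= M -> 0 < de ->
  forall (rho a e D z b rho' a' : R) (G : bool), one_step rho a e D z b rho' a' -> (G -> e <= e0) ->
  speed_ratio M rho' a' <=
   (1 + de) ^+ 3 * speed_ratio M rho a - (1 + de) ^+ 3 * speed_ratio M rho a * (1 - e0 ^+ 4) * G%:R
   + ((1 + de) ^+ 3 * speed_ratio M rho a * ((1 + 2 / (th / 3)) ^+ 6 / M)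
      + (1 + de^-1) ^+ 3 * 36 * (1 + 2 / (th / 3)) ^+ 6) * expR (th * (z + D)).
Proof.
move=> th0 /andP[e00 e01] M1 d0 rho a e D z b rho' a' G st Ge.
have M0 : 0 < M by exact: lt_le_trans M1.
have h := ratio_step st M1 d0.
have [[rho0 a0 b0 rho'0 a'0] [/andP[e_0 e1] D0 z0] _ _ _] := st.
have s0 : 0 <= z + D by rewrite addr_ge0.
have h6 := pow6_le_expR th0 s0.
set C := (1 + 2 / (th / 3)) ^+ 6 in h6 *; set Q := expR _ in h6 *.
rewrite /speed_ratio; set q := a ^+ 2 / (M + rho) in h *; set q' := a' ^+ 2 / (M + rho') in h *.
have q'0 : 0 <= q' by rewrite divr_ge0 ?sqr_ge0 // addr_ge0 // ltW.
have q0 : 0 <= q by rewrite divr_ge0 ?sqr_ge0 // addr_ge0 // ltW.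
have di : 0 < de^-1 by rewrite invr_gt0.
have zM : 0 <= z / M by rewrite divr_ge0 // ltW.
set Aq := (1 + z / M) * (1 + de) * e ^+ 2 * q in h.
set Rr := (1 + de^-1) * (4 * (1 + z) * D ^+ 2 + 2 * z) in h.
have d1 : 0 <= 1 + de by rewrite addr_ge0 // ltW.
have di1 : 0 <= 1 + de^-1 by rewrite addr_ge0 // ltW.
have z1 : 0 <= 1 + z / M by rewrite addr_ge0.
have zz1 : 0 <= 1 + z by rewrite addr_ge0.
have Aq0 : 0 <= Aq by do 3!apply: mulr_ge0 => //; exact: sqr_ge0.
have r0 : 0 <= 4 * (1 + z) * D ^+ 2 + 2 * z.
  apply: addr_ge0; last exact: mulr_ge0.
  by apply: mulr_ge0; [exact: mulr_ge0|exact: sqr_ge0].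
have Rr0 : 0 <= Rr by exact: mulr_ge0.
have h1 : q' ^+ 2 <= (1 + de) * Aq ^+ 2 + (1 + de^-1) * Rr ^+ 2.
  by apply: le_trans (sqrD_le _ _ d0); rewrite ler_sqr ?nnegrE ?addr_ge0.
have hA : Aq ^+ 2 <= (1 + de) ^+ 2 * q ^+ 2 * (1 - (1 - e0 ^+ 4) * G%:R + C / M * Q).
  have -> : Aq ^+ 2 = (1 + de) ^+ 2 * q ^+ 2 * ((1 + z / M) ^+ 2 * e ^+ 4) by rewrite /Aq; ring.
  apply: ler_wpM2l; first by rewrite mulr_ge0 ?sqr_ge0.
  have e4 : e ^+ 4 <= 1 - (1 - e0 ^+ 4) * G%:R.
    case: G Ge => [/(_ isT) ee0|_]; last by rewrite mulr0 subr0 exprn_ile1.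
    by rewrite mulr1 opprB addrCA subrr addr0 lerXn2r ?nnegrE.
  have e41 : e ^+ 4 <= 1 by rewrite exprn_ile1.
  have hz : (2 * z + z ^+ 2 / M) / M <= C / M * Q.
    rewrite [leRHS]mulrAC ler_wpM2r ?invr_ge0 ?(ltW M0) // (le_trans _ h6) //.
    have zz : z ^+ 2 / M <= z ^+ 2 by rewrite ler_pdivrMr // ler_peMr ?sqr_ge0.
    apply: (@le_trans _ _ ((1 + (z + D)) ^+ 2)).
      apply: (@le_trans _ _ ((1 + z) ^+ 2)); first by move: zz; rewrite sqrrD; lra.
      by rewrite lerXn2r ?nnegrE ?addr_ge0 //; lra.
    by rewrite ler_weXn2l // lerDl.
  have -> : (1 + z / M) ^+ 2 * e ^+ 4 = e ^+ 4 + (2 * z + z ^+ 2 / M) / M * e ^+ 4.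
    by field; rewrite gt_eqF.
  rewrite lerD // (le_trans _ hz) // ler_piMr // divr_ge0 ?(ltW M0) //.
  by apply: addr_ge0; [exact: mulr_ge0|apply: divr_ge0; [exact: sqr_ge0|exact: ltW]].
have hR : Rr ^+ 2 <= (1 + de^-1) ^+ 2 * (36 * (C * Q)).
  rewrite /Rr exprMn ler_wpM2l ?sqr_ge0 //.
  have -> : 36 * (C * Q) = 6 ^+ 2 * (C * Q) by ring.
  apply: (@le_trans _ _ (6 ^+ 2 * (1 + (z + D)) ^+ 6)); last by rewrite ler_wpM2l ?sqr_ge0.
  have -> : 6 ^+ 2 * (1 + (z + D)) ^+ 6 = (6 * (1 + (z + D)) ^+ 3) ^+ 2 by ring.
  have t0 : 0 <= 1 + (z + D) by rewrite addr_ge0.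
  have g1 : 1 <= (1 + (z + D)) by lra.
  have g2 : (1 + z) * D ^+ 2 <= (1 + (z + D)) ^+ 3.
    rewrite exprS; apply: ler_pM; rewrite ?sqr_ge0 ?addr_ge0 //; first by lra.
    by rewrite expr1; apply: ler_pM => //; lra.
  have g3 : z <= (1 + (z + D)) ^+ 3.
    by apply: (@le_trans _ _ (1 + (z + D))); [lra|rewrite -[leLHS]expr1 ler_weXn2l].
  apply: (lerXn2r 2); rewrite ?nnegrE //; first by apply: mulr_ge0 => //; exact: exprn_ge0.
  by rewrite -mulrA; lra.
apply: (le_trans h1).
have k1 := ler_wpM2l d1 hA; have k2 := ler_wpM2l di1 hR.
apply: (le_trans (lerD k1 k2)).
rewrite le_eqVlt; apply/orP; left; apply/eqP.
by ring.
Qed.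

End speed_ratio_step.

Section slow_relative_speed.
Context d (T : measurableType d) (R : realType) (P : probability T R).
Variables (lambda sigma om : R) (rot : 'cV[R]_3 -> 'M[R]_3) (x0 v0 : 'cV[R]_3).
Variables (eta delta : nat -> {RV P >-> borel 'cV[R]_3}) (xi : nat -> {RV P >-> R}).
Hypothesis om_gt0 : 0 < om.
Hypothesis hrot : rotation_choice rot.
Hypothesis noisy : collision_noise lambda sigma eta delta xi.
Let hinnov := walk_innov noisy.
Notation state := (borel 'cV[R]_3 * borel 'cV[R]_3)%type.
Notation zeta := (innov eta delta xi).
Notation step := (walk_step om rot).
Notation X := (walkX om rot x0 v0 eta delta xi).
Notation S := (walk_state om rot x0 v0 eta delta xi).

Definition ratio_of M (s : state) : R := speed_ratio M (rho_of om s) (spd_of om s).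

Lemma ratio_of_ge0 M s : 0 <= ratio_of M s.
Proof. exact: sqr_ge0. Qed.

Lemma measurable_ratio_of M : 0 < M -> measurable_fun setT (ratio_of M).
Proof.
move=> M0; apply: (@measurable_funX _ _ _ _ (fun s => spd_of om s ^+ 2 / (M + rho_of om s)) 2).
have mr : measurable_fun setT (rho_of om) by exact: measurable_rho_of.
have ms : measurable_fun setT (spd_of om) by exact: measurable_spd_of.
apply: measurable_funM; first exact: measurable_funX.
have mh : measurable_fun setT (fun s => M + rho_of om s).
  by apply: (measurable_funD (measurable_cst _) mr).
apply: (measurable_comp (F := [set x : R | x != 0]) _ _ _ mh).
- rewrite (_ : [set x | _] = ~` [set 0 : R]); first by apply: measurableC; exact: measurable_set1.
  by apply/seteqP; split => x /=; [move/eqP|move=> /eqP].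
- by move=> _ [s _ <-] /=; rewrite gt_eqF // ltr_pwDl // rho_of_ge0.
- apply: open_continuous_measurable_fun; first exact: open_neq.
  by move=> x; rewrite inE /= => xn0; exact: inv_continuous.
Qed.

Lemma contraction_constants (c1 B C : R) : 0 < c1 <= 1 -> 0 < B -> 0 < C ->
  exists M de, [/\ 1 <= M, 0 < de & (1 + de) ^+ 3 * (1 - c1 + C / M * B) <= 1 - c1 / 4].
Proof.
move=> /andP[c0 c01] B0 C0.
pose M := Num.max 1 (2 * C * B / c1).
have M1 : 1 <= M by rewrite /M le_max lexx.
have M0 : 0 < M by exact: lt_le_trans M1.
have h : C / M * B <= c1 / 2.
  have : 2 * C * B / c1 <= M by rewrite /M le_max lexx orbT.
  rewrite ler_pdivrMr // => h.
  have -> : C / M * B = (2 * C * B) / (2 * M) by field; rewrite gt_eqF.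
  rewrite ler_pdivrMr ?mulr_gt0 //; lra.
(* c1 / 28 is small enough for (1 + de)^3 <= 1 + c1 / 4, and (1 + c1 / 4) (1 - c1 / 2) is at most 1
   - c1 / 4. *)
exists M, (c1 / 28); split => //; first by rewrite divr_gt0.
have CM : 0 <= C / M * B by rewrite mulr_ge0 ?divr_ge0 // ltW.
apply: (@le_trans _ _ ((1 + c1 / 28) ^+ 3 * (1 - c1 / 2))).
  by apply: ler_wpM2l; [apply: exprn_ge0; lra|lra].
have h3 : (1 + c1 / 28) ^+ 3 <= 1 + c1 / 4.
  have q2 : c1 ^+ 2 <= c1 by rewrite expr2 ler_piMl // ltW.
  have q3 : c1 ^+ 3 <= c1 by rewrite exprS (le_trans (ler_wpM2l (ltW c0) q2)) // -expr2.
  have -> : (1 + c1 / 28) ^+ 3 = 1 + 3 / 28 * c1 + 3 / 784 * c1 ^+ 2 + c1 ^+ 3 / 21952 by field.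
  lra.
apply: (@le_trans _ _ ((1 + c1 / 4) * (1 - c1 / 2))).
  by apply: ler_wpM2r => //; lra.
have := sqr_ge0 c1; lra.
Qed.

Lemma walk_ratio_drift : exists M g c g0 : R, [/\ 1 <= M, 0 <= g < 1, 0 <= c, 0 <= g0 &
  (forall k s, \int[P]_w (ratio_of M (step k.+1 (s, zeta k.+1 w)))%:E <=
    (g * ratio_of M s + c)%:E)%E /\
  (forall s, \int[P]_w (ratio_of M (step 0 (s, zeta 0 w)))%:E <= (g0 * ratio_of M s + c)%:E)%E].
Proof.
have [e0 [p [/andP[e00 e01] /andP[p0 p1] pe Hgood]]] := good_event_lb noisy.
have [th [B [th0 B1 HB]]] := innov_moment om_gt0 noisy.
have B0 : 0 < B by exact: lt_le_trans B1.
pose C := (1 + 2 / (th / 3)) ^+ 6.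
have C0 : 0 < C by rewrite exprn_gt0 // addr_gt0 // !divr_gt0.
pose c1 := (1 - e0 ^+ 4) * p.
have e04 : 0 < 1 - e0 ^+ 4 by rewrite subr_gt0 exprn_ilt1.
have e041 : 1 - e0 ^+ 4 <= 1 by rewrite gerBl exprn_ge0.
have c1b : 0 < c1 <= 1 by rewrite mulr_gt0 //= mulr_ile1 // ltW.
have [M [de [M1 de0 hM]]] := contraction_constants c1b B0 C0.
have M0 : 0 < M by exact: lt_le_trans M1.
pose K1 := (1 + de) ^+ 3; pose K2 := (1 + de^-1) ^+ 3 * 36 * C.
have K10 : 0 <= K1 by rewrite exprn_ge0 // addr_ge0 // ltW.
have K20 : 0 <= K2.
  by apply: mulr_ge0; [apply: mulr_ge0 => //; apply: exprn_ge0|exact: ltW]; rewrite addr_ge0 // invr_ge0 ltW.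
have CM0 : 0 <= C / M by rewrite divr_ge0 // ltW.
have mf : measurable_fun setT (ratio_of M) by exact: measurable_ratio_of.
have mS k s : measurable_fun setT (fun w => ratio_of M (step k (s, zeta k w))).
  exact: (measurableT_comp mf (measurable_step_of _ _ _ om_gt0 hrot k s)).
pose Q k w := expR (th * kick om delta xi k w).
have mQ k : measurable_fun setT (Q k) by apply: measurable_fun_expRM; exact: measurable_kick.
have Q0 k w : 0 <= Q k w by exact: expR_ge0.
have e0b : 0 <= e0 <= 1 by rewrite e00 ltW.
have oneb : 0 <= (1 : R) <= 1 by rewrite ler01 lexx.
exists M, (1 - c1 / 4), (K2 * B), (K1 * (1 + C / M * B)).
have CMB : 0 <= C / M * B by rewrite mulr_ge0 // ltW.
split => //.
- by case/andP: c1b => *; apply/andP; split; lra.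
- by rewrite mulr_ge0 // ltW.
- by rewrite mulr_ge0 // addr_ge0.
split => [k s|s].
- pose G := innov_event eta delta xi k.+1 (eta_le e0) (eta_le 1) `[1, 2]%classic.
  have mG : measurable G by apply: measurable_innov_event; rewrite //; exact: measurable_eta_le.
  set f := ratio_of M s; have f0 : 0 <= f by exact: ratio_of_ge0.
  have key w : ratio_of M (step k.+1 (s, zeta k.+1 w)) <=
      K1 * f - K1 * f * (1 - e0 ^+ 4) * \1_G w + (K1 * f * (C / M) + K2) * Q k.+1 w.
    rewrite indicE.
    apply: (speed_ratio_step th0 e0b M1 de0 (geo_one_step om_gt0 hrot s.1 s.2 (delta k.+1 w)
      (xi k.+1 w) (noise_eta_ball noisy k.+1 w))).
    by rewrite inE => -[].
  have Kf : 0 <= K1 * f by exact: mulr_ge0.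
  have c2 : 0 <= K1 * f * (C / M) + K2 by apply: addr_ge0 => //; exact: mulr_ge0.
  have c10 : 0 <= K1 * f * (1 - e0 ^+ 4) <= K1 * f.
    by rewrite ler_piMr // andbT mulr_ge0 // ltW.
  apply: le_trans (expectation_affine_le (mS k.+1 s) (mQ k.+1) mG (fun w => ratio_of_ge0 _ _) (Q0 k.+1) c10 c2
    (Hgood k.+1) (HB k.+1) key) _.
  rewrite lee_fin; have := ler_wpM2r f0 hM; rewrite -/K1.
  by rewrite /c1; move: (C / M) => u; lra.
(* The initial flight has no dissipation: the same estimate is used with [e0 = 1] and an empty good
   event. *)
- have mG : measurable (set0 : set T) by exact: measurable0.
  set f := ratio_of M s; have f0 : 0 <= f by exact: ratio_of_ge0.
  have key w : ratio_of M (step 0 (s, zeta 0 w)) <=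
      K1 * f - 0 * \1_set0 w + (K1 * f * (C / M) + K2) * Q 0 w.
    have [e [b st]] := walk_one_step om_gt0 hrot noisy 0 s w.
    have := @speed_ratio_step _ th 1 M de th0 oneb M1 de0 _ _ _ _ _ _ _ _ false st.
    by rewrite mulr0 mul0r; apply.
  have Kf : 0 <= K1 * f by exact: mulr_ge0.
  have c2 : 0 <= K1 * f * (C / M) + K2 by apply: addr_ge0 => //; exact: mulr_ge0.
  have c10 : 0 <= (0 : R) <= K1 * f by rewrite lexx Kf.
  have P0 : (0%:E <= P set0)%E by exact: measure_ge0.
  apply: le_trans (expectation_affine_le (mS 0 s) (mQ 0) mG (fun w => ratio_of_ge0 _ _) (Q0 0) c10 c2
    P0 (HB 0) key) _.
  by rewrite lee_fin; move: (C / M) => u; lra.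
Qed.

Lemma walk_ratio_bounded : exists M C : R, [/\ 1 <= M, 0 <= C &
  forall n, (\int[P]_w (ratio_of M (S n.+1 w))%:E <= C%:E)%E].
Proof.
have [M [g [c [g0 [M1 /andP[gg0 g1] c0 g00 [Hd H0]]]]]] := walk_ratio_drift.
have M0 : 0 < M by exact: lt_le_trans M1.
have mf : measurable_fun setT (ratio_of M) by exact: measurable_ratio_of.
have f0 := ratio_of_ge0 M.
pose A := g0 * ratio_of M (x0, v0) + c.
have A0 : 0 <= A by rewrite addr_ge0 // mulr_ge0.
have g1' : 0 < 1 - g by rewrite subr_gt0.
have c1 : 0 <= c / (1 - g) by rewrite divr_ge0 // ltW.
exists M, (A + c / (1 - g)); split => //; first exact: addr_ge0.
elim=> [|n IH].
  have h := walk_drift x0 v0 om_gt0 hrot hinnov mf f0 g00 c0 H0.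
  apply: (le_trans h); rewrite (integral_prob_cst P (ratio_of M (x0, v0))) -EFinM -EFinD lee_fin.
  by rewrite lerDl.
have h := walk_drift x0 v0 om_gt0 hrot hinnov mf f0 gg0 c0 (Hd n).
have gE : (0 <= g%:E)%E by rewrite lee_fin.
apply: (le_trans h); apply: (le_trans (leeD2r _ (lee_wpmul2l gE IH))).
rewrite -EFinM -EFinD lee_fin.
have : g * A <= A by rewrite ler_piMl // ltW.
have -> : g * (A + c / (1 - g)) + c = g * A + c / (1 - g) by field; rewrite gt_eqF.
by rewrite lerD2r.
Qed.

End slow_relative_speed.

(** * Orders of growth along almost every path *)

Section regular_paths.
Variable R : realType.
Implicit Types (r a z : nat -> R).

Definition negligible_wrt r a : Prop :=
  forall e : R, 0 < e -> exists N, forall n, (N <= n)%N -> a n <= e * r n.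

Definition at_least_linear r : Prop :=
  exists2 b : R, 0 < b & exists N, forall n, (N <= n)%N -> b * n%:R < r n.

Lemma nat_above (x : R) : exists n, forall m, (n <= m)%N -> x <= m%:R.
Proof.
exists (Num.bound `|x|) => m nm; apply: le_trans (ler_norm x) _.
by apply: ltW; apply: lt_le_trans (archi_boundP (normr_ge0 x)) _; rewrite ler_nat.
Qed.

Lemma at_least_linear_large r (A : R) : at_least_linear r ->
  exists N, forall n, (N <= n)%N -> A <= r n.
Proof.
move=> [b b0 [N HN]].
have [N1 HN1] := nat_above (A / b).
exists (maxn N N1) => n; rewrite geq_max => /andP[Nn An].
apply: le_trans (ltW (HN n Nn)); rewrite mulrC -ler_pdivrMr //.
exact: HN1.
Qed.

(** As n is at most a constant times [r n], the hypothesis bounds [a n ^+ 2] by [r n ^+ 2] times a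
    constant over [m.+1]. *)
Lemma negligible_of_sqr r a M : at_least_linear r -> (forall n, 0 <= a n) -> 0 <= M ->
  (forall m, exists N, forall n, (N <= n)%N -> a n ^+ 2 <= n%:R / m.+1%:R * (M + r n)) ->
  negligible_wrt r a.
Proof.
move=> lin a0 M0 H e e0; have [b b0 [N1 HN1]] := lin.
have [N2 HN2] := at_least_linear_large (Num.max M 0) lin.
have [m Hm] := nat_above (2 / (b * e ^+ 2)).
have [N3 HN3] := H m.
have be0 : 0 < b * e ^+ 2 by rewrite mulr_gt0 // exprn_gt0.
have hm : 2 / (b * e ^+ 2) <= m.+1%:R.
  exact: Hm.
exists (maxn N1 (maxn N2 N3)) => n; rewrite !geq_max => /and3P[n1 n2 n3].
have r1 := HN1 n n1; have := HN2 n n2; rewrite ge_max => /andP[rM r0].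
have h := HN3 n n3.
have m0 : 0 < m.+1%:R :> R by [].
have e_r : 0 <= e * r n by rewrite mulr_ge0 // ltW.
apply: ler_of_sqr => //; apply: (le_trans h).
have h1 : n%:R / m.+1%:R <= e ^+ 2 / 2 * r n.
  rewrite ler_pdivrMr //.
  have h2 : 1 / b <= e ^+ 2 / 2 * m.+1%:R.
    move: hm; rewrite ler_pdivrMr // ler_pdivrMr // => hm; lra.
  have h3 : n%:R <= r n / b by rewrite ler_pdivlMr // mulrC ltW.
  apply: (le_trans h3); rewrite mulrAC mulrC.
  by apply: ler_wpM2r => //; rewrite -div1r.
have h4 : M + r n <= 2 * r n by lra.
have h5 : 0 <= n%:R / m.+1%:R :> R by rewrite divr_ge0.
have h6 : 0 <= M + r n by rewrite addr_ge0.
apply: (le_trans (ler_pM h5 h6 h1 h4)).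
by rewrite le_eqVlt; apply/orP; left; apply/eqP; field.
Qed.

Lemma negligible_of_sqr_linear r a C : at_least_linear r -> (forall n, 0 <= a n) ->
  (exists N, forall n, (N <= n)%N -> a n ^+ 2 <= C * n.+1%:R) -> negligible_wrt r a.
Proof.
move=> lin a0 [N HN]; apply: (negligible_of_sqr (M := 0) lin a0) => // m.
have [N1 HN1] := at_least_linear_large (Num.max 0 (2 * C * m.+1%:R)) lin.
exists (maxn N (maxn N1 1)) => n; rewrite !geq_max => /and3P[n0 n1 n2].
apply: (le_trans (HN n n0)); have := HN1 n n1; rewrite ge_max => /andP[r0 rC].
have m0 : 0 < m.+1%:R :> R by [].
have [C0|C0] := leP C 0.
  have h1 : C * n.+1%:R <= 0 by rewrite pmulr_lle0.
  by apply: (le_trans h1); rewrite add0r mulr_ge0 // divr_ge0.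
rewrite add0r mulrAC ler_pdivlMr //.
have nn : n.+1%:R <= 2 * n%:R :> R by rewrite -natrM ler_nat mul2n -addnn -addn1 leq_add2l.
apply: (@le_trans _ _ (C * (2 * n%:R) * m.+1%:R)).
  by apply: ler_wpM2r => //; apply: ler_wpM2l => //; exact: ltW.
have -> : C * (2 * n%:R) * m.+1%:R = n%:R * (2 * C * m.+1%:R) by ring.
exact: ler_wpM2l.
Qed.

End regular_paths.

Section almost_every_path.
Context d (T : measurableType d) (R : realType) (P : probability T R).
Variables (lambda sigma om : R) (rot : 'cV[R]_3 -> 'M[R]_3) (x0 v0 : 'cV[R]_3).
Variables (eta delta : nat -> {RV P >-> borel 'cV[R]_3}) (xi : nat -> {RV P >-> R}).
Hypothesis om_gt0 : 0 < om.
Hypothesis hrot : rotation_choice rot.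
Hypothesis noisy : collision_noise lambda sigma eta delta xi.
Let hinnov := walk_innov noisy.
Notation X := (walkX om rot x0 v0 eta delta xi).
Notation S := (walk_state om rot x0 v0 eta delta xi).

Let ae_ratio : exists2 M : R, 1 <= M & {ae P, forall w m, exists N, forall n, (N <= n)%N ->
  spd_of om (S n w) ^+ 2 <= n%:R / m.+1%:R * (M + rho_of om (S n w))}.
Proof.
have [M [C [M1 C0 HC]]] := walk_ratio_bounded x0 v0 om_gt0 hrot noisy.
have M0 : 0 < M by exact: lt_le_trans M1.
exists M => //; apply/ae_foralln => m.
have mS n : measurable_fun setT (fun w => ratio_of om M (S n.+1 w)).
  have mf : measurable_fun setT (ratio_of om M) by exact: measurable_ratio_of.
  by apply: (measurableT_comp mf); exact: measurable_walk_state.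
pose Y n w := (n.+1%:R ^+ 2)^-1 * ratio_of om M (S n.+1 w).
have i0 n : 0 <= (n.+1%:R ^+ 2)^-1 :> R by rewrite invr_ge0 exprn_ge0.
have mY n : measurable_fun setT (Y n) by exact: (measurable_funM (measurable_cst _) (mS n)).
have Y0 n w : 0 <= Y n w by exact: (mulr_ge0 (i0 n) (ratio_of_ge0 _ _ _)).
have EY n : (\int[P]_w (Y n w)%:E <= (C * (n.+1%:R ^+ 2)^-1)%:E)%E.
  rewrite (mulrC C); exact: (expectationZ_le (mS n) (i0 n) (fun w => ratio_of_ge0 _ _ _) (HC n)).
have sum N : \sum_(0 <= n < N) C * (n.+1%:R ^+ 2)^-1 <= C * 2.
  by rewrite -mulr_sumr ler_wpM2l // sum_invsqr_le.
have c0 : 0 < (m.+1%:R ^+ 2)^-1 :> R by rewrite invr_gt0 exprn_gt0.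
have [A [mA PA0 HA]] := ae_eventually_lt mY Y0 c0 EY sum.
exists A; split => // w nw; apply: HA => -[N HN]; apply: nw.
exists N.+1 => -[//|n] Nn; have := HN n Nn; rewrite /Y /ratio_of /speed_ratio.
set a := spd_of _ _; set r := rho_of _ _.
have r0 : 0 < M + r by rewrite ltr_pwDl // rho_of_ge0.
set q := a ^+ 2 / (M + r); have q0 : 0 <= q by rewrite divr_ge0 ?sqr_ge0 // ltW.
have n0 : 0 < n.+1%:R :> R by []; have m0 : 0 < m.+1%:R :> R by [].
rewrite mulrC ltr_pdivrMr ?exprn_gt0 // => h.
have : q <= n.+1%:R / m.+1%:R.
  apply: ler_of_sqr; first by rewrite divr_ge0.
  by rewrite [leRHS]expr_div_n; apply: ltW; rewrite [ltRHS]mulrC.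
by rewrite /q ler_pdivrMr.
Qed.

(** Borel-Cantelli gives expR (th k) < (n+1)^2 eventually. The crude bound k <= c expR (th k / 4)
    then yields growth of order [sqrt n], already negligible against a linear one. *)
Let ae_kick : exists C : R, {ae P, forall w, exists N, forall n, (N <= n)%N ->
  kick om delta xi n w ^+ 2 <= C * n.+1%:R}.
Proof.
have [th [B [th0 B1 HB]]] := innov_moment om_gt0 noisy.
pose c := (th / 4)^-1; have c0 : 0 < c by rewrite invr_gt0 divr_gt0.
exists (c ^+ 2).
have mQ n : measurable_fun setT (fun w => expR (th * kick om delta xi n w)).
  by apply: measurable_fun_expRM; exact: measurable_kick.
pose Y n w := (n.+1%:R ^+ 2)^-1 * expR (th * kick om delta xi n w).
have i0 n : 0 <= (n.+1%:R ^+ 2)^-1 :> R by rewrite invr_ge0 exprn_ge0.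
have mY n : measurable_fun setT (Y n) by exact: (measurable_funM (measurable_cst _) (mQ n)).
have Y0 n w : 0 <= Y n w by exact: (mulr_ge0 (i0 n) (expR_ge0 _)).
have EY n : (\int[P]_w (Y n w)%:E <= (B * (n.+1%:R ^+ 2)^-1)%:E)%E.
  rewrite (mulrC B); exact: (expectationZ_le (mQ n) (i0 n) (fun w => expR_ge0 _) (HB n)).
have sum N : \sum_(0 <= n < N) B * (n.+1%:R ^+ 2)^-1 <= B * 2.
  by rewrite -mulr_sumr ler_wpM2l // ?sum_invsqr_le // (le_trans _ B1).
have [A [mA PA0 HA]] := ae_eventually_lt mY Y0 ltr01 EY sum.
exists A; split => // w nw; apply: HA => -[N HN]; apply: nw.
exists N => n Nn; have := HN n Nn; rewrite /Y.
have k0 := kick_ge0 delta xi om_gt0 n w; set k := kick _ _ _ _ _ in k0 *.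
have n0 : 0 < n.+1%:R :> R by [].
rewrite mulrC ltr_pdivrMr ?exprn_gt0 // mul1r.
have -> : th * k = 4%:R * (th / 4 * k) by field.
rewrite expRM_natl (exprM _ 2 2) => h.
have h2 : expR (th / 4 * k) ^+ 2 <= n.+1%:R by apply: ler_of_sqr => //; exact: ltW.
have h3 : k <= expR (th / 4 * k) * c by apply: le_expR_div; rewrite divr_gt0.
apply: (@le_trans _ _ ((expR (th / 4 * k) * c) ^+ 2)).
  by rewrite ler_sqr ?nnegrE // (le_trans k0).
by rewrite exprMn mulrC ler_wpM2l // sqr_ge0.
Qed.

Lemma ae_regular_path : exists2 beta : R, 0 < beta &
  {ae P, forall w, [/\ exists N, forall n, (N <= n)%N -> beta * n%:R < radial (X n w),
    at_least_linear (fun n => rho_of om (S n w)),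
    negligible_wrt (fun n => rho_of om (S n w)) (fun n => spd_of om (S n w)) &
    negligible_wrt (fun n => rho_of om (S n w)) (fun n => kick om delta xi n w)]}.
Proof.
have [beta b0 H1] := ae_linear_escape x0 v0 om_gt0 hrot noisy.
have [M M1 H2] := ae_ratio; have [C H3] := ae_kick.
exists beta => //; apply: filterS3 H1 H2 H3 => w h1 h2 h3.
have lin : at_least_linear (fun n => rho_of om (S n w)).
  exists (om * beta); first exact: mulr_gt0.
  by have [N HN] := h1; exists N => n Nn; rewrite -mulrA ltr_pM2l //; exact: HN.
split => //.
- apply: (negligible_of_sqr lin _ _ h2); last by rewrite (le_trans _ M1).
  by move=> n; exact: spd_of_ge0.
- by apply: (negligible_of_sqr_linear lin _ h3) => n; exact: kick_ge0.
Qed.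

End almost_every_path.

(** * Continuous time *)

(** By conservation a'^2 is at most c r^2 + 3 c r^2, and r is at most 2 r'; the factor 1/16 turns
    this into e^2 r'^2. *)
Lemma slow_flight_bound (R : realType) (c e r r' b a' : R) : 0 < c <= 1 / 2 ->
  c <= e ^+ 2 / 16 -> 0 < e -> 0 < r -> 0 <= b <= c * r -> `|r' - r| <= c * r ->
  a' ^+ 2 - b ^+ 2 = r' ^+ 2 - r ^+ 2 -> a' <= e * r' /\ r / 2 <= r'.
Proof.
move=> /andP[c0 c2] ce e0 r0 /andP[b0 hb] /ler_normlP[d1 d2] en.
have cr0 : 0 <= c * r by rewrite mulr_ge0 // ltW.
have cr : c * r <= 1 / 2 * r by rewrite ler_wpM2r // ltW.
have hr' : r / 2 <= r' by lra.
have r'0 : 0 < r' by apply: lt_le_trans hr'; rewrite divr_gt0.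
split => //.
apply: ler_of_sqr; first by rewrite mulr_ge0 // ltW.
have hb2 : b ^+ 2 <= c * r * r.
  apply: (@le_trans _ _ ((c * r) * (c * r))); first by rewrite expr2; exact: ler_pM.
  by rewrite ler_wpM2l //; lra.
have hd : r' ^+ 2 - r ^+ 2 <= c * r * (3 * r).
  have [le|gt] := leP r' r.
    have h1 : r' ^+ 2 <= r ^+ 2 by rewrite ler_sqr ?nnegrE // ltW.
    have h2 : 0 <= c * r * (3 * r) by rewrite mulr_ge0 // mulr_ge0 // ltW.
    by lra.
  by rewrite subr_sqr; apply: ler_pM; lra.
have h4 : r ^+ 2 <= 4 * r' ^+ 2.
  have -> : 4 * r' ^+ 2 = (2 * r') ^+ 2 by ring.
  by rewrite ler_sqr ?nnegrE ?mulr_ge0 ?(ltW r'0) ?(ltW r0) //; lra.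
have h5 : c * r ^+ 2 <= e ^+ 2 / 16 * (4 * r' ^+ 2).
  by apply: ler_pM => //; [exact: ltW|exact: sqr_ge0].
by rewrite exprMn; move: en hb2 hd h5; rewrite !expr2; lra.
Qed.

Section along_a_path.
Context d (T : measurableType d) (R : realType) (P : probability T R).
Variables (lambda sigma om : R) (rot : 'cV[R]_3 -> 'M[R]_3) (x0 v0 : 'cV[R]_3).
Variables (eta delta : nat -> {RV P >-> borel 'cV[R]_3}) (xi : nat -> {RV P >-> R}).
Hypothesis om_gt0 : 0 < om.
Hypothesis hrot : rotation_choice rot.
Hypothesis noisy : collision_noise lambda sigma eta delta xi.
Variable w : T.
Notation X k := (walkX om rot x0 v0 eta delta xi k w).
Notation V k := (walkV om rot x0 v0 eta delta xi k w).
Notation Tm k := (walkT om rot x0 v0 eta delta xi k w).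
Notation S k := (walk_state om rot x0 v0 eta delta xi k w).
Notation rho := (fun k => rho_of om (S k)).
Notation kck := (fun k => kick om delta xi k w).
Notation tau k := (free_time om (X k) (V k) (xi k w)).
Let om_ge0 : 0 <= om. Proof. exact: ltW. Qed.

Hypothesis lin : at_least_linear rho.
Hypothesis slow : negligible_wrt rho (fun k => spd_of om (S k)).
Hypothesis quiet : negligible_wrt rho kck.

Let rhoE k : rho_of om (S k) = potential om (X k). Proof. by []. Qed.

Lemma speed_after_collision k : (0 < k)%N ->
  relspeed om (X k) (V k) <= spd_of om (S k) + 2 * kck k.
Proof.
case: k => // k _; rewrite walkVS.
have e1 := noise_eta_ball noisy k.+1 w.
apply: le_trans (enorm_collide om _ _ _ hrot (ltW e1)) _.
apply: lerD; first by apply: ler_piMl; [exact: enorm_ge0|exact: ltW].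
by apply: ler_wpM2l => //; rewrite /kick lerDr noise_ge0.
Qed.

Lemma eventually_slow_flight (e : R) : 0 < e -> exists N, forall k, (N <= k)%N ->
  [/\ 0 < rho k, relspeed om (X k) (V k) <= e * rho k & kck k <= e * rho k].
Proof.
move=> e0; have e3 : 0 < e / 3 by rewrite divr_gt0.
have [N1 H1] := slow e3; have [N2 H2] := quiet e3; have [N3 H3] := at_least_linear_large 1 lin.
exists (maxn 1 (maxn N1 (maxn N2 N3))) => k; rewrite !geq_max => /and4P[k0 k1 k2 k3].
have r1 : 1 <= rho k by exact: H3.
have r0 : 0 < rho k by exact: lt_le_trans r1.
have h1 := H1 k k1; have h2 := H2 k k2.
have er : 0 <= e * rho k by rewrite mulr_ge0 // ltW.
split => //.
  by apply: le_trans (speed_after_collision k0) _; move: h1 h2; move: (rho k) (spd_of _ _) (kick _ _ _ _ _) => r a z; lra.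
by apply: (le_trans h2); rewrite ler_wpM2r ?(ltW r0) // ler_pdivrMr //; lra.
Qed.

Lemma flight_ratio_small (e : R) : 0 < e -> exists N, forall k s, (N <= k)%N -> 0 <= s <= tau k ->
  relspeed om (X k + s *: V k) (V k) <= e * potential om (X k + s *: V k) /\
  rho k / 2 <= potential om (X k + s *: V k).
Proof.
move=> e0; pose c := Num.min (1 / 2) (e ^+ 2 / 16).
have c0 : 0 < c by rewrite lt_min divr_gt0 //= divr_gt0 // exprn_gt0.
have c2 : c <= 1 / 2 by rewrite ge_min lexx.
have ce : c <= e ^+ 2 / 16 by rewrite ge_min lexx orbT.
have [N HN] := eventually_slow_flight c0.
exists N => k s Nk hs; have [r0 hb hz] := HN k Nk.
have hp := potential_flight om_gt0 hs.
have hn : noise om (xi k w) <= kck k by rewrite /kick lerDl enorm_ge0.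
apply: (slow_flight_bound (c := c) (b := relspeed om (X k) (V k))) => //.
- by rewrite c0.
- by rewrite relspeed_ge0.
- exact: le_trans hp (le_trans hn hz).
- exact: relspeed_flight.
Qed.

(* Eventually both the relative speed and om xi are at most rho, so that covering the distance
   xi takes a time of order xi / rho >= (rho' - rho) / (om rho). *)
Lemma flight_time_ge : exists2 c : R, 0 < c & exists N, forall k, (N <= k)%N ->
  0 < rho k /\ c * (ln (rho k.+1) - ln (rho k)) <= tau k.
Proof.
(* The last term keeps [t0] at most 1; the others bound the mean relative speed over a flight no
   longer than 1 by C rho. *)
pose C := 1 + 2 * om + om^-1.
have oi0 : 0 < om^-1 by rewrite invr_gt0.
have C0 : 0 < C by rewrite !addr_gt0 // mulr_gt0.
have C1 : om^-1 <= C by rewrite /C lerDr addr_ge0 ?mulr_ge0.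
have C2 : 1 + 2 * om <= C by rewrite /C lerDl ltW.
exists (om * C)^-1; first by rewrite invr_gt0 mulr_gt0.
have [N HN] := eventually_slow_flight ltr01.
exists N => k Nk; have [r0 hb hz] := HN k Nk; have [r'0 _ _] := HN k.+1 (leqW Nk).
split => //; rewrite !mul1r in hb hz.
pose m := Num.max (xi k w) 0.
have m0 : 0 <= m by rewrite /m le_max lexx orbT.
have hn : noise om (xi k w) <= rho k by apply: le_trans hz; rewrite /kick lerDl enorm_ge0.
have hpf := potential_fly om_gt0 (X k) (V k) (xi k w).
have hv := velocity_le om_gt0 (X k) (V k).
have nd := potential_gt0_nondegenerate (v := V k) r0.
rewrite -walkXS in hpf; rewrite !rhoE in r0 r'0 hb hn *.
have {hpf}/ler_normlP[_ hpf] := hpf.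
move: hpf hv nd hn hb r0 r'0; rewrite /noise -/m.
set r := potential om (X k); set r' := potential om (X k.+1); set b := relspeed om _ _.
move=> hpf hv nd hn hb r0 r'0.
have Cr0 : 0 < C * r by rewrite mulr_gt0.
pose t0 := m / (C * r).
have t00 : 0 <= t0 by rewrite divr_ge0 // ltW.
have t01 : t0 <= 1.
  rewrite /t0 ler_pdivrMr // mul1r.
  have : m <= om^-1 * r by rewrite mulrC ler_pdivlMr // mulrC.
  by move=> h; apply: (le_trans h); rewrite ler_wpM2r // ltW.
have ht : t0 <= tau k.
  rewrite leNgt; apply/negP => lt.
  have [xi0|xi0] := leP (xi k w) 0.
    move: lt; rewrite /t0 /m (max_idPr xi0) mul0r; apply/negP; rewrite -leNgt; exact: free_time_ge0.
  have K := free_timeK om_gt0 nd (ltW xi0).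
  have tg := free_time_ge0 om (X k) (V k) (xi k w).
  have := rel_dist_le (X k) (V k) om_ge0 tg.
  rewrite K -/(relspeed om (X k) (V k)) -/b; move: lt tg; set s := free_time _ _ _ _ => lt tg h.
  have mE : m = xi k w by rewrite /m; apply/max_idPl; exact: ltW.
  have h1 : b + s * (om * enorm (V k)) <= C * r.
    have h2 : s * (om * enorm (V k)) <= 1 * (om * (2 * r)).
      apply: ler_pM => //; first by rewrite mulr_ge0 ?enorm_ge0.
        by rewrite ltW // (lt_le_trans lt).
      by rewrite ler_wpM2l //; lra.
    by have := ler_wpM2r (ltW r0) C2; lra.
  have h3 := ler_wpM2l tg h1.
  have : s * (C * r) < m by rewrite -ltr_pdivlMr.
  by rewrite mE; lra.
apply: le_trans ht; rewrite mulrC ler_pdivrMr ?mulr_gt0 //.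
have -> : t0 * (om * C) = om * m / r by rewrite /t0; field; rewrite !gt_eqF.
have h6 : ln r' - ln r <= r' / r - 1.
  have h7 := expR_ge1Dx (ln r' - ln r).
  by rewrite expRB !lnK ?posrE // in h7; lra.
apply: (le_trans h6); rewrite -(ler_pM2r r0) mulrBl !divfK ?gt_eqF //; lra.
Qed.

Lemma walkT_mono m n : (m <= n)%N -> Tm m <= Tm n.
Proof.
elim: n => [|n IH]; first by rewrite leqn0 => /eqP ->.
rewrite leq_eqVlt => /orP[/eqP -> //|mn]; apply: le_trans (IH mn) _.
by rewrite walkTS lerDl free_time_ge0.
Qed.

Lemma walkT_unbounded (A : R) : exists n, A <= Tm n.
Proof.
have [c c0 [N HN]] := flight_time_ge.
have tele j : c * (ln (rho (N + j)%N) - ln (rho N)) <= Tm (N + j)%N - Tm N.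
  elim: j => [|j IH]; first by rewrite addn0 !subrr mulr0.
  have [_ h] := HN (N + j)%N (leq_addr _ _).
  rewrite addnS walkTS; move: h IH => /=.
  move: (ln (rho_of _ (S (N + j).+1))) (ln (rho_of _ (S (N + j)%N))) (ln (rho_of _ (S N))) => u v t.
  by move: (free_time _ _ _ _) (Tm (N + j)%N) (Tm N) => a b e; lra.
have [N1 HN1] := at_least_linear_large (expR ((A - Tm N) / c + ln (rho N))) lin.
exists (N + N1)%N; have h1 := HN1 (N + N1)%N (leq_addl _ _).
have [r0 _] := HN (N + N1)%N (leq_addr _ _).
have h2 : (A - Tm N) / c + ln (rho N) <= ln (rho (N + N1)%N).
  by rewrite -ler_expR lnK // posrE.
have h3 := tele N1.
have h4 : c * ((A - Tm N) / c) <= c * (ln (rho (N + N1)%N) - ln (rho N)).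
  by rewrite ler_pM2l // lerBrDr.
rewrite mulrC divfK ?gt_eqF // in h4.
have := le_trans h4 h3; rewrite lerD2r; exact.
Qed.

Notation last t := (last_collision om rot x0 v0 (eta^~ w) (delta^~ w) (xi^~ w) t).

(** As collision times are unbounded, the default value of [xget] is not taken: the predecessor of
    the least n with t < T_n qualifies. *)
Lemma last_collisionP (t : R) : 0 <= t -> Tm (last t) <= t < Tm (last t).+1.
Proof.
move=> t0; have [n0 hn0] := walkT_unbounded (t + 1).
have ex : exists n, t < Tm n by exists n0; apply: lt_le_trans hn0; lra.
have [n tn min] := ex_minnP ex.
have : exists k, Tm k <= t < Tm k.+1.
  case: n tn min => [|k] tn min; first by move: tn; rewrite ltNge t0.
  exists k; rewrite tn andbT leNgt; apply/negP => /min.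
  by rewrite ltnn.
move=> [k hk]; exact: (@xgetPex _ 0%N [set j | Tm j <= t < Tm j.+1] (ex_intro _ k hk)).
Qed.

Lemma last_collision_large N : exists2 t0 : R, 0 <= t0 & forall t, t0 <= t -> (N <= last t)%N.
Proof.
have T0 : 0 <= Tm N by have := walkT_mono (leq0n N).
exists (Tm N) => // t Nt; have /andP[_ h] := last_collisionP (le_trans T0 Nt).
rewrite leqNgt; apply/negP => lt; have := walkT_mono lt.
by move: h Nt; move: (Tm N) (Tm _.+1) => a b; lra.
Qed.

Notation Xt t := (path_pos om rot x0 v0 (eta^~ w) (delta^~ w) (xi^~ w) t).
Notation Vt t := (path_vel om rot x0 v0 (eta^~ w) (delta^~ w) (xi^~ w) t).

Lemma path_flight (t : R) : 0 <= t -> exists2 s, 0 <= s <= tau (last t) &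
  Xt t = X (last t) + s *: V (last t).
Proof.
move=> t0; have /andP[h1 h2] := last_collisionP t0.
exists (t - Tm (last t)) => //; rewrite subr_ge0 h1 /= lerBlDl -walkTS; exact: ltW.
Qed.

Lemma path_radial_unbounded (A : R) : exists2 t0 : R, 0 <= t0 & forall t, t0 <= t -> A <= radial (Xt t).
Proof.
have [N HN] := flight_ratio_small ltr01.
have [N1 HN1] := at_least_linear_large (2 * om * A) lin.
have [t0 t00 Ht] := last_collision_large (maxn N N1).
exists t0 => // t tt; have := Ht t tt; rewrite geq_max => /andP[k1 k2].
have [s hs ->] := path_flight (le_trans t00 tt).
have [_ h] := HN _ _ k1 hs; have h1 := HN1 _ k2.
rewrite -(ler_pM2l om_gt0); apply: le_trans h; rewrite ler_pdivlMr //.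
by rewrite mulrC mulrA.
Qed.

Lemma path_ratio_small (e : R) : 0 < e -> exists2 t0 : R, 0 <= t0 & forall t, t0 <= t ->
  enorm (Vt t - rotfield om (Xt t)) / enorm (rotfield om (Xt t)) <= e.
Proof.
move=> e0; have [N HN] := flight_ratio_small e0.
have [t0 t00 Ht] := last_collision_large N.
have [t1 t10 Hr] := path_radial_unbounded 1.
exists (Num.max t0 t1) => [|t]; first by rewrite le_max t00.
rewrite ge_max => /andP[tt0 tt1].
have r1 := Hr t tt1.
have p0 : 0 < om * radial (Xt t) by rewrite mulr_gt0 // (lt_le_trans _ r1).
rewrite enorm_rotfield // ler_pdivrMr //.
have [s hs E] := path_flight (le_trans t00 tt0).
by have [h _] := HN _ _ (Ht t tt0) hs; rewrite E.
Qed.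

Lemma cvg_path_radial : radial (Xt t) @[t --> +oo] --> +oo.
Proof.
apply/cvgryPge => A; have [t0 _ H] := path_radial_unbounded A.
by exists t0; split => [|t /ltW]; [exact: num_real|exact: H].
Qed.

Lemma cvg_path_ratio :
  enorm (Vt t - rotfield om (Xt t)) / enorm (rotfield om (Xt t)) @[t --> +oo] --> (0 : R).
Proof.
apply/cvgrPdist_le => e e0; have [t0 _ H] := path_ratio_small e0.
exists t0; split => [|t /ltW tt]; first exact: num_real.
by rewrite sub0r normrN ger0_norm; [exact: H|rewrite divr_ge0 ?enorm_ge0].
Qed.

End along_a_path.

(** * Convergence in probability and measurability at a fixed time *)

Section convergence_in_probability.
Context d (T : measurableType d) (R : realType) (P : probability T R).

(** Unions over all later times are uncountable, so the limit is tested along sequences tending to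
    infinity. Along each, the upper limit of the events is null, and the decreasing tail unions
    dominate. *)
Lemma cvg_prob0 (B : R -> set T) : (forall t, measurable (B t)) ->
  {ae P, forall w, exists t0, forall t, t0 <= t -> ~ B t w} ->
  P (B t) @[t --> +oo] --> 0%E.
Proof.
move=> mB [A [mA PA0 HA]]; apply/cvge_pinftyP => u uoo.
pose F n := B (u n).
have mF n : measurable (F n) by exact: mB.
have mU n : measurable (\bigcup_(k >= n) F k) by exact: bigcup_measurable.
have L0 : P (lim_sup_set F) = 0%E.
  apply: measure_negligible; first by apply: bigcap_measurable => // k _.
  exists A; split => //; apply: subset_trans HA => w /= Fw [t0 Ht].
  have /cvgryPge/(_ t0)[N _ HN] := uoo.
  have [k /= Nk Fk] := Fw N I.
  exact: (Ht (u k) (HN k Nk)).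
have H : P (\bigcup_(k >= n) F k) @[n --> \oo] --> 0%E.
  rewrite -L0; apply: (lim_sup_set_cvg P F mF).
  exact: (le_lt_trans (probability_le1 P (mU 0%N)) (ltry 1)).
apply: (squeeze_cvge _ (cvg_cst 0%E) H).
apply: nearW => n; rewrite measure_ge0 /=; apply: le_measure; rewrite ?inE //.
by move=> w Fw; exists n => /=.
Qed.

End convergence_in_probability.

Section path_measurability.
Context d (T : measurableType d) (R : realType) (P : probability T R).
Variables (om : R) (rot : 'cV[R]_3 -> 'M[R]_3) (x0 v0 : 'cV[R]_3).
Variables (eta delta : nat -> {RV P >-> borel 'cV[R]_3}) (xi : nat -> {RV P >-> R}).
Hypothesis om_gt0 : 0 < om.
Hypothesis hrot : rotation_choice rot.
Hypothesis hinnov : indep_innov P eta delta xi.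
Variable t : R.
Notation X := (walkX om rot x0 v0 eta delta xi).
Notation V := (walkV om rot x0 v0 eta delta xi).
Notation Tm := (walkT om rot x0 v0 eta delta xi).

Definition last_at w := last_collision om rot x0 v0 (eta^~ w) (delta^~ w) (xi^~ w) t.

Let during k : set T := [set w | Tm k w <= t < Tm k.+1 w].

Let measurable_during k : measurable (during k).
Proof.
have mT j : measurable_fun setT (Tm j) by exact: measurable_walkT.
rewrite (_ : during k = Tm k @^-1` `]-oo, t] `&` Tm k.+1 @^-1` `]t, +oo[).
  by apply: measurableI; apply: measurable_preimage => //; exact: measurable_itv.
apply/seteqP; split => w; rewrite /during /= !in_itv /= andbT => /andP //.
Qed.

Let during_inj j k w : during j w -> during k w -> j = k.
Proof.
suff H i l : during i w -> during l w -> (l <= i)%N.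
  by move=> dj dk; apply/eqP; rewrite eqn_leq !H.
move=> /andP[i1 i2] /andP[l1 l2]; rewrite leqNgt; apply/negP => il.
have := walkT_mono om rot x0 v0 eta delta xi w il.
by move: i2 l1; move: (Tm i.+1 w) (Tm l w) => a b; lra.
Qed.

Let last_at_during k w : during k w -> last_at w = k.
Proof.
move=> dk; apply: during_inj (dk).
exact: (@xgetPex _ 0%N [set j | Tm j w <= t < Tm j.+1 w] (ex_intro _ k dk)).
Qed.

Let last_at0 w : (forall k, ~ during k w) -> last_at w = 0%N.
Proof. by move=> H; apply: xgetPN => k; exact: H. Qed.

(** The events [during k] are disjoint; where none occurs the index takes its default 0, and the map
    is measurable on this remaining piece as well. *)
Lemma measurable_fun_last d' (U : measurableType d') (F : nat -> T -> U) :
  (forall k, measurable_fun setT (F k)) -> measurable_fun setT (fun w => F (last_at w) w).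
Proof.
move=> mF _ B mB; rewrite setTI.
rewrite (_ : _ @^-1` B = (\bigcup_k (during k `&` F k @^-1` B)) `|`
    (~` (\bigcup_k during k) `&` F 0%N @^-1` B)).
  apply: measurableU.
    by apply: bigcup_measurable => k _; apply: measurableI => //; exact: measurable_preimage.
  apply: measurableI; last exact: measurable_preimage.
  by apply: measurableC; exact: bigcup_measurable.
apply/seteqP; split => w /=.
  have [[k dk]|nd] := pselect (exists k, during k w).
    by rewrite (last_at_during dk) => Bw; left; exists k.
  rewrite last_at0 => [Bw|k dk]; last by apply: nd; exists k.
  by right; split => // -[k _ dk]; apply: nd; exists k.
move=> [[k _ [dk Bw]]|[nd Bw]]; first by rewrite (last_at_during dk).
by rewrite last_at0 // => k dk; apply: nd; exists k.
Qed.

Lemma measurable_path_pos : measurable_fun setT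
  (fun w => path_pos om rot x0 v0 (eta^~ w) (delta^~ w) (xi^~ w) t : borel 'cV[R]_3).
Proof.
apply: (@measurable_fun_last _ (borel 'cV[R]_3)
  (fun k w => X k w + (t - Tm k w) *: V k w : borel 'cV[R]_3)) => k.
apply: measurable_fun_addv; first exact: measurable_walkX.
apply: measurable_fun_scalev; last exact: measurable_walkV.
by apply: measurable_funB => //; exact: measurable_walkT.
Qed.

Lemma measurable_path_vel : measurable_fun setT
  (fun w => path_vel om rot x0 v0 (eta^~ w) (delta^~ w) (xi^~ w) t : borel 'cV[R]_3).
Proof.
apply: (@measurable_fun_last _ (borel 'cV[R]_3) (fun k w => V k w : borel 'cV[R]_3)) => k.
exact: measurable_walkV.
Qed.

Lemma measurable_radial_le (M : R) : measurable
  [set w | radial (path_pos om rot x0 v0 (eta^~ w) (delta^~ w) (xi^~ w) t) <= M].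
Proof.
have m := measurable_fun_radial measurable_path_pos.
rewrite (_ : [set w | _] = (fun w => radial (path_pos om rot x0 v0 (eta^~ w) (delta^~ w) (xi^~ w) t)) @^-1` `]-oo, M]).
  by apply: measurable_preimage => //; exact: measurable_itv.
by apply/seteqP; split => w /=; rewrite in_itv.
Qed.

(** The quotient exceeds e exactly when its denominator F is positive and the numerator minus e F is
    positive: a zero denominator gives the quotient 0, which is not above e. *)
Lemma measurable_ratio_gt (e : R) : 0 < e ->
  let Xt w := path_pos om rot x0 v0 (eta^~ w) (delta^~ w) (xi^~ w) t in
  let Vt w := path_vel om rot x0 v0 (eta^~ w) (delta^~ w) (xi^~ w) t in
  measurable [set w | e < `|enorm (Vt w - rotfield om (Xt w)) / enorm (rotfield om (Xt w)) - 0|].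
Proof.
move=> e0 Xt Vt.
have mF : measurable_fun setT (fun w => enorm (rotfield om (Xt w))).
  by apply: measurable_fun_enorm; apply: measurable_fun_rotfield; exact: measurable_path_pos.
have mU : measurable_fun setT (fun w => enorm (Vt w - rotfield om (Xt w))).
  apply: measurable_fun_enorm; apply: measurable_fun_subv; first exact: measurable_path_vel.
  by apply: measurable_fun_rotfield; exact: measurable_path_pos.
have mG : measurable_fun setT (fun w => enorm (Vt w - rotfield om (Xt w)) - e * enorm (rotfield om (Xt w))).
  by apply: measurable_funB => //; exact: (measurable_funM (measurable_cst _) mF).
rewrite (_ : [set w | _] =
  (fun w => enorm (rotfield om (Xt w))) @^-1` `]0, +oo[ `&`
  (fun w => enorm (Vt w - rotfield om (Xt w)) - e * enorm (rotfield om (Xt w))) @^-1` `]0, +oo[).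
  by apply: measurableI; apply: measurable_preimage => //; exact: measurable_itv.
apply/seteqP; split => w /=; rewrite !in_itv /= !andbT subr0 ger0_norm ?divr_ge0 ?enorm_ge0 //.
  move=> h; have F0 : 0 < enorm (rotfield om (Xt w)).
    rewrite lt_neqAle enorm_ge0 andbT; apply/negP => /eqP F0.
    by move: h; rewrite -F0 invr0 mulr0 => h; have := lt_trans e0 h; rewrite ltxx.
  by split => //; rewrite subr_gt0 -ltr_pdivlMr.
by move=> [F0]; rewrite subr_gt0 ltr_pdivlMr.
Qed.

End path_measurability.

Lemma liminf_events_prob1 (d : measure_display) (T : measurableType d) (R : realType)
    (P : probability T R) (A : nat -> set T) : (forall n, measurable (A n)) ->
  {ae P, forall w, exists N, forall n, (N <= n)%N -> A n w} -> P (liminf_events A) = 1%E.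
Proof.
move=> mA [B [mB PB0 HB]].
have mL : measurable (liminf_events A).
  by apply: bigcup_measurable => n _; apply: bigcap_measurable => //; exists n.+1 => /=.
have L0 : P (~` liminf_events A) = 0%E.
  apply: measure_negligible; first exact: measurableC.
  exists B; split => //; apply: subset_trans HB => w /= nL [N HN]; apply: nL.
  (* The union in [liminf_events] starts at index 1, hence the successor. *)
  by exists N.+1 => // m /= Nm; apply: HN; exact: ltnW (ltnW Nm).
have := probability_setC P (measurableC mL); rewrite setCK => ->.
by rewrite [X in (1 - X)%E]L0 sube0.
Qed.

Theorem theorem1 (R : realType) (d : measure_display) (T : measurableType d)
    (P : probability T R) (lambda sigma : R)
    (eta delta : nat -> {RV P >-> borel 'cV[R]_3}) (xi : nat -> {RV P >-> R})
    (rot : 'cV[R]_3 -> 'M[R]_3) (x0 v0 : 'cV[R]_3)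
    (lambda_gt0 : 0 < lambda) (sigma_gt0 : 0 < sigma)
    (eta_iid : iid eta) (delta_iid : iid delta) (xi_iid : iid xi)
    (indep : independent3 P (sigma_seq eta) (sigma_seq delta) (sigma_seq xi))
    (eta_ball : forall k w, enorm (eta k w : 'cV[R]_3) < 1)
    (eta_supp : interior (msupport (distribution P (eta 0%N) : set 'cV[R]_3 -> \bar R)) !=set0)
    (delta_law : forall k, has_law (delta k) (gaussian3 sigma))
    (xi_law : forall k, has_law (xi k) (exponential_prob lambda))
    (rot_choice : rotation_choice rot)
    (start : radial x0 != 0 \/ v0 != 0)
    (om : R) (om_gt0 : 0 < om) :
  let X n w := walk_pos om rot x0 v0 (eta^~ w) (delta^~ w) (xi^~ w) n in
  let Xt t w := path_pos om rot x0 v0 (eta^~ w) (delta^~ w) (xi^~ w) t in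
  let Vt t w := path_vel om rot x0 v0 (eta^~ w) (delta^~ w) (xi^~ w) t in
  let ratio t w :=
    enorm (Vt t w - rotfield om (Xt t w)) / enorm (rotfield om (Xt t w)) in
  [/\ {ae P, forall w, radial (Xt t w) @[t --> +oo] --> +oo} /\
      cvg_in_prob_pinfty P (fun t w => radial (Xt t w)),
      {ae P, forall w, ratio t w @[t --> +oo] --> 0} /\
      cvg_in_prob P ratio 0 &
      exists beta : R, 0 < beta /\
        P (liminf_events (fun n => [set w | beta * n%:R < radial (X n w)])) = 1%E].
Proof.
move=> X Xt Vt ratio.
have noisy : collision_noise lambda sigma eta delta xi by split.
have hinnov := walk_innov noisy.
have [beta b0 H] := ae_regular_path x0 v0 om_gt0 rot_choice noisy.
have cvgX : {ae P, forall w, radial (Xt t w) @[t --> +oo] --> +oo}.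
  by apply: filterS H => w [_ lin slow quiet];
    apply: (cvg_path_radial om_gt0 rot_choice noisy lin slow quiet).
have cvgR : {ae P, forall w, ratio t w @[t --> +oo] --> 0}.
  by apply: filterS H => w [_ lin slow quiet];
    apply: (cvg_path_ratio om_gt0 rot_choice noisy lin slow quiet).
split.
- split => // M; apply: cvg_prob0 => [t|]; first exact: measurable_radial_le.
  (* [M + 1] excludes equality with [M], and [t0 + 1] is used because the bound holds for times
     strictly beyond [t0]. *)
  apply: filterS cvgX => w /cvgryPge/(_ (M + 1))[t0 [_ Ht]].
  exists (t0 + 1) => t tt /= XM; have := Ht t; rewrite /= => /(_ ltac:(lra)).
  by move: XM; rewrite /Xt; move: (radial _) => r; lra.
- split => // e e0; apply: cvg_prob0 => [t|]; first exact: measurable_ratio_gt.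
  apply: filterS cvgR => w /cvgrPdist_le/(_ e e0)[t0 [_ Ht]].
  exists (t0 + 1) => t tt /=; apply/negP; rewrite -leNgt distrC.
  by apply: Ht; lra.
- exists beta; split => //; apply: liminf_events_prob1.
    move=> n; have m : measurable_fun setT (fun w => radial (X n w)).
      by apply: measurable_fun_radial; exact: (measurable_walkX x0 v0 (om := om)).
    rewrite (_ : [set w | _] = (fun w => radial (X n w)) @^-1` `]beta * n%:R, +oo[).
      by apply: measurable_preimage => //; exact: measurable_itv.
    by apply/seteqP; split => w /=; rewrite in_itv /= andbT.
  by apply: filterS H => w [h _ _ _].
Qed.
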